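(* Let $D\subset\mathbb R^d$ be a bounded Lipschitz domain, $m\in\mathbb N$ with $(d,m)\in\mathcal M$, let $s\in\mathbb N$, $U\subset\mathbb R^s$ open, and let $\delta\ge 1$. Let $a,b:U\to L^\infty(D)$ and $f:U\to V^*$ satisfy the uniform bounds $$1\le a(\boldsymbol x,\boldsymbol y)\le \tfrac{\overline a}{2},\qquad |b(\boldsymbol x,\boldsymbol y)|\le\tfrac{\overline b}{2},\qquad \|f(\boldsymbol y)\|_{V^*}\le\tfrac{\overline f}{2}$$ for all $\boldsymbol y\in U$ and almost all $\boldsymbol x\in D$. Suppose that $a,b$ (as $L^\infty(D)$-valued functions) and $f$ (as a $V^*$-valued function) have continuous partial derivatives of all orders in $\boldsymbol y\in U$, and that there are positive constants $\boldsymbol R=(R_1,\dots,R_s)$ such that for all $\boldsymbol\nu\in\mathbb N_0^s$ and $\boldsymbol y\in U$ $$\|\partial^{\boldsymbol\nu}a(\boldsymbol y)\|_{L^\infty(D)}\le\frac{\overline a}{2}\frac{(|\boldsymbol\nu|!)^\delta}{(2\boldsymbol R)^{\boldsymbol\nu}},\qquad \|\partial^{\boldsymbol\nu}b(\boldsymbol y)\|_{L^\infty(D)}\le\frac{\overline b}{2}\frac{(|\boldsymbol\nu|!)^\delta}{(2\boldsymbol R)^{\boldsymbol\nu}},\qquad \|\partial^{\boldsymbol\nu}f(\boldsymbol y)\|_{V^*}\le\frac{\overline f}{2}\frac{(|\boldsymbol\nu|!)^\delta}{(2\boldsymbol R)^{\boldsymbol\nu}}.$$ Suppose moreover that at least one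 of the following holds: (A) there is a constant $0<\gamma<1$ such that $\dfrac{\overline b}{2}=\dfrac{\gamma}{m\,\overline f^{\,m-1}}$; (B) $b(\boldsymbol x,\boldsymbol y)\ge 0$ for all $\boldsymbol y\in U$ and almost all $\boldsymbol x\in D$, and $m$ is odd. Let $C_A:=1-\gamma$ in case (A) and $C_A:=1$ in case (B). Let $\overline u:=\overline f/(1-\gamma)$ in case (A) with $m=1$, and $\overline u:=\overline f$ in case (A) with $m\ge2$ and in case (B). For $\boldsymbol y\in U$ let $u(\boldsymbol y)\in V$ be the unique function with $\|u(\boldsymbol y)\|_V\le\overline u$ that solves $$C_m^2\int_D a(\boldsymbol y)\nabla u(\boldsymbol y)\cdot\nabla v+\int_D b(\boldsymbol y)\,u(\boldsymbol y)^m\,v=C_m\int_D f(\boldsymbol y)\,v\qquad\forall v\in V.$$ Then $u$ is of class Gevrey-$\delta$, i.e. $u\in G^\delta(U,V)$. More precisely, with $$C_u:=C_A^{-1}\,\overline u\left(\overline a+\overline b\,\overline u^{\,m-1}+1\right),\qquad \rho:=\max\left\{2,\ \frac{2\overline a+\overline b\left(m\,\overline u^{\,m-1}+(3C_u)^{m-1}(m+1)\right)}{C_A}+1\right\},$$ for all $\boldsymbol\nu\in\mathbb N_0^s\setminus\{\boldsymbol 0\}$ and all $\boldsymbol y\in U$, $$\|\partial^{\boldsymbol\nu}u(\boldsymbol y)\|_V\le\frac{C_u\,\rho^{|\boldsymbol\nu|-1}\left[\tfrac12\right]_{|\boldsymbol\nu|}}{\boldsymbol R^{\boldsymbol\nu}}(|\boldsymbol\nu|!)^{\delta-1}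 \qquad\text{and}\qquad \|\partial^{\boldsymbol\nu}u(\boldsymbol y)\|_{H^1_0(D)}\le\frac{C_u\,\rho^{|\boldsymbol\nu|-1}(|\boldsymbol\nu|!)^\delta}{C_m\,\boldsymbol R^{\boldsymbol\nu}}.$$
   Context: All functions are real-valued; $\nabla$ acts in $\boldsymbol x\in D$, $\partial^{\boldsymbol\nu}$ in $\boldsymbol y$. The set $\mathcal M$ of admissible pairs $(d,m)$: $d\in\{1,2\}$ and $m\ge1$ arbitrary; $d=3$, $1\le m\le5$; $d=4$, $1\le m\le3$; $d\in\{5,6\}$, $1\le m\le2$; $d\ge7$, $m=1$. For these pairs $H^1_0(D)\hookrightarrow L^{m+1}(D)$, and $C_m>0$ is a fixed constant of this embedding: $\|v\|_{L^{m+1}(D)}\le C_m\|v\|_{H^1_0(D)}$ for all $v\in H^1_0(D)$, where $\|v\|_{H^1_0(D)}:=\|\nabla v\|_{L^2(D)}$. $V:=H^1_0(D)$ with norm $\|v\|_V:=C_m\|v\|_{H^1_0(D)}$. $V^*:=H^{-1}(D)$ with norm $\|g\|_{V^*}:=\sup_{0\ne v\in V}\frac{\int_D g\,v}{\|v\|_{H^1_0(D)}}$, where $\int_D g\,v$ denotes the $H^{-1}$–$H^1_0$ duality pairing extending the $L^2(D)$ inner product. The constants $\overline a,\overline b,\overline f$ are fixed, with $\overline f>0$. Multi-index notation: $|\boldsymbol\nu|=\sum_j\nu_j$, $\boldsymbol R^{\boldsymbol\nu}=\prod_jR_j^{\nu_j}$, $(2\boldsymbol R)^{\boldsymbol\nu}=2^{|\boldsymbol\nu|}\boldsymbol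 R^{\boldsymbol\nu}$. $\left[\tfrac12\right]_n:=|(\tfrac12)_n|$, where $(q)_0=1$ and $(q)_n=q(q-1)\cdots(q-n+1)$ for $n\ge1$ is the falling factorial. Gevrey class: for a Banach space $B$ and an open set $U$, $g\in G^\delta(U,B)$ means that all partial derivatives $\partial^{\boldsymbol\nu}g:U\to B$ exist and are continuous, and for each $\boldsymbol y_0\in U$ there are an open neighbourhood $J\subseteq U$ of $\boldsymbol y_0$ and constants $C>0$, $R_j>0$ with $\|\partial^{\boldsymbol\nu}g(\boldsymbol y)\|_B\le C\,\boldsymbol R^{-\boldsymbol\nu}(|\boldsymbol\nu|!)^\delta$ for all $\boldsymbol y\in J$ and all multi-indices $\boldsymbol\nu$. In both cases (A) and (B) the solution with $\|u(\boldsymbol y)\|_V\le\overline u$ exists and is unique. *)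

(* Defs.v *)
From HB Require Import structures.
From mathcomp Require Import all_boot all_order all_algebra.
From mathcomp Require Import all_classical all_reals all_analysis.
From mathcomp Require Import measurable_realfun ess_sup_inf.
From mathcomp Require Import ring.

Set Implicit Arguments.
Unset Strict Implicit.
Unset Printing Implicit Defensive.
Import Order.TTheory GRing.Theory Num.Theory.
Import numFieldNormedType.Exports.

Local Open Scope classical_set_scope.
Local Open Scope ring_scope.

Section rV_borel.
Context (R : realType) (n : nat).
Let G : set (set 'rV[R]_n) := open.

Let borelC (A : set 'rV[R]_n) : <<s G >> A -> <<s G >> (~` A).
Proof. exact: (@sigma_algebraC 'rV[R]_n G A). Qed.

HB.instance Definition _ := @isMeasurable.Build (sigma_display G) 'rV[R]_n
  <<s G >> (@sigma_algebra0 _ setT G) borelC (@sigma_algebra_bigcup _ setT G).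

Lemma open_rV_measurable (A : set 'rV[R]_n) : open A -> measurable A.
Proof. by move=> oA; exact: sub_sigma_algebra. Qed.

End rV_borel.

Section rV_lebesgue.
Context (R : realType).

Section step.
Variable n : nat.

Definition rV_cons (p : R * 'rV[R]_n) : 'rV[R]_n.+1 :=
  \row_i oapp (p.2 0) p.1 (unlift ord0 i).

Definition rV_uncons (v : 'rV[R]_n.+1) : R * 'rV[R]_n :=
  (v 0 ord0, \row_j v 0 (lift ord0 j)).

Lemma rV_cons0 p : rV_cons p 0 ord0 = p.1.
Proof. by rewrite mxE unlift_none. Qed.

Lemma rV_consS p (j : 'I_n) : rV_cons p 0 (lift ord0 j) = p.2 0 j.
Proof. by rewrite mxE (@liftK n.+1 ord0 j). Qed.

Lemma rV_consK : cancel rV_cons rV_uncons.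
Proof.
move=> [x v]; rewrite /rV_uncons rV_cons0.
by congr pair; apply/rowP => j; rewrite mxE rV_consS.
Qed.

Let box (qr : 'rV[rat]_n.+1 * rat) : set 'rV[R]_n.+1 :=
  ball (\row_j (ratr (qr.1 0 j) : R)) (ratr qr.2).

Let open_box (A : set 'rV[R]_n.+1) : open A ->
  A = \bigcup_(qr in [set qr | box qr `<=` A]) box qr.
Proof.
move=> oA; apply/seteqP; split=> [x Ax|x [qr /= sA /sA]//].
have /nbhs_ballP[e /= e0 sA] : nbhs x A by exact: open_nbhs_nbhs.
have [r] := @rat_in_itvoo R 0 (e / 2) (divr_gt0 e0 (ltr0Sn _ 1)).
rewrite in_itv/= => /andP[r_gt0 re].
have q j : {q : rat | `|x 0 j - ratr q| < ratr r}.
  apply: cid; have [|q] := @rat_in_itvoo R (x 0 j - ratr r) (x 0 j + ratr r).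
    by rewrite ltrD2l gtrN.
  by rewrite in_itv/= => qx; exists q; rewrite distrC ltr_distl.
exists (\row_j sval (q j), r) => /=.
- move=> y [_ yq]; apply: sA; split => // i j.
  rewrite /ball/= (ord1 i); have := yq 0 j; rewrite /ball/= !mxE => yqj.
  rewrite (splitr e) -[x 0 j](subrK (ratr (sval (q j)))) -addrA.
  rewrite (le_lt_trans (ler_normD _ _))// ltrD//.
    by rewrite (lt_trans (svalP (q j))).
  by rewrite (lt_trans yqj).
- split => // i j; rewrite (ord1 i) /ball/= !mxE distrC.
  exact: (svalP (q j)).
Qed.

Lemma measurable_rV_cons : measurable_fun [set: R * 'rV[R]_n] rV_cons.
Proof.
apply: (@measurability _ _ _ _ _ _ (@open 'rV[R]_n.+1)) => //.
move=> _ [A oA <-]; rewrite setTI (open_box oA) preimage_bigcup.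
rewrite bigcup_mkcond; apply: countable_bigcupT_measurable => [|[q r]]; first exact: countableP.
case: ifP => // _.
rewrite (_ : _ @^-1` _ = if 0 < ratr r :> R then ball (ratr (q 0 ord0) : R) (ratr r) `*`
    ball (\row_j (ratr (q 0 (lift ord0 j)) : R)) (ratr r) else set0); last first.
  case: ifPn => r0.
  apply/seteqP; split=> [[x v] /= [_ xv]|[x v] /= [xq [_ vq]]].
  - split; first by have := xv 0 ord0; rewrite rV_cons0 mxE.
    split => // i j; rewrite (ord1 i); have := xv 0 (lift ord0 j).
    by rewrite rV_consS !mxE.
  - split => // i j; rewrite (ord1 i).
    have [k ->|->] := unliftP ord0 j.
      by have := vq 0 k; rewrite rV_consS !mxE.
    by rewrite rV_cons0 !mxE.
  by rewrite -subset0 => x [/= r1]; rewrite r1 in r0.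
case: ifPn => r0; last exact: measurable0.
apply: measurableX; first by rewrite ball_itv; exact: measurable_itv.
by apply: open_rV_measurable; exact: ball_open.
Qed.

Lemma measurable_rV_uncons : measurable_fun [set: 'rV[R]_n.+1] rV_uncons.
Proof.
apply/measurable_fun_pairP; split.
- apply: (measurability _ (RGenOpens.measurableE R)).
  move=> _ [_ [a [b ->]] <-]; rewrite setTI; apply: open_rV_measurable.
  by apply: open_comp => // v _; exact: coord_continuous.
- apply: (@measurability _ _ _ _ _ _ (@open 'rV[R]_n)) => //.
  move=> _ [A oA <-]; rewrite setTI; apply: open_rV_measurable.
  apply: open_comp => // v _ B /nbhs_ballP[e /= e0 sB].
  apply/nbhs_ballP; exists e => //= w [_ vw]; apply: sB; split => // i j.
  by rewrite /= !mxE; exact: vw.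
Qed.

Section prepend.
Local Open Scope ereal_scope.
Variable m : {sigma_finite_measure set 'rV[R]_n -> \bar R}.

Definition lebesgue_prepend : set 'rV[R]_n.+1 -> \bar R :=
  pushforward (lebesgue_measure \x m) rV_cons.

Let prepend0 : lebesgue_prepend set0 = 0.
Proof. by rewrite /lebesgue_prepend /pushforward preimage_set0 measure0. Qed.

Let prepend_ge0 A : 0 <= lebesgue_prepend A.
Proof. exact: (measure_ge0 (lebesgue_measure \x m)). Qed.

Let prepend_sigma_additive : semi_sigma_additive lebesgue_prepend.
Proof.
move=> F mF tF mUF; rewrite /lebesgue_prepend /pushforward preimage_bigcup.
have mcons A : measurable A -> measurable (rV_cons @^-1` A).
  by move=> mA; rewrite -[X in measurable X]setTI; exact: measurable_rV_cons.
apply: measure_semi_sigma_additive.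
- by move=> k; exact: mcons.
- apply/trivIsetP => /= i j _ _ ij; rewrite -preimage_setI.
  by move/trivIsetP : tF => /(_ _ _ _ _ ij) ->//; rewrite preimage_set0.
- by rewrite -preimage_bigcup; exact: mcons.
Qed.

HB.instance Definition _ := isMeasure.Build _ _ _ lebesgue_prepend
  prepend0 prepend_ge0 prepend_sigma_additive.

Let prepend_sigma_finite : sigma_finite setT lebesgue_prepend.
Proof.
have /sigma_finiteP[F [FT ndF Foo]] := sigma_finiteT (@lebesgue_measure R).
have /sigma_finiteP[G [GT ndG Goo]] := sigma_finiteT m.
exists (fun k => rV_uncons @^-1` (F k `*` G k)).
  rewrite -preimage_bigcup; apply/esym; rewrite -subTset => v _.
  have [k _ Fk] : (\bigcup_k F k) (rV_uncons v).1 by rewrite -FT.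
  have [l _ Gl] : (\bigcup_k G k) (rV_uncons v).2 by rewrite -GT.
  exists (maxn k l) => //; split.
    by move: Fk; exact/subsetPset/ndF/leq_maxl.
  by move: Gl; exact/subsetPset/ndG/leq_maxr.
move=> k; have [mF Fk] := Foo k; have [mG Gk] := Goo k; split.
  rewrite -[X in measurable X]setTI; apply: measurable_rV_uncons => //.
  exact: measurableX.
rewrite /lebesgue_prepend /pushforward -comp_preimage.
rewrite (_ : rV_uncons \o rV_cons = id); last exact/funext/rV_consK.
by rewrite preimage_id product_measure1E// lte_mul_pinfty// ge0_fin_numE.
Qed.

HB.instance Definition _ := Measure_isSigmaFinite.Build _ _ _ lebesgue_prepend
  prepend_sigma_finite.

End prepend.

End step.

(* Lebesgue measure on R^n, as the n-fold product of the one on R. *)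
Fixpoint lebesgue_rV n : {sigma_finite_measure set 'rV[R]_n -> \bar R} :=
  if n is n'.+1 then lebesgue_prepend (lebesgue_rV n') else \d_(0 : 'rV[R]_0).

End rV_lebesgue.

Record seminorm (R : realType) (E : lmodType R) := Seminorm {
  seminorm_fun :> E -> R ;
  seminormD : forall x y, seminorm_fun (x + y) <= seminorm_fun x + seminorm_fun y ;
  seminormZ : forall a x, seminorm_fun (a *: x) = `|a| * seminorm_fun x }.

(* The normed space obtained from a seminormed one by identifying vectors at
   distance 0. *)
Section normed_quotient.
Context (R : realType) (E : lmodType R) (p : seminorm E).
Local Open Scope quotient_scope.

Lemma seminorm0 : p 0 = 0.
Proof. by rewrite -(scale0r 0) seminormZ normr0 mul0r. Qed.

Lemma seminormN x : p (- x) = p x.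
Proof. by rewrite -scaleN1r seminormZ normrN1 mul1r. Qed.

Lemma seminorm_ge0 x : 0 <= p x.
Proof.
rewrite -(pmulr_rge0 _ (ltr0Sn R 1)) mulr_natl mulr2n -{2}seminormN.
by rewrite -seminorm0 -(subrr x) seminormD.
Qed.

Lemma seminorm_distC x y : p (x - y) = p (y - x).
Proof. by rewrite -seminormN opprB. Qed.

Definition seminorm_eqv (x y : E) := p (x - y) == 0.

Let eqv_refl : reflexive seminorm_eqv.
Proof. by move=> x; rewrite /seminorm_eqv subrr seminorm0. Qed.

Let eqv_sym : symmetric seminorm_eqv.
Proof. by move=> x y; rewrite /seminorm_eqv seminorm_distC. Qed.

Let eqv_trans : transitive seminorm_eqv.
Proof.
move=> y x z /eqP xy /eqP yz; rewrite /seminorm_eqv eq_le seminorm_ge0 andbT.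
by rewrite -(subrK y x) -addrA (le_trans (seminormD _ _ _))// xy yz addr0.
Qed.

Canonical seminorm_eqv_equiv := EquivRel _ eqv_refl eqv_sym eqv_trans.

Definition normed_quot : Type := {eq_quot seminorm_eqv}.
HB.instance Definition _ := Choice.on normed_quot.
HB.instance Definition _ := EqQuotient.on normed_quot.

Implicit Types x y : E.

Definition nclass (x : E) : normed_quot := \pi_normed_quot x.

Lemma nclassP x y : reflect (p (x - y) = 0) (nclass x == nclass y).
Proof. by rewrite /nclass eqmodE; exact: eqP. Qed.

Lemma nclass_repr x : p (repr (nclass x) - x) = 0.
Proof. by apply/nclassP; rewrite /nclass reprK. Qed.

Let zero : normed_quot := nclass 0.
Let add (u v : normed_quot) : normed_quot := nclass (repr u + repr v).
Let opp (u : normed_quot) : normed_quot := nclass (- repr u).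
Let scale (a : R) (u : normed_quot) : normed_quot := nclass (a *: repr u).

Let piE (x y : E) : p (x - y) = 0 -> nclass x = nclass y.
Proof. by move=> xy; apply/eqP/nclassP. Qed.

Let pD x y : p x = 0 -> p y = 0 -> p (x + y) = 0.
Proof.
move=> x0 y0; apply/eqP; rewrite eq_le seminorm_ge0 andbT.
by rewrite (le_trans (seminormD _ _ _))// x0 y0 addr0.
Qed.

Let add_pi x y : add (nclass x) (nclass y) = nclass (x + y).
Proof. by apply: piE; rewrite opprD addrACA; apply: pD; exact: nclass_repr. Qed.

Let opp_pi x : opp (nclass x) = nclass (- x).
Proof. by apply: piE; rewrite -opprD seminormN; exact: nclass_repr. Qed.

Let scale_pi a x : scale a (nclass x) = nclass (a *: x).
Proof. by apply: piE; rewrite -scalerBr seminormZ nclass_repr mulr0. Qed.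

Let quotW (P : normed_quot -> Prop) : (forall x, P (nclass x)) -> forall u, P u.
Proof. by move=> Ppi u; rewrite -[u]reprK; exact: Ppi. Qed.

Let addA : associative add.
Proof. by elim/quotW=> x; elim/quotW=> y; elim/quotW=> z; rewrite !add_pi addrA. Qed.

Let addC : commutative add.
Proof. by elim/quotW=> x; elim/quotW=> y; rewrite !add_pi addrC. Qed.

Let add0 : left_id zero add.
Proof. by elim/quotW=> x; rewrite add_pi add0r. Qed.

Let addN : left_inverse zero opp add.
Proof. by elim/quotW=> x; rewrite opp_pi add_pi addNr. Qed.

HB.instance Definition _ := GRing.isZmodule.Build normed_quot addA addC add0 addN.

Lemma nclassD x y : nclass (x + y) = nclass x + nclass y.
Proof. exact/esym/add_pi. Qed.

Let scaleA a b u : scale a (scale b u) = scale (a * b) u.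
Proof. by elim/quotW: u => x; rewrite !scale_pi scalerA. Qed.

Let scale1 : left_id 1 scale.
Proof. by elim/quotW=> x; rewrite scale_pi scale1r. Qed.

Let scaleDr : right_distributive scale +%R.
Proof.
move=> a; elim/quotW=> x; elim/quotW=> y.
by rewrite -nclassD !scale_pi scalerDr nclassD.
Qed.

Let scaleDl u : {morph scale^~ u : a b / a + b}.
Proof.
by elim/quotW: u => x a b; rewrite !scale_pi scalerDl nclassD.
Qed.

HB.instance Definition _ := GRing.Zmodule_isLmodule.Build R normed_quot
  scaleA scale1 scaleDr scaleDl.

Lemma nclassZ a x : nclass (a *: x) = a *: nclass x.
Proof. exact/esym/scale_pi. Qed.

Let norm (u : normed_quot) : R := p (repr u).

Let norm_pi x : norm (nclass x) = p x.
Proof.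
have le_norm y z : p (y - z) = 0 -> p y <= p z.
  by move=> yz; rewrite -(subrK z y) (le_trans (seminormD _ _ _))// yz add0r.
apply/eqP; rewrite eq_le; apply/andP; split; apply: le_norm.
  exact: nclass_repr.
by rewrite seminorm_distC nclass_repr.
Qed.

Let ler_normD u v : norm (u + v) <= norm u + norm v.
Proof.
elim/quotW: u => x; elim/quotW: v => y.
by rewrite -nclassD !norm_pi seminormD.
Qed.

Let norm_scale a u : norm (a *: u) = `|a| * norm u.
Proof. by elim/quotW: u => x; rewrite -nclassZ !norm_pi seminormZ. Qed.

Let norm_eq0 u : norm u = 0 -> u = 0.
Proof. by elim/quotW: u => x; rewrite norm_pi => x0; apply: piE; rewrite subr0. Qed.

HB.instance Definition _ := Lmodule_isNormed.Build R normed_quot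
  ler_normD norm_scale norm_eq0.

Lemma normed_quot_normE (u : normed_quot) : `|u| = p (repr u).
Proof. by []. Qed.

Lemma nclass_norm x : `|nclass x| = p x.
Proof. exact: norm_pi. Qed.

End normed_quotient.

Section Lp_space.
Context {disp : measure_display} {T : measurableType disp} {R : realType}.
Variables (mu : {measure set T -> \bar R}) (p : \bar R) (p1 : (1 <= p)%E).

Let Lnorm_ae0 (f : T -> R) : measurable_fun [set: T] f ->
  f = 0 %[ae mu] -> ('N[mu]_p[EFin \o f] = 0)%E.
Proof.
move=> mf f0; rewrite unlock /Lnorm; case: p p1 => [r r1|r1|//].
- rewrite (_ : integral _ _ _ = 0)%E; last first.
    rewrite -(integral0 mu setT); apply: ae_eq_integral => //.
      have mg : @measurable_fun _ _ T (\bar R) [set: T] (abse \o (EFin \o f)).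
        by apply: measurableT_comp => //; exact/measurable_EFinP.
      exact: (measurableT_comp (measurable_poweR r) mg).
    apply: filterS f0 => x /(_ Logic.I) /= -> _; rewrite normr0.
    by rewrite powR0// gt_eqF// (lt_le_trans ltr01).
  by rewrite poweR0r// invr_eq0 gt_eqF// (lt_le_trans ltr01).
- case: ifPn => // mu0; rewrite -(ess_sup_cst 0%E mu0); apply: eq_ess_sup.
  by apply: filterS f0 => x /(_ Logic.I) /= ->; rewrite normr0.
Qed.

Let Lp_norm (f : LfunType mu p1) : R := fine ('N[mu]_p[EFin \o f])%E.

Let Lp_normZ a f : Lp_norm (a *: f) = `|a| * Lp_norm f.
Proof.
apply: EFin_inj; rewrite EFinM !finite_norm_fine; exact: LnormZ.
Qed.

Definition Lp_seminorm := Seminorm (@ler_LnormD _ _ _ mu p p1) Lp_normZ.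

Definition Lp : Type := normed_quot Lp_seminorm.
HB.instance Definition _ := NormedModule.on Lp.

Definition Lp_fun (u : Lp) : T -> R := (repr u : LfunType mu p1).

Lemma nclass_ae (f : LfunType mu p1) :
  Lp_fun (nclass Lp_seminorm f) = f %[ae mu].
Proof.
have /fine_Lnormr_eq0 := @nclass_repr _ _ Lp_seminorm f.
by apply: filterS => x /(_ I) /= /eqP; rewrite subr_eq0 => /eqP.
Qed.

Lemma Lp_funD (u v : Lp) : Lp_fun (u + v) = (Lp_fun u \+ Lp_fun v) %[ae mu].
Proof.
by rewrite -[u in Lp_fun (u + _)]reprK -[v in Lp_fun (_ + v)]reprK;
  rewrite -nclassD; exact: nclass_ae.
Qed.

Lemma Lp_funZ a (u : Lp) : Lp_fun (a *: u) = (a \*: Lp_fun u) %[ae mu].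
Proof.
by rewrite -[u in Lp_fun (_ *: u)]reprK -nclassZ; exact: nclass_ae.
Qed.

Lemma Lp_fun_eq0 (u : Lp) : Lp_fun u = 0 %[ae mu] -> u = 0.
Proof.
move=> u0; apply: normr0_eq0; rewrite normed_quot_normE.
apply: EFin_inj; rewrite [LHS]finite_norm_fine.
exact: Lnorm_ae0.
Qed.

End Lp_space.
Coercion Lp_fun : Lp >-> Funclass.

Section partial_derivatives.
Context (R : realType) (n : nat) (B : normedModType R).
Implicit Types (g : 'rV[R]_n -> B) (nu : {ffun 'I_n -> nat}).

Definition partial (j : 'I_n) g : 'rV[R]_n -> B :=
  fun y => 'D_(delta_mx 0 j) g y.

Definition iter_partial (l : seq 'I_n) g : 'rV[R]_n -> B := foldr partial g l.

(* All iterated partial derivatives, in any order, exist and are continuous on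
   U. *)
Definition smooth_on (U : set 'rV[R]_n) g := forall l y, U y ->
  {for y, continuous (iter_partial l g)} /\
  forall j, derivable (iter_partial l g) y (delta_mx 0 j).

Definition mpartial nu g : 'rV[R]_n -> B :=
  iter_partial (flatten [seq nseq (nu j) j | j <- enum 'I_n]) g.

Definition mdeg nu : nat := (\sum_j nu j)%N.

Definition mpow (r : 'I_n -> R) nu : R := \prod_j r j ^+ nu j.

Definition gevrey (delta : R) (U : set 'rV[R]_n) g := smooth_on U g /\
  forall y0, U y0 -> exists J : set 'rV[R]_n, exists C : R,
    exists r : 'I_n -> R,
    [/\ open J, J y0, J `<=` U, 0 < C /\ (forall j, 0 < r j) &
      forall nu y, J y ->
        `|mpartial nu g y| <= C * (mpow r nu)^-1 * (mdeg nu)`!%:R `^ delta].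

Lemma iter_partial_lin (a : R) g h l :
  smooth_on setT g -> smooth_on setT h ->
  iter_partial l (a *: g + h) = a *: iter_partial l g + iter_partial l h.
Proof.
move=> sg sh; elim: l => //= j l ->; apply/funext => y; rewrite /partial.
have [[_ dg] [_ dh]] := (sg l y Logic.I, sh l y Logic.I).
by rewrite deriveD ?deriveZ//; exact: derivableZ.
Qed.

Lemma smooth_lin (a : R) g h :
  smooth_on setT g -> smooth_on setT h -> smooth_on setT (a *: g + h).
Proof.
move=> sg sh l y _; rewrite iter_partial_lin//.
have [[cg dg] [ch dh]] := (sg l y Logic.I, sh l y Logic.I); split.
  by apply: continuousD => //; apply: continuousZr.
by move=> j; apply: derivableD => //; exact: derivableZ.
Qed.

Lemma smooth0 : smooth_on setT (0 : 'rV[R]_n -> B).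
Proof.
have i0 l : iter_partial l (0 : 'rV[R]_n -> B) = 0.
  by elim: l => //= j l ->; apply/funext => y; rewrite /partial (derive_cst 0).
move=> l y _; rewrite i0; split; first exact: cst_continuous.
by move=> j; exact: derivable_cst.
Qed.

End partial_derivatives.

(* Near every boundary point, in suitable orthonormal coordinates x *m Q, the
   set D is the strict epigraph of a Lipschitz function of the coordinates other
   than the k-th one. *)
Definition lipschitz_boundary (R : realType) (d : nat) (D : set 'rV[R]_d) :=
  forall x0, (closure D `\` interior D) x0 ->
  exists r : R, exists Q : 'M[R]_d, exists k : 'I_d,
  exists gam : 'rV[R]_d.-1 -> R,
  [/\ 0 < r, Q *m Q^T = 1%:M, [lipschitz gam z | z in setT] &
    forall x, ball x0 r x -> D x <-> gam (col' k (x *m Q)) < (x *m Q) 0 k].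

Record lipschitz_domain (R : realType) (d : nat) := LipschitzDomain {
  dom :> set 'rV[R]_d ;
  dom_open : open dom ;
  dom_neq0 : dom !=set0 ;
  dom_connected : connected dom ;
  dom_bounded : bounded_set dom ;
  dom_lipschitz : lipschitz_boundary dom }.
Arguments dom_open {R d} _.
Arguments dom_neq0 {R d} _.
Arguments dom_connected {R d} _.
Arguments dom_bounded {R d} _.
Arguments dom_lipschitz {R d} _.

Section spaces.
Context (R : realType) (d : nat) (D : lipschitz_domain R d).

(* L^p(D) is L^p(R^d) for the restriction of Lebesgue measure to D: functions are
   defined on R^d but only matter up to almost everywhere equality on D. *)
Definition lebesgue_on : {measure set 'rV[R]_d -> \bar R} :=
  mrestr (lebesgue_rV R d) (open_rV_measurable (dom_open D)).

Definition Linf : Type := Lp lebesgue_on (leey 1).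
HB.instance Definition _ := NormedModule.on Linf.

Definition L2 : Type := Lp lebesgue_on (lee1n 2).
HB.instance Definition _ := NormedModule.on L2.

(* C_c^oo(D), as functions on R^d. *)
Definition test_function (phi : 'rV[R]_d -> R) := smooth_on setT phi /\
  exists K : set 'rV[R]_d, [/\ compact K, K `<=` D & forall x, ~ K x -> phi x = 0].

Definition L2_pair : Type := (L2 * {ffun 'I_d -> L2})%type.
HB.instance Definition _ := GRing.Lmodule.on L2_pair.

Definition test_pair : set L2_pair := [set w : L2_pair | exists phi,
  [/\ test_function phi, Lp_fun w.1 = phi %[ae lebesgue_on] &
    forall i, Lp_fun (w.2 i) = partial i phi %[ae lebesgue_on]]].

Definition H10_pred : {pred L2_pair} := fun w =>
  `[< forall e : R, 0 < e -> exists z, [/\ test_pair z,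
        `|w.1 - z.1| < e & forall i, `|w.2 i - z.2 i| < e] >].

Let test_pair0 : test_pair 0.
Proof.
exists 0; split.
- by split; [exact: smooth0|exists set0; split => //; exact: compact0].
- have := @Lp_funZ _ _ _ lebesgue_on _ (lee1n 2) 0 0.
  by rewrite scale0r; apply: filterS => x /[apply] /= ->; rewrite scale0r.
- move=> i; rewrite ffunE; have := @Lp_funZ _ _ _ lebesgue_on _ (lee1n 2) 0 0.
  rewrite scale0r; apply: filterS => x /[apply] /= ->.
  by rewrite scale0r /partial (derive_cst 0).
Qed.

Let test_pair_lin a w z : test_pair w -> test_pair z -> test_pair (a *: w + z).
Proof.
move=> [phi [[sphi [K [cK KD phi0]]] wphi wphi']].
move=> [psi [[spsi [L [cL LD psi0]]] zpsi zpsi']].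
exists (a *: phi + psi); split.
- split; first exact: smooth_lin.
  exists (K `|` L); split; [exact: compactU|by rewrite subUset|move=> x].
  move=> /not_orP[Kx Lx]; rewrite -[LHS]/(a * phi x + psi x).
  by rewrite phi0// psi0// mulr0 addr0.
- rewrite [(_ + _).1]/(a *: w.1 + z.1).
  apply: filterS2 (filterI wphi zpsi) (filterI (Lp_funD (a *: w.1) z.1)
    (Lp_funZ a w.1)) => x [wx zx] [Dx Zx] _.
  by rewrite (Dx Logic.I) /= (Zx Logic.I) /= (wx Logic.I) (zx Logic.I).
- move=> i; rewrite [(_ + _).2]/(a *: w.2 + z.2) !ffunE.
  apply: filterS2 (filterI (wphi' i) (zpsi' i))
    (filterI (Lp_funD (a *: w.2 i) (z.2 i)) (Lp_funZ a (w.2 i))).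
  move=> x [wx zx] [Dx Zx] _.
  rewrite (Dx Logic.I) /= (Zx Logic.I) /= (wx Logic.I) (zx Logic.I).
  by rewrite -[RHS]/(iter_partial [:: i] _ x) iter_partial_lin.
Qed.

Let H10_submod_closed : submod_closed H10_pred.
Proof.
split.
  apply/asboolP => e e0; exists 0; split; first exact: test_pair0.
    by rewrite subrr normr0.
  by move=> i; rewrite subrr normr0.
move=> a w z /asboolP wH /asboolP zH; apply/asboolP => e e0.
have a1 : 0 < `|a| + 1 by rewrite ltr_wpDl.
have [w' [tw w1 w2]] := wH _ (divr_gt0 (divr_gt0 e0 (ltr0Sn R 1)) a1).
have [z' [tz z1 z2]] := zH _ (divr_gt0 e0 (ltr0Sn R 1)).
have bound (p p' q q' : L2) : `|p - p'| < e / 2 / (`|a| + 1) ->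
    `|q - q'| < e / 2 -> `|(a *: p + q) - (a *: p' + q')| < e.
  move=> pp qq; rewrite opprD addrACA -scalerBr (splitr e).
  rewrite (le_lt_trans (ler_normD _ _))// ltr_leD// ?(ltW qq)// normrZ.
  rewrite (@le_lt_trans _ _ ((`|a| + 1) * `|p - p'|))//.
    by rewrite ler_wpM2r// lerDl.
  by rewrite mulrC -ltr_pdivlMr.
exists (a *: w' + z'); split; first exact: test_pair_lin.
  exact: bound.
by move=> i; rewrite !ffunE; exact: bound.
Qed.

HB.instance Definition _ := GRing.isSubmodClosed.Build R L2_pair H10_pred
  H10_submod_closed.

(* H^1_0(D) is the closure of C_c^oo(D) in H^1(D); an element is given together
   with its weak gradient, i.e. as a limit of pairs (phi, grad phi) in
   L^2(D) x L^2(D)^d. *)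
Record H10 := H10Elem { H10_val : L2_pair ; _ : H10_val \in H10_pred }.
HB.instance Definition _ := [isSub for H10_val].
HB.instance Definition _ := [Choice of H10 by <:].
HB.instance Definition _ := [SubChoice_isSubLmodule of H10 by <:].

Definition H10_fun (v : H10) : 'rV[R]_d -> R := Lp_fun (H10_val v).1.

Definition grad (v : H10) (i : 'I_d) : L2 := (H10_val v).2 i.

Definition H10_norm (v : H10) : R := Num.sqrt (\sum_i `|grad v i| ^+ 2).

End spaces.
Identity Coercion Lp_of_L2 : L2 >-> Lp.
Identity Coercion Lp_of_Linf : Linf >-> Lp.
Coercion H10_fun : H10 >-> Funclass.

Section energy_norm.
Context (R : realType) (d : nat) (D : lipschitz_domain R d).
Implicit Types v w : H10 D.

Lemma gradD v w i : grad (v + w) i = grad v i + grad w i.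
Proof. by rewrite /grad !ffunE. Qed.

Lemma gradZ a v i : grad (a *: v) i = a *: grad v i.
Proof. by rewrite /grad !ffunE. Qed.

Lemma H10_norm_ge0 v : 0 <= H10_norm v.
Proof. exact: sqrtr_ge0. Qed.

Lemma H10_normZ a v : H10_norm (a *: v) = `|a| * H10_norm v.
Proof.
rewrite /H10_norm -sqrtr_sqr -sqrtrM ?sqr_ge0// mulr_sumr; congr Num.sqrt.
by apply: eq_bigr => i _; rewrite gradZ normrZ exprMn real_normK// num_real.
Qed.

Let cauchy_schwarz (x y : 'I_d -> R) :
  (\sum_i x i * y i) ^+ 2 <= (\sum_i x i ^+ 2) * \sum_i y i ^+ 2.
Proof.
have : 0 <= \sum_i \sum_j (x i * y j - x j * y i) ^+ 2.
  by apply: sumr_ge0 => i _; apply: sumr_ge0 => j _; exact: sqr_ge0.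
have -> : \sum_i \sum_j (x i * y j - x j * y i) ^+ 2 =
    ((\sum_i x i ^+ 2) * (\sum_i y i ^+ 2) - (\sum_i x i * y i) ^+ 2) *+ 2.
  transitivity (\sum_i \sum_j (x i ^+ 2 * y j ^+ 2 + x j ^+ 2 * y i ^+ 2
      - (x i * y i) * (x j * y j) *+ 2)).
    by apply: eq_bigr => i _; apply: eq_bigr => j _; rewrite sqrrB !exprMn; ring.
  under eq_bigr do rewrite sumrB big_split -!mulr_suml -!mulr_sumr /=.
  rewrite sumrB big_split /= -mulr_suml.
  under [X in _ - X]eq_bigr do rewrite sumrMnl -mulr_sumr.
  by rewrite sumrMnl -mulr_suml -mulr_sumr expr2 mulr2n mulrnBl mulr2n.
by rewrite pmulrn_lge0// subr_ge0.
Qed.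

Lemma H10_normD v w : H10_norm (v + w) <= H10_norm v + H10_norm w.
Proof.
rewrite -[leRHS]ger0_norm ?addr_ge0 ?H10_norm_ge0// -sqrtr_sqr.
rewrite ler_wsqrtr// sqrrD !sqr_sqrtr ?sumr_ge0//; try by move=> *; rewrite sqr_ge0.
apply: (@le_trans _ _ (\sum_i (`|grad v i| + `|grad w i|) ^+ 2)).
  apply: ler_sum => i _; rewrite gradD lerXn2r ?nnegrE ?addr_ge0//.
  exact: ler_normD.
under eq_bigr do rewrite sqrrD.
rewrite !big_split /= lerD2r lerD2l -mulr2n lerMn2r /=.
rewrite /H10_norm -sqrtrM; last by apply: sumr_ge0 => i _; exact: sqr_ge0.
by rewrite (le_trans (ler_norm _))// -sqrtr_sqr ler_wsqrtr// cauchy_schwarz.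
Qed.

End energy_norm.

Definition sobolev_embedding (R : realType) (d : nat) (D : lipschitz_domain R d)
    (m : nat) (Cm : R) := forall v : H10 D,
  ('N[lebesgue_on D]_(m.+1%:R%:E)[EFin \o v] <= (Cm * H10_norm v)%:E)%E.

(* H^1_0(D) as a normed space, for the norm C_m ||grad v||_{L^2(D)}; the
   embedding is what makes this norm definite. *)
Section solution_space.
Context (R : realType) (d : nat) (D : lipschitz_domain R d) (m : nat) (Cm : R).
Context (Cm_gt0 : 0 < Cm) (Cm_emb : sobolev_embedding D m Cm).

Definition solution_space of 0 < Cm & sobolev_embedding D m Cm : Type := H10 D.
Local Notation V := (solution_space Cm_gt0 Cm_emb).
HB.instance Definition _ := GRing.Lmodule.on V.

Let norm (v : V) : R := Cm * H10_norm v.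

Let norm_triangle (v w : V) : norm (v + w) <= norm v + norm w.
Proof. by rewrite /norm -mulrDr ler_pM2l//; exact: H10_normD. Qed.

Let norm_scale a (v : V) : norm (a *: v) = `|a| * norm v.
Proof. by rewrite /norm mulrCA; congr (_ * _); exact: H10_normZ. Qed.

Let norm_eq0 (v : V) : norm v = 0 -> v = 0.
Proof.
move=> nv0; apply/val_inj => /=.
have v0 : H10_norm v = 0 by move/eqP: nv0; rewrite mulf_eq0 gt_eqF//= => /eqP.
rewrite [LHS]surjective_pairing; congr pair.
  apply: Lp_fun_eq0; have := Cm_emb v; rewrite v0 mulr0 => N0.
  have /Lnorm_eq0_eq0 : 'N[lebesgue_on D]_(m.+1%:R%:E)[EFin \o H10_fun v]%E = 0%E.
    by apply/eqP; rewrite eq_le N0 Lnorm_ge0.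
  move=> /(_ _ _)H; apply: filterS (H _ _) => [x /(_ Logic.I)[]//||].
    exact/measurable_EFinP.
  by rewrite lte_fin ltr0Sn.
apply/ffunP => i; rewrite [RHS]ffunE; apply/eqP; rewrite -normr_eq0 -sqrf_eq0.
move/eqP: v0; rewrite sqrtr_eq0 => s0.
have /psumr_eq0P -> // : \sum_i `|grad v i| ^+ 2 = 0.
  by apply/eqP; rewrite eq_le s0 sumr_ge0// => *; exact: sqr_ge0.
Qed.

HB.instance Definition _ := Lmodule_isNormed.Build R V
  norm_triangle norm_scale norm_eq0.

End solution_space.

Section dual_space.
Context (R : realType) (d : nat) (D : lipschitz_domain R d).

Definition dual_pred : {pred H10 D -> R^o} := fun l =>
  `[< (forall a v w, l (a *: v + w) = a *: l v + l w) /\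
      exists K, forall v, `|l v| <= K * H10_norm v >].

Let dual_submod_closed : submod_closed dual_pred.
Proof.
split.
  apply/asboolP; split=> [a v w|]; first by rewrite /= scaler0 addr0.
  by exists 0 => v; rewrite mul0r normr0.
move=> a k l /asboolP[klin [K kK]] /asboolP[llin [L lL]]; apply/asboolP; split.
  move=> b v w; rewrite -![(a *: k + l) _]/(a * k _ + l _) klin llin.
  by rewrite -![_ *: _]/(_ * _); ring.
exists (`|a| * K + L) => v; rewrite -[(a *: k + l) v]/(a * k v + l v).
rewrite (le_trans (ler_normD _ _))// mulrDl lerD// normrM -mulrA.
by rewrite ler_wpM2l.
Qed.

HB.instance Definition _ := GRing.isSubmodClosed.Build R (H10 D -> R^o)
  dual_pred dual_submod_closed.

(* H^{-1}(D), the bounded linear functionals on H^1_0(D); the duality pairing of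
   l with v is l v. *)
Record Hm1 := Hm1Elem { Hm1_fun :> H10 D -> R^o ; _ : Hm1_fun \in dual_pred }.
HB.instance Definition _ := [isSub for Hm1_fun].
HB.instance Definition _ := [Choice of Hm1 by <:].
HB.instance Definition _ := [SubChoice_isSubLmodule of Hm1 by <:].

Implicit Types (k l : Hm1).

Definition Hm1_norm l : R := sup [set l v / H10_norm v | v in [set v | v != 0]].

Let Hm1P l : (forall a v w, l (a *: v + w) = a *: l v + l w) /\
  exists K, forall v, `|l v| <= K * H10_norm v.
Proof. exact: (asboolP _ (valP l)). Qed.

Let lin0 l : l 0 = 0.
Proof.
have [lin _] := Hm1P l; have := lin 1 0 0.
by rewrite scaler0 addr0 scale1r => /eqP; rewrite -subr_eq0 opprD addNKr oppr_eq0
  => /eqP.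
Qed.

Let linN l v : l (- v) = - l v.
Proof.
have [lin _] := Hm1P l; have := lin (-1) v 0.
by rewrite !addr0 lin0 addr0 !scaleN1r.
Qed.

Let norm_ub l v : l v <= Hm1_norm l * H10_norm v.
Proof.
have [_ [K lK]] := Hm1P l.
have [->|v0] := eqVneq v 0.
  rewrite lin0 /H10_norm big1 ?sqrtr0 ?mulr0// => i _.
  by rewrite /grad ffunE normr0 expr0n.
have [nv0|nv0] := eqVneq (H10_norm v) 0.
  have := lK v; rewrite nv0 !mulr0 normr_le0 => /eqP ->; exact: lexx.
have nvp : 0 < H10_norm v by rewrite lt_def nv0 H10_norm_ge0.
rewrite -ler_pdivrMr//; apply: sup_ubound; last by exists v.
exists `|K| => _ [w _ <-].
have [->|w0] := eqVneq (H10_norm w) 0; first by rewrite invr0 mulr0.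
rewrite ler_pdivrMr ?lt_def ?w0 ?H10_norm_ge0//.
rewrite (le_trans (ler_norm _))// (le_trans (lK w))//.
by rewrite ler_wpM2r ?H10_norm_ge0 ?ler_norm.
Qed.

Let norm_lub l M : 0 <= M -> (forall v, l v <= M * H10_norm v) -> Hm1_norm l <= M.
Proof.
move=> M0 lM; rewrite /Hm1_norm; set S := image _ _.
have [->|S0] := eqVneq S set0; first by rewrite sup0.
apply: ge_sup; first exact/set0P.
move=> _ [w _ <-]; have [->|w0] := eqVneq (H10_norm w) 0.
  by rewrite invr0 mulr0.
by rewrite ler_pdivrMr ?lt_def ?w0 ?H10_norm_ge0.
Qed.

Let norm_ge0 l : 0 <= Hm1_norm l.
Proof.
have [[v v0]|H] := pselect (exists v : H10 D, H10_norm v != 0); last first.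
  have nv (v : H10 D) : H10_norm v = 0.
    by apply/eqP/negPn/negP => nv; apply: H; exists v.
  rewrite /Hm1_norm; set S := image _ _.
  have [->|/set0P[x Sx]] := eqVneq S set0; first by rewrite sup0.
  have -> : S = [set 0].
    apply/seteqP; split=> [_ [w _ <-]|_ ->] /=; first by rewrite nv invr0 mulr0.
    by move: Sx => [w w0 _]; exists w => //; rewrite nv invr0 mulr0.
  by rewrite sup1.
have nvp : 0 < H10_norm v by rewrite lt_def v0 H10_norm_ge0.
have := lerD (norm_ub l v) (norm_ub l (- v)).
rewrite linN subrr -[H10_norm (- v)]mul1r -(normrN1 R) -H10_normZ scaleN1r opprK.
by rewrite -mulr2n pmulrn_lge0// pmulr_lge0.
Qed.

Let norm_triangle k l : Hm1_norm (k + l) <= Hm1_norm k + Hm1_norm l.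
Proof.
apply: norm_lub => [|v]; first by rewrite addr_ge0.
by rewrite mulrDl -[(k + l) v]/(k v + l v) lerD.
Qed.

Let norm_abs l v : `|l v| <= Hm1_norm l * H10_norm v.
Proof.
rewrite ler_norml norm_ub andbT lerNl -linN (le_trans (norm_ub _ _))//.
by rewrite -scaleN1r H10_normZ normrN1 mul1r.
Qed.

Let norm_scale_le a l : Hm1_norm (a *: l) <= `|a| * Hm1_norm l.
Proof.
apply: norm_lub => [|v]; first by rewrite mulr_ge0.
rewrite -[(a *: l) v]/(a * l v) (le_trans (ler_norm _))// normrM -mulrA.
by rewrite ler_wpM2l.
Qed.

Let norm_scale a l : Hm1_norm (a *: l) = `|a| * Hm1_norm l.
Proof.
apply/eqP; rewrite eq_le norm_scale_le /=.
have [->|a0] := eqVneq a 0; first by rewrite normr0 mul0r.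
rewrite -ler_pdivlMl ?normr_gt0// -normfV.
by rewrite -{1}[l](scalerK a0) norm_scale_le.
Qed.

Let norm_eq0 l : Hm1_norm l = 0 -> l = 0.
Proof.
move=> l0; apply/val_inj/funext => v /=; apply/eqP.
by have := norm_abs l v; rewrite l0 mul0r normr_le0.
Qed.

HB.instance Definition _ := Lmodule_isNormed.Build R Hm1
  norm_triangle norm_scale norm_eq0.

End dual_space.

Definition admissible (d m : nat) : bool :=
  [|| (d \in [:: 1; 2]) && (1 <= m), (d == 3) && (1 <= m <= 5),
      (d == 4) && (1 <= m <= 3), (d \in [:: 5; 6]) && (1 <= m <= 2) |
      (7 <= d) && (m == 1)]%N.

Definition weak_solution (R : realType) (d : nat) (D : lipschitz_domain R d)
    (m : nat) (Cm : R) (a b : Linf D) (f : Hm1 D) (u : H10 D) := forall v : H10 D,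
  Cm ^+ 2 * (\int[lebesgue_on D]_x (a x * \sum_i grad u i x * grad v i x)) +
  \int[lebesgue_on D]_x (b x * u x ^+ m * v x) = Cm * f v.

(* |(1/2)_n|, for the falling factorial (q)_n. *)
Definition ffact_half (R : realType) (n : nat) : R :=
  `|\prod_(i < n) (2^-1 - i%:R)|.

Definition const_Cu (R : realType) (m : nat) (abar bbar CA ubar : R) : R :=
  CA^-1 * ubar * (abar + bbar * ubar ^+ m.-1 + 1).

Definition const_rho (R : realType) (m : nat) (abar bbar CA ubar : R) : R :=
  Num.max 2 ((2 * abar + bbar * (m%:R * ubar ^+ m.-1 +
    (3 * const_Cu m abar bbar CA ubar) ^+ m.-1 * m.+1%:R)) / CA + 1).

(* Main.v *)
(** The weak form is an identity A(y) u + T(y) u^m = F(y) between bounded symmetric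
    multilinear forms on V, where A, T, F are linear contractions of a, b, f. The
    difference w = u(y') - u(y) solves the linear equation with operator
    A(y') + \sum_i T(y') u(y')^i u(y)^(m-1-i), which is coercive with constant C_A: in
    case (A) by smallness, in case (B) because \sum_i s^i t^(m-1-i) >= 0 for odd m.
    Since V is complete, coercivity makes the difference quotients of u converge, and
    by induction on the order u is as smooth as the data.

    For the bounds, the Leibniz rule is expanded over all ways of splitting the list
    of differentiations into two sublists; as sublists of a sorted list are sorted,
    the symmetry of mixed derivatives is never needed. Isolating d^nu u leaves the
    coercive operator above (at y' = y) applied to d^nu u, and products of derivatives
    of lower order, which are controlled by the Vandermonde identity
    \sum_(0 < k < n) C(n, k) [1/2]_k [1/2]_(n-k) = 2 [1/2]_n. *)

Require Import Defs.
From HB Require Import structures.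
From mathcomp Require Import all_boot all_order all_algebra.
From mathcomp Require Import all_classical all_reals all_analysis.
From mathcomp Require Import measurable_realfun ess_sup_inf ring lra.

Set Implicit Arguments.
Unset Strict Implicit.
Unset Printing Implicit Defensive.
Import Order.TTheory GRing.Theory Num.Theory.
Import numFieldNormedType.Exports.

Local Open Scope classical_set_scope.
Local Open Scope ring_scope.

(** * Symmetric multilinear forms *)

(** For u in H^1_0 the power u^m is met only inside an integral, so what is differentiated is a form
    contracted with u. Keeping forms of all arities in one type makes contraction a bilinear map
    that can be iterated: one product rule and one product estimate then serve the diffusion term
    and the power term alike.

    The weight R^nu / (|nu|!)^(delta-1) is submultiplicative over splittings, because k! (n-k)! <=
    n!; hence delta leaves the estimates and the case delta = 1 remains. There n! itself is no
    usable majorant: the sum of C(n,k) k! (n-k)! over 0 < k < n is (n-1) n!. With [1/2]_n the sum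
    costs only a factor 2, and the 2^-n hidden in 2R brings the data below this majorant.

    A product of two derivatives of lower order carries rho^(k-1) rho^(n-k-1) = rho^(n-1) / rho, a
    gain of 1/rho over the isolated term, so a large rho closes the induction. C_u is chosen so that
    the data use at most half of C_A C_u, and rho so that the remainders use at most the other
    half. *)

Section symmetric_forms.
Context (R : realType) (V : normedModType R).
Implicit Types (s t : seq V) (u v w : V).

Definition normprod s : R := \prod_(v <- s) `|v|.

Lemma normprod_ge0 s : 0 <= normprod s.
Proof. exact: prodr_ge0. Qed.

Lemma normprod_cons v s : normprod (v :: s) = `|v| * normprod s.
Proof. by rewrite /normprod big_cons. Qed.

(** By symmetry, linearity in the head entry is linearity in every entry. One [K] serves all
    arities, so the norm below is a supremum over all of them. *)
Definition sform_pred : {pred seq V -> R^o} := fun x =>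
  `[< [/\ forall s t, perm_eq s t -> x s = x t,
        forall a v w s, x (a *: v + w :: s) = a * x (v :: s) + x (w :: s) &
        exists K, forall s, `|x s| <= K * normprod s] >].

Let sform_submod_closed : submod_closed sform_pred.
Proof.
split.
  apply/asboolP; split=> [//|a v w s|]; first by rewrite /= mulr0 addr0.
  by exists 0 => s; rewrite mul0r normr0.
move=> c x y /asboolP[px lx [K xK]] /asboolP[py ly [L yL]]; apply/asboolP.
have E s : (c *: x + y) s = c * x s + y s by [].
split=> [s t st|a v w s|]; first by rewrite !E (px _ _ st) (py _ _ st).
  by rewrite !E lx ly; ring.
exists (`|c| * K + L) => s; rewrite E (le_trans (ler_normD _ _))// mulrDl.
by rewrite lerD// normrM -mulrA ler_wpM2l.
Qed.

HB.instance Definition _ := GRing.isSubmodClosed.Build R (seq V -> R^o)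
  sform_pred sform_submod_closed.

(* Bounded symmetric multilinear forms of all arities at once: the value on a
   list of length n is that of the n-linear component. *)
Record sform := SForm { sform_fun :> seq V -> R^o ; _ : sform_fun \in sform_pred }.
HB.instance Definition _ := [isSub for sform_fun].
HB.instance Definition _ := [Choice of sform by <:].
HB.instance Definition _ := [SubChoice_isSubLmodule of sform by <:].

Implicit Types x y : sform.

Lemma sform_perm x s t : perm_eq s t -> x s = x t.
Proof. by have /asboolP[+ _ _] := valP x; exact. Qed.

Lemma sform_lin x a v w s : x (a *: v + w :: s) = a * x (v :: s) + x (w :: s).
Proof. by have /asboolP[_ + _] := valP x; exact. Qed.

Lemma sformDE x y s : (x + y) s = x s + y s :> R. Proof. by []. Qed.
Lemma sformZE a x s : (a *: x) s = a * x s :> R. Proof. by []. Qed.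
Lemma sformNE x s : (- x) s = - x s :> R. Proof. by []. Qed.

(** Lists with a zero entry contribute [_ / 0 = 0]; nothing is lost, since a bounded form vanishes
    on them. The empty list has [normprod] equal to 1. *)
Definition sform_norm x : R := sup [set `|x s| / normprod s | s in setT].

Let norm_ub x s : `|x s| <= sform_norm x * normprod s.
Proof.
have /asboolP[_ _ [K xK]] := valP x.
have [s0|s0] := eqVneq (normprod s) 0; first by have := xK s; rewrite s0 !mulr0.
rewrite -ler_pdivrMr ?lt_def ?s0 ?normprod_ge0//.
apply: sup_ubound; last by exists s.
exists `|K| => _ [t _ <-].
have [->|t0] := eqVneq (normprod t) 0; first by rewrite invr0 mulr0.
rewrite ler_pdivrMr ?lt_def ?t0 ?normprod_ge0// (le_trans (xK t))//.
by rewrite ler_wpM2r ?normprod_ge0 ?ler_norm.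
Qed.

Let norm_lub x M : 0 <= M -> (forall s, `|x s| <= M * normprod s) ->
  sform_norm x <= M.
Proof.
move=> M0 xM; apply: ge_sup; first by exists (`|x [::]| / normprod [::]), [::].
move=> _ [s _ <-]; have [->|s0] := eqVneq (normprod s) 0.
  by rewrite invr0 mulr0.
by rewrite ler_pdivrMr ?lt_def ?s0 ?normprod_ge0.
Qed.

Let norm_ge0 x : 0 <= sform_norm x.
Proof.
have := norm_ub x [::]; rewrite /normprod big_nil mulr1.
exact: le_trans.
Qed.

Let norm_triangle x y : sform_norm (x + y) <= sform_norm x + sform_norm y.
Proof.
apply: norm_lub => [|s]; first by rewrite addr_ge0.
by rewrite mulrDl (le_trans (ler_normD _ _))// lerD.
Qed.

Let norm_scale_le a x : sform_norm (a *: x) <= `|a| * sform_norm x.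
Proof.
apply: norm_lub => [|s]; first by rewrite mulr_ge0.
by rewrite sformZE normrM -mulrA ler_wpM2l.
Qed.

Let norm_scale a x : sform_norm (a *: x) = `|a| * sform_norm x.
Proof.
apply/eqP; rewrite eq_le norm_scale_le /=.
have [->|a0] := eqVneq a 0; first by rewrite normr0 mul0r.
rewrite -ler_pdivlMl ?normr_gt0// -normfV.
by rewrite -{1}[x](scalerK a0) norm_scale_le.
Qed.

Let norm_eq0 x : sform_norm x = 0 -> x = 0.
Proof.
move=> x0; apply/val_inj/funext => s /=; apply/eqP.
by have := norm_ub x s; rewrite x0 mul0r normr_le0.
Qed.

HB.instance Definition _ := Lmodule_isNormed.Build R sform
  norm_triangle norm_scale norm_eq0.

Lemma sform_le_norm x s : `|x s| <= `|x| * normprod s.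
Proof. exact: norm_ub. Qed.

Lemma sform_norm_le x M : 0 <= M -> (forall s, `|x s| <= M * normprod s) ->
  `|x| <= M.
Proof. exact: norm_lub. Qed.

(** Contraction of the head slot with [u]; it lowers the arity by one without leaving the type. *)
Definition app_fun x u : seq V -> R^o := fun s => x (u :: s).

Let app_proof x u : app_fun x u \in sform_pred.
Proof.
apply/asboolP; split=> [s t st|a v w s|].
- by apply: sform_perm; rewrite perm_cons.
- have sw z : perm_eq (u :: z :: s) (z :: u :: s).
    by apply/permP => p /=; rewrite !addnA [X in (X + _)%N]addnC.
  by rewrite /app_fun !(sform_perm x (sw _)) sform_lin.
- by exists (`|x| * `|u|) => s; rewrite /app_fun -mulrA -normprod_cons sform_le_norm.
Qed.

Definition app x u : sform := SForm (app_proof x u).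

Lemma appE x u s : app x u s = x (u :: s). Proof. by []. Qed.

Lemma sformP x y : (forall s, x s = y s :> R) -> x = y.
Proof. by move=> xy; apply/val_inj/funext. Qed.

Lemma app_linr a x u v : app x (a *: u + v) = a *: app x u + app x v.
Proof. by apply: sformP => s; exact: sform_lin. Qed.

Lemma appDl x y u : app (x + y) u = app x u + app y u.
Proof. exact: sformP. Qed.

Lemma appBl x y u : app (x - y) u = app x u - app y u.
Proof. exact: sformP. Qed.

Lemma appZl a x u : app (a *: x) u = a *: app x u.
Proof. exact: sformP. Qed.

Lemma app0l u : app 0 u = 0.
Proof. exact: sformP. Qed.

Lemma appDr x u v : app x (u + v) = app x u + app x v.
Proof. by have := app_linr 1 x u v; rewrite !scale1r. Qed.

Lemma app0r x : app x 0 = 0.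
Proof. by apply: (addrI (app x 0)); rewrite -appDr !addr0. Qed.

Lemma appZr a x u : app x (a *: u) = a *: app x u.
Proof. by rewrite -[a *: u]addr0 app_linr app0r addr0. Qed.

Lemma appBr x u v : app x (u - v) = app x u - app x v.
Proof. by rewrite appDr -scaleN1r appZr scaleN1r. Qed.

Lemma app_norm x u : `|app x u| <= `|x| * `|u|.
Proof.
apply: sform_norm_le => [|s]; first by rewrite mulr_ge0.
by rewrite -mulrA -normprod_cons appE sform_le_norm.
Qed.

Lemma app_comm x u v : app (app x u) v = app (app x v) u.
Proof.
apply: sformP => s; rewrite !appE; apply: sform_perm; apply/permP => p /=.
by rewrite !addnA [X in (X + _)%N]addnC.
Qed.

Definition pow n x u : sform := iter n (app^~ u) x.

Lemma powSr n x u : pow n.+1 x u = pow n (app x u) u.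
Proof. exact: iterSr. Qed.

Lemma pow_appC n x u v : app (pow n x u) v = pow n (app x v) u.
Proof.
by elim: n => //= n IH; rewrite app_comm IH.
Qed.

Lemma powB n x y u : pow n (x - y) u = pow n x u - pow n y u.
Proof. by elim: n => //= n ->; rewrite appBl. Qed.

Lemma powZ n a x u : pow n (a *: x) u = a *: pow n x u.
Proof. by elim: n => //= n ->; rewrite appZl. Qed.

Lemma pow0 n u : pow n 0 u = 0.
Proof. by elim: n => //= n ->; rewrite app0l. Qed.

Lemma pow_norm n x u : `|pow n x u| <= `|x| * `|u| ^+ n.
Proof.
elim: n => [|n IH]; first by rewrite mulr1.
rewrite exprSr mulrA (le_trans (app_norm _ _))// ler_wpM2r//.
Qed.

Lemma powE n x u s : pow n x u s = x (nseq n u ++ s).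
Proof. by elim: n x => // n IH x; rewrite powSr IH appE. Qed.

(** Divided difference of t |-> x t^n between [u'] and [u], in closed form [ddivE]; on the diagonal
    it is the derivative n x u^(n-1). The recursion exchanges one factor [u'] for [u] at a time. *)
Fixpoint ddiv n x u' u : sform :=
  if n is n'.+1 then ddiv n' (app x u') u' u + pow n' x u else 0.

Lemma ddivP n x u' u : pow n x u' - pow n x u = app (ddiv n x u' u) (u' - u).
Proof.
elim: n x => [|n IH] x; first by rewrite /= subrr app0l.
rewrite powSr -[ddiv _ _ _ _]/(ddiv n (app x u') u' u + pow n x u) appDl -IH.
by rewrite appBr pow_appC addrA subrK.
Qed.

Lemma ddiv0 n u' u : ddiv n 0 u' u = 0.
Proof. by elim: n => //= n IH; rewrite app0l IH pow0 addr0. Qed.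

Lemma ddiv_norm n x u' u M : `|u'| <= M -> `|u| <= M ->
  `|ddiv n x u' u| <= n%:R * M ^+ n.-1 * `|x|.
Proof.
move=> uM' uM; have M0 : 0 <= M by rewrite (le_trans _ uM).
elim: n x => [|n IH] x; first by rewrite normr0 !mul0r.
rewrite -[ddiv _ _ _ _]/(ddiv n (app x u') u' u + pow n x u).
rewrite (le_trans (ler_normD _ _))// -natr1 mulrDl mulrDl mul1r lerD//; last first.
  rewrite (le_trans (pow_norm _ _ _))// mulrC ler_wpM2r// lerXn2r ?nnegrE//.
case: n IH => [IH|n IH]; first by rewrite /= normr0 !mul0r.
rewrite (le_trans (IH _))//= exprS -mulrA -[leRHS]mulrA ler_wpM2l//.
rewrite [M * _]mulrC -mulrA ler_wpM2l ?exprn_ge0// mulrC.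
by rewrite (le_trans (app_norm _ _))// ler_wpM2l.
Qed.

Lemma ddivE n x u' u s : ddiv n x u' u s =
  \sum_(i < n) x (nseq i u' ++ nseq (n.-1 - i) u ++ s).
Proof.
elim: n x => [|n IH] x; first by rewrite big_ord0.
rewrite -[ddiv _ _ _ _]/(ddiv n (app x u') u' u + pow n x u) sformDE IH powE.
rewrite big_ord_recl /= subn0 addrC; congr (_ + _).
apply: eq_bigr => i _; rewrite /bump /= add1n.
by case: n i {IH} => [[]//|n] i /=; rewrite subSS.
Qed.

Lemma ddiv_same n x u : ddiv n x u u = n%:R *: pow n.-1 x u.
Proof.
elim: n x => [|n IH] x; first by rewrite scale0r.
rewrite -[ddiv _ _ _ _]/(ddiv n (app x u) u u + pow n x u) IH.
case: n {IH} => [|n]; first by rewrite scale0r add0r scale1r.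
by rewrite -powSr /= -[n.+2]addn1 natrD scalerDl scale1r.
Qed.

(** The derivative of (x u^n) u in the direction [w] by the product rule, in the shape used by the
    induction of [jet_pow_rem]. *)
Lemma app_ddiv_sameS n x u w : app (ddiv n.+1 x u u) w =
  app (app (ddiv n x u u) w) u + app (pow n x u) w.
Proof.
rewrite !ddiv_same !appZl -[n.+1.-1]/n; case: n => [|n].
  by rewrite scale1r !scale0r add0r.
by rewrite app_comm -/(pow n.+1 x u) -[n.+2]addn1 natrD scalerDl scale1r.
Qed.

End symmetric_forms.

(** * Smoothness of solutions of coercive equations *)

Section app_calculus.
Context (R : realType) (V : normedModType R).

Lemma cvg_le_dist (B : normedModType R) (T : Type) (F : set_system T)
    {FF : Filter F} (f : T -> B) l (b : T -> R) :
  (\forall t \near F, `|f t - l| <= b t) -> b @ F --> 0 -> f @ F --> l.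
Proof.
move=> fb b0; apply/cvgrPdist_lt => e e0; near=> t; rewrite distrC.
rewrite (@le_lt_trans _ _ (b t))//; first by near: t.
by near: t; apply: (cvgr_lt 0).
Unshelve. all: by end_near. Qed.

Lemma cvg_dist_norm0 (B : normedModType R) (T : Type) (F : set_system T)
    {FF : Filter F} (f : T -> B) l : f @ F --> l -> `|f t - l| @[t --> F] --> (0 : R).
Proof.
by move=> fl; rewrite -(@normr0 _ B); apply: cvg_norm; apply/subr_cvg0.
Qed.

Lemma app_cvg (T : Type) (F : set_system T) {FF : Filter F} (x : T -> sform V)
    (u : T -> V) x0 u0 : x @ F --> x0 -> u @ F --> u0 ->
  app (x t) (u t) @[t --> F] --> app x0 u0.
Proof.
move=> xx uu.
apply: (@cvg_le_dist _ _ _ _ _ _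
    (fun t => `|x t - x0| * `|u t| + `|x0| * `|u t - u0|)).
- near=> t.
  rewrite (_ : app (x t) (u t) - app x0 u0 =
      app (x t - x0) (u t) + app x0 (u t - u0)); last first.
    by rewrite appBl appBr addrA subrK.
  by rewrite (le_trans (ler_normD _ _))// lerD// app_norm.
rewrite -[0 : R](_ : 0 * `|u0| + `|x0| * 0 = 0); last by rewrite mul0r mulr0 addr0.
apply: cvgD; first by apply: cvgM (cvg_dist_norm0 xx) _; exact: cvg_norm.
by apply: cvgM (cvg_dist_norm0 uu); exact: cvg_cst.
Unshelve. all: by end_near. Qed.

Lemma pow_cvg n (T : Type) (F : set_system T) {FF : Filter F} (x : T -> sform V)
    (u : T -> V) x0 u0 : x @ F --> x0 -> u @ F --> u0 ->
  pow n (x t) (u t) @[t --> F] --> pow n x0 u0.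
Proof. by move=> xx uu; elim: n => //= n IH; exact: app_cvg. Qed.

Lemma ddiv_cvg n (T : Type) (F : set_system T) {FF : Filter F} (x : T -> sform V)
    (u v : T -> V) x0 u0 v0 : x @ F --> x0 -> u @ F --> u0 -> v @ F --> v0 ->
  ddiv n (x t) (u t) (v t) @[t --> F] --> ddiv n x0 u0 v0.
Proof.
move=> + uu vv; elim: n x x0 => [|n IH] x x0 xx /=; first exact: cvg_cst.
apply: cvgD; last exact: pow_cvg.
by apply: (IH (fun t => app (x t) (u t))); exact: app_cvg.
Qed.

(** A directional derivative yields continuity along the line only, which is all that the product
    rule needs. *)
Lemma derivable_cvg_shift (E B : normedModType R) (g : E -> B) y v :
  derivable g y v -> g (h *: v + y) @[h --> 0^'] --> g y.
Proof.
move=> dg.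
have lim0 : (fun h : R => h *: (h^-1 *: ((g \o shift y) (h *: v) - g y)) + g y)
    @ 0^' --> g y.
  rewrite -[X in _ --> X]add0r; apply: cvgD; last exact: cvg_cst.
  rewrite -[X in _ --> X](scale0r ('D_v g y)); apply: cvgZ => //.
  exact: nbhs_dnbhs.
apply: cvg_trans lim0; apply: near_eq_cvg.
near=> h; have h0 : h != 0 by near: h; exact: nbhs_dnbhs_neq.
by rewrite scalerA mulfV// scale1r subrK.
Unshelve. all: by end_near. Qed.

Lemma is_derive_app (E : normedModType R) (x : E -> sform V) (u : E -> V) y v dx du :
  is_derive y v x dx -> is_derive y v u du ->
  is_derive y v (fun z => app (x z) (u z)) (app dx (u y) + app (x y) du).
Proof.
move=> [dxx <-] [duu <-].
have cv : (fun h => h^-1 *: (((fun z => app (x z) (u z)) \o shift y) (h *: v) -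
    app (x y) (u y))) @ 0^' --> app ('D_v x y) (u y) + app (x y) ('D_v u y).
  rewrite (_ : (fun h => _) = (fun h =>
      app (h^-1 *: ((x \o shift y) (h *: v) - x y)) (u (h *: v + y)) +
      app (x y) (h^-1 *: ((u \o shift y) (h *: v) - u y)))).
    apply: cvgD; apply: app_cvg => //; [|exact: cvg_cst].
    exact: derivable_cvg_shift.
  apply/funext => h /=.
  rewrite appZl appZr -scalerDr appBl appBr; congr (_ *: _).
  by rewrite addrA subrK.
by split; [exact: cvgP cv|exact: cvg_lim cv].
Qed.

End app_calculus.

(** * Functions of class C^k on an open set *)

Section Ck.
Context (R : realType) (s : nat) (U : set 'rV[R]_s) (oU : open U).
Implicit Types (B : normedModType R) (y : 'rV[R]_s) (j : 'I_s) (k : nat).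

Let nearU y (P : 'rV[R]_s -> Prop) : U y -> (forall z, U z -> P z) ->
  \forall z \near y, P z.
Proof. by move=> Uy UP; apply: filterS (open_nbhs_nbhs (conj oU Uy)). Qed.

(** [smooth_on] graded by the order: the regularity of the solution is gained one derivative at a
    time. *)
Fixpoint Ck B k (g : 'rV[R]_s -> B) : Prop :=
  (forall y, U y -> {for y, continuous g}) /\
  if k is k'.+1 then forall j,
    (forall y, U y -> derivable g y (delta_mx 0 j)) /\ Ck k' (partial j g)
  else True.

Section theory.
Context (B : normedModType R).
Implicit Types g h : 'rV[R]_s -> B.

Lemma Ck_cont k g : Ck k g -> forall y, U y -> {for y, continuous g}.
Proof. by case: k => [|k] []. Qed.

Lemma Ck_derivable k g : Ck k.+1 g ->
  forall j y, U y -> derivable g y (delta_mx 0 j).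
Proof. by move=> [_ H] j; have [] := H j. Qed.

Lemma Ck_partial k g : Ck k.+1 g -> forall j, Ck k (partial j g).
Proof. by move=> [_ H] j; have [] := H j. Qed.

Lemma Ck_prev k g : Ck k.+1 g -> Ck k g.
Proof.
elim: k g => [|k IH] g [cg dg]; split => // j.
by have [dj cj] := dg j; split => //; exact: IH.
Qed.

Lemma Ck_leq k l g : (k <= l)%N -> Ck l g -> Ck k g.
Proof.
elim: l => [|l IH]; first by rewrite leqn0 => /eqP ->.
by rewrite leq_eqVlt => /predU1P[->//|kl] /Ck_prev; exact: IH.
Qed.

Lemma partial_eq_on g h j : (forall y, U y -> g y = h y) ->
  forall y, U y -> partial j g y = partial j h y.
Proof. by move=> gh y Uy; apply: near_eq_derive; exact: (nearU Uy gh). Qed.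

Lemma Ck_eq k g h : (forall y, U y -> g y = h y) -> Ck k g -> Ck k h.
Proof.
elim: k g h => [|k IH] g h gh [cg dg].
all: have ch y : U y -> {for y, continuous h}.
1,3: move=> Uy; rewrite /prop_for /continuous_at -gh//.
1,2: have gh_near : {near y, g =1 h} by exact: (nearU Uy gh).
1,2: by apply: cvg_trans (cg y Uy); exact: (near_eq_cvg gh_near).
all: split=> // j.
have [dj cj] := dg j; split=> [y Uy|]; last exact: (IH _ _ (@partial_eq_on _ _ j gh) cj).
by apply: near_eq_derivable (dj y Uy); exact: (nearU Uy gh).
Qed.

Lemma Ck_lin k a g h : Ck k g -> Ck k h -> Ck k (fun y => a *: g y + h y).
Proof.
elim: k g h => [|k IH] g h [cg dg] [ch dh].
all: have cgh y : U y -> {for y, continuous (fun y => a *: g y + h y)}.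
1,3: by move=> Uy; apply: cvgD (ch y Uy); exact: cvgZl_tmp (cg y Uy).
all: split=> // j.
have [[dgj cgj] [dhj chj]] := (dg j, dh j).
split=> [y Uy|].
  by apply: derivableD; [apply: derivableZ; exact: dgj|exact: dhj].
apply: Ck_eq (IH _ _ cgj chj) => y Uy; rewrite /partial.
rewrite -[in RHS]/(a \*: g + h) deriveD ?deriveZ//; last exact: dhj.
- exact: dgj.
- by apply: derivableZ; exact: dgj.
Qed.

Lemma Ck_cst k (c : B) : Ck k (cst c).
Proof.
elim: k c => [|k IH] c.
all: have cc y : U y -> {for y, continuous (cst c)} by move=> _; exact: cst_continuous.
all: split=> // j.
split=> [y _|]; first exact: derivable_cst.
by rewrite (_ : partial j _ = cst 0)//; apply/funext => y; rewrite /partial derive_cst.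
Qed.

Lemma CkD k g h : Ck k g -> Ck k h -> Ck k (fun y => g y + h y).
Proof.
move=> cg ch; apply: Ck_eq (Ck_lin 1 cg ch) => y _; by rewrite scale1r.
Qed.

Lemma CkB k g h : Ck k g -> Ck k h -> Ck k (fun y => g y - h y).
Proof.
move=> cg ch; apply: Ck_eq (Ck_lin (-1) ch cg) => y _.
by rewrite scaleN1r addrC.
Qed.

Lemma smooth_on_partial g j : smooth_on U g -> smooth_on U (partial j g).
Proof.
move=> sg l y Uy; have := sg (rcons l j) y Uy.
by rewrite /iter_partial -cats1 foldr_cat.
Qed.

Lemma smooth_onP g : smooth_on U g <-> forall k, Ck k g.
Proof.
split=> [|cg l].
  have cont0 h : smooth_on U h -> forall y, U y -> {for y, continuous h}.
    by move=> sh y Uy; have [] := sh [::] y Uy.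
  move=> + k; elim: k g => [|k IH] g sg; split=> //; first exact: cont0.
    exact: cont0.
  move=> j; split=> [y Uy|]; first by have [_] := sg [::] y Uy; exact.
  exact/IH/smooth_on_partial.
(* The last entry of the list is the derivative taken first, so peeling from the right replaces [g]
   by [partial j g]. *)
elim/last_ind: l g cg => [|l j IH] g cg y Uy.
  split; first exact: (Ck_cont (cg 0)).
  by move=> j; exact: (Ck_derivable (cg 1)).
rewrite /iter_partial -cats1 foldr_cat; apply: IH => // k.
exact: Ck_partial (cg k.+1) j.
Qed.

End theory.

Section app.
Context (V : normedModType R).
Implicit Types (x : 'rV[R]_s -> sform V) (u : 'rV[R]_s -> V).

Lemma partial_app x u j y : derivable x y (delta_mx 0 j) ->
  derivable u y (delta_mx 0 j) ->
  partial j (fun z => app (x z) (u z)) y =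
  app (partial j x y) (u y) + app (x y) (partial j u y).
Proof.
by move=> /derivableP dx /derivableP du; have [] := is_derive_app dx du.
Qed.

Lemma Ck_app k x u : Ck k x -> Ck k u -> Ck k (fun y => app (x y) (u y)).
Proof.
elim: k x u => [|k IH] x u cx cu.
all: have cxu y : U y -> {for y, continuous (fun y => app (x y) (u y))}.
1,3: by move=> Uy; exact: app_cvg (Ck_cont cx Uy) (Ck_cont cu Uy).
all: split=> // j.
split=> [y Uy|].
  have /derivableP dx := Ck_derivable cx (j := j) Uy.
  have /derivableP du := Ck_derivable cu (j := j) Uy.
  by have [] := is_derive_app dx du.
have c1 := IH _ _ (Ck_partial cx j) (Ck_prev cu).
have c2 := IH _ _ (Ck_prev cx) (Ck_partial cu j).
apply: Ck_eq (CkD c1 c2) => y Uy; rewrite partial_app//.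
  exact: Ck_derivable cx _ _ Uy.
exact: Ck_derivable cu _ _ Uy.
Qed.

Lemma Ck_pow k n x u : Ck k x -> Ck k u -> Ck k (fun y => pow n (x y) (u y)).
Proof. by move=> cx cu; elim: n => //= n IH; exact: Ck_app. Qed.

Lemma Ck_ddiv k n x u v : Ck k x -> Ck k u -> Ck k v ->
  Ck k (fun y => ddiv n (x y) (u y) (v y)).
Proof.
move=> cx cu cv; elim: n x cx => [|n IH] x cx; first exact: Ck_cst.
by apply: CkD; [apply: (IH (fun y => app (x y) (u y))); exact: Ck_app|exact: Ck_pow].
Qed.

End app.
End Ck.

(** Completeness tested on sequences with geometric increments. It implies convergence of Cauchy
    filters, and in L^2 such increments give pointwise convergence almost everywhere without passing
    to a subsequence. *)
Definition fast_complete (R : realType) (V : normedModType R) :=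
  forall x : nat -> V, (forall k, `|x k.+1 - x k| <= 2^-1 ^+ k) ->
  exists l : V, x @ \oo --> l.

(** * Limits of coercive linear equations *)

Section completeness.
Context (R : realType) (V : normedModType R) (Vc : fast_complete V).

(** Choose x_k within 2^-(k+1) of eventually all points of [F]. Two consecutive choices have a
    common nearby point, so the increments are at most 2^-k. *)
Lemma fast_complete_cvg (F : set_system V) {PF : ProperFilter F} :
  (forall e : R, 0 < e -> exists x, \forall z \near F, `|x - z| < e) ->
  exists l : V, F --> l.
Proof.
move=> cF; pose e k : R := 2^-1 ^+ k.+1.
have e0 k : 0 < e k by rewrite exprn_gt0// invr_gt0.
have /choice[x xP] k := cF _ (e0 k).
have [k|l xl] := Vc (x := x).
  have [z [z1 z2]] := filter_ex (filterI (xP k) (xP k.+1)).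
  rewrite -(subrK z (x k.+1)) -addrA (le_trans (ler_normD _ _))//.
  rewrite [`|z - _|]distrC (le_trans (ltW (ltrD z2 z1)))//.
  rewrite (@le_trans _ _ (e k + e k))// ?lerD2r.
    by rewrite {1}/e exprS -/(e k) ler_piMl// ?(ltW (e0 k))// invf_le1// ler1n.
  by rewrite /e exprS; set p := _ ^+ k; lra.
exists l; apply/fcvgrPdist_lt => r r0.
have r2 : 0 < r / 2 by rewrite divr_gt0.
have [k [lk ek]] : exists k, `|l - x k| < r / 2 /\ e k < r / 2.
  have : \forall k \near \oo, `|l - x k| < r / 2 /\ e k < r / 2.
    near=> k; split; first by near: k; exact: cvgr_dist_lt.
    near: k; apply: (cvgr_lt 0) => //.
    rewrite /e (_ : (fun k => _) = (fun k => 2^-1 * 2^-1 ^+ k)); last first.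
      by apply/funext => k; rewrite exprS.
    rewrite -[X in _ --> X](mulr0 (2^-1)); apply: cvgM; first exact: cvg_cst.
    by apply: cvg_expr; rewrite gtr0_norm ?invr_gt0// invf_lt1// ltr1n.
  by move=> /filter_ex.
apply: filterS (xP k) => z xz.
rewrite -(subrK (x k) l) -addrA (le_lt_trans (ler_normD _ _))//.
by rewrite (splitr r) ltrD// (lt_trans xz).
Unshelve. all: by end_near. Qed.

(** Coercivity first bounds [w], then makes it Cauchy through M(t0) (w(t0) - w(t)) = g(t0) - g(t) -
    (M(t0) - M(t)) w(t). The limit equation thus gets its solution as a limit; no existence theorem
    such as Lax-Milgram enters. *)
Lemma coercive_cvg (T : Type) (F : set_system T) {PF : ProperFilter F}
    (M : T -> sform V) (w : T -> V) (g : T -> sform V) (M0 g0 : sform V) (c : R) :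
  0 < c -> M @ F --> M0 -> g @ F --> g0 ->
  (\forall t \near F, app (M t) (w t) = g t) ->
  (\forall t \near F, forall d, c * `|d| <= `|app (M t) d|) ->
  exists2 w0, w @ F --> w0 & app M0 w0 = g0.
Proof.
move=> c0 MM gg Mw Mc; pose K := (`|g0| + 1) / c.
have K0 : 0 <= K by rewrite divr_ge0// ?addr_ge0// ltW.
have wK : \forall t \near F, `|w t| <= K.
  near=> t; rewrite ler_pdivlMr// mulrC.
  rewrite (@le_trans _ _ `|app (M t) (w t)|)//.
    by have : forall d, c * `|d| <= `|app (M t) d| by [near: t]; exact.
  rewrite (_ : app _ _ = g t); last by near: t.
  by near: t; apply: (cvgr_norm_le g0) => //; rewrite ltrDl.
have [w0 ww] : exists w0 : V, w @ F --> w0.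
  apply: (@fast_complete_cvg (w @ F)) => e e0.
  (* Chosen so that the Cauchy estimate 2n + 2nK comes to e c / 2. *)
  pose n := e * c / (4 * (1 + K)).
  have K1 : 0 < 1 + K by rewrite ltr_pwDl.
  have n0 : 0 < n by rewrite divr_gt0 ?mulr_gt0.
  have P : \forall t \near F, [/\ app (M t) (w t) = g t,
      forall d, c * `|d| <= `|app (M t) d|, `|w t| <= K, `|M0 - M t| < n
      & `|g0 - g t| < n].
    near=> t; split; near: t => //; exact: cvgr_dist_lt.
  have /filter_ex[t0 [E0 C0 W0 M0n g0n]] := P.
  exists (w t0); apply: filterS P => t [Et _ Wt Mt gt].
  change (`|w t0 - w t| < e).
  rewrite -(ltr_pM2l c0) (le_lt_trans (C0 _))//.
  rewrite (_ : app _ _ = (g t0 - g t) - app (M t0 - M t) (w t)); last first.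
    by rewrite appBr appBl E0 Et opprB addrA subrK.
  have g2 : `|g t0 - g t| <= n + n.
    rewrite -(subrK g0 (g t0)) -addrA (le_trans (ler_normD _ _))// lerD ?ltW//.
    by rewrite distrC.
  have M2 : `|M t0 - M t| <= n + n.
    rewrite -(subrK M0 (M t0)) -addrA (le_trans (ler_normD _ _))// lerD ?ltW//.
    by rewrite distrC.
  rewrite (le_lt_trans (ler_normB _ _))//.
  rewrite (@le_lt_trans _ _ ((n + n) + (n + n) * K))//.
    rewrite lerD// (le_trans (app_norm _ _))// ler_pM//.
  rewrite (_ : _ + _ = e * c / 2); last by rewrite /n; field; rewrite gt_eqF.
  by rewrite [c * e]mulrC ltr_pdivrMr// ltr_pMr ?mulr_gt0// ltr1n.
exists w0 => //.
have lim1 : app (M t) (w t) @[t --> F] --> app M0 w0 by exact: app_cvg.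
rewrite -(cvg_lim (@norm_hausdorff _ _) lim1).
apply: cvg_lim; first exact: norm_hausdorff.
by apply: cvg_trans gg; apply: near_eq_cvg; near=> t; apply/esym; near: t.
Unshelve. all: by end_near. Qed.

End completeness.

(** * Regularity of solutions depending on a parameter *)

Section solution.
Context (R : realType) (V : normedModType R) (Vc : fast_complete V).
Context (s : nat) (U : set 'rV[R]_s) (oU : open U) (m : nat) (c : R) (c0 : 0 < c).
Implicit Types (A T F : 'rV[R]_s -> sform V) (u : 'rV[R]_s -> V).

Definition solves A T F u := forall y, U y ->
  app (A y) (u y) + pow m (T y) (u y) = F y.

(** Two base points, because the operator acts on the difference of two solutions. Only the lower
    bound on the norm is kept of coercivity. *)
Definition coercive A T u := forall y' y, U y' -> U y -> forall d,
  c * `|d| <= `|app (A y' + ddiv m (T y') (u y') (u y)) d|.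

(** The linearisation of the nonlinear operator at [u y], which is also the case y' = y of the
    operator in [coercive]. *)
Definition linop A T u y : sform V := A y + ddiv m (T y) (u y) (u y).

Lemma solves_diff A T F u y' y : solves A T F u -> U y' -> U y ->
  app (A y' + ddiv m (T y') (u y') (u y)) (u y' - u y) =
  F y' - F y - app (A y' - A y) (u y) - pow m (T y' - T y) (u y).
Proof.
move=> sol Uy' Uy; rewrite -!sol// appDl -ddivP appBr appBl powB.
rewrite [in RHS]opprD [in RHS]addrACA !opprB -[RHS]addrA [in RHS]addrACA.
by rewrite !subrKA.
Qed.

Lemma solves_continuous A T F u : solves A T F u -> coercive A T u ->
  Ck U 0 A -> Ck U 0 T -> Ck U 0 F -> Ck U 0 u.
Proof.
move=> sol co [cA _] [cT _] [cF _]; split=> // y Uy.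
apply: (@cvg_le_dist _ _ _ (nbhs y) _ _ _ (fun y' => c^-1 *
    (`|F y' - F y| + `|A y' - A y| * `|u y| + `|T y' - T y| * `|u y| ^+ m))).
  near=> y'; have Uy' : U y' by near: y'; exact: open_nbhs_nbhs.
  rewrite -ler_pdivrMl ?invr_gt0// invrK (le_trans (co _ _ Uy' Uy _))//.
  rewrite (solves_diff sol)// (le_trans (ler_normB _ _))// lerD ?pow_norm//.
  by rewrite (le_trans (ler_normB _ _))// lerD ?app_norm.
have lim0 (B : normedModType R) (g : 'rV[R]_s -> B) : {for y, continuous g} ->
    `|g y' - g y| @[y' --> y] --> (0 : R).
  by move=> cg; apply: (@cvg_dist_norm0 _ _ _ (nbhs y) _ _ _ cg).
rewrite -[X in _ --> X](_ : c^-1 * (0 + 0 * `|u y| + 0 * `|u y| ^+ m) = 0); last first.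
  by rewrite !mul0r !addr0 mulr0.
apply: cvgM; first exact: cvg_cst.
apply: cvgD; last by apply: cvgM; [exact: (lim0 _ _ (cT y Uy))|exact: cvg_cst].
apply: cvgD; first exact: (lim0 _ _ (cF y Uy)).
by apply: cvgM; [exact: (lim0 _ _ (cA y Uy))|exact: cvg_cst].
Unshelve. all: by end_near. Qed.

Lemma solves_derivable A T F u j : solves A T F u -> coercive A T u ->
  Ck U 1 A -> Ck U 1 T -> Ck U 1 F -> forall y, U y ->
  derivable u y (delta_mx 0 j) /\
  app (linop A T u y) (partial j u y) =
    partial j F y - app (partial j A y) (u y) - pow m (partial j T y) (u y).
Proof.
move=> sol co cA cT cF y Uy; set e := delta_mx 0 j.
have cu := solves_continuous sol co (Ck_prev cA) (Ck_prev cT) (Ck_prev cF).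
have dq (g : 'rV[R]_s -> sform V) : Ck U 1 g ->
    (fun h : R => h^-1 *: (g (h *: e + y) - g y)) @ 0^' --> partial j g y.
  by move=> /Ck_derivable /(_ j y Uy).
have shy : (h *: e + y) @[h --> (0 : R)^'] --> y.
  rewrite -[X in _ --> X]add0r -(scale0r e).
  by apply: cvgD; [apply: cvgZr_tmp; exact: nbhs_dnbhs|exact: cvg_cst].
have sh (B : normedModType R) (g : 'rV[R]_s -> B) : Ck U 0 g ->
    g (h *: e + y) @[h --> 0^'] --> g y.
  by move=> [cg _]; apply: cvg_comp shy (cg y Uy).
have Ush : \forall h \near 0^', U (h *: e + y).
  by apply: shy; exact: open_nbhs_nbhs.
(* The difference quotients solve [solves_diff] divided by h. The operators converge to [linop]
   because [u] is already known to be continuous. *)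
have [||||w0 ww Mw] := @coercive_cvg _ _ Vc R ((0 : R)^') _
  (fun h => A (h *: e + y) + ddiv m (T (h *: e + y)) (u (h *: e + y)) (u y))
  (fun h => h^-1 *: (u (h *: e + y) - u y))
  (fun h => h^-1 *: (F (h *: e + y) - F y)
     - app (h^-1 *: (A (h *: e + y) - A y)) (u y)
     - pow m (h^-1 *: (T (h *: e + y) - T y)) (u y))
  (linop A T u y)
  (partial j F y - app (partial j A y) (u y) - pow m (partial j T y) (u y))
  c c0.
- apply: cvgD; first exact/sh/Ck_prev.
  apply: ddiv_cvg; [exact/sh/Ck_prev|exact: sh|exact: cvg_cst].
- apply: cvgB; last by apply: pow_cvg; [exact: dq|exact: cvg_cst].
  apply: cvgB; first exact: dq.
  by apply: app_cvg; [exact: dq|exact: cvg_cst].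
- near=> h; have Uh : U (h *: e + y) by near: h.
  by rewrite appZr (solves_diff sol)// appZl powZ !scalerBr.
- near=> h; have Uh : U (h *: e + y) by near: h.
  by move=> d; exact: co.
have dw : partial j u y = w0 by apply: cvg_lim => //; exact: norm_hausdorff.
by split; [exact: cvgP ww|rewrite dw].
Unshelve. all: by end_near. Qed.

End solution.

(** Each partial derivative of [u] solves an equation of the same kind with T = 0, whose operator
    [linop] and right-hand side contain [u] itself but not its derivatives. The induction hypothesis
    is therefore used twice: for [u], making these data C^k, and then for [partial j u]. *)
Lemma solves_Ck (R : realType) (V : normedModType R) (Vc : fast_complete V)
    (s : nat) (U : set 'rV[R]_s) (oU : open U) (m : nat) (c : R) (c0 : 0 < c)
    k (A T F : 'rV[R]_s -> sform V) (u : 'rV[R]_s -> V) :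
  solves U m A T F u -> coercive U m c A T u ->
  Ck U k A -> Ck U k T -> Ck U k F -> Ck U k u.
Proof.
elim: k A T F u => [|k IH] A T F u sol co cA cT cF.
  exact: solves_continuous co cA cT cF.
have cu := IH _ _ _ _ sol co (Ck_prev cA) (Ck_prev cT) (Ck_prev cF).
split=> [|j]; first exact: Ck_cont cu.
have dju := solves_derivable Vc oU c0 j sol co (Ck_leq (ltn0Sn k) cA)
  (Ck_leq (ltn0Sn k) cT) (Ck_leq (ltn0Sn k) cF).
split=> [y /dju[]//|].
apply: (IH (linop m A T u) (cst 0) (fun y => partial j F y -
  app (partial j A y) (u y) - pow m (partial j T y) (u y))).
- by move=> y /dju[_ <-]; rewrite pow0 addr0.
- by move=> y' y Uy' Uy d; rewrite ddiv0 addr0; exact: co.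
- exact: (CkD oU (Ck_prev cA) (Ck_ddiv oU m (Ck_prev cT) cu cu)).
- exact: Ck_cst.
- have cuA := Ck_app oU (Ck_partial cA j) cu.
  exact: (CkB oU (CkB oU (Ck_partial cF j) cuA) (Ck_pow oU m (Ck_partial cT j) cu)).
Qed.

(** * Derivative bounds *)

Section splits.
Context (T : eqType).
Implicit Types l : seq T.

(** All 2^n ways, with multiplicity: binomial coefficients occur only as the numbers of pairs with
    given sizes, and the Leibniz rule has no coefficients. *)
Fixpoint splits l : seq (seq T * seq T) :=
  if l is j :: l' then
    [seq (j :: p.1, p.2) | p <- splits l'] ++ [seq (p.1, j :: p.2) | p <- splits l']
  else [:: ([::], [::])].

Lemma size_splits l p : p \in splits l -> (size p.1 + size p.2 = size l)%N.
Proof.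
elim: l p => [|j l IH] p /=; first by rewrite inE => /eqP ->.
by rewrite mem_cat => /orP[] /mapP[q /IH <- ->] /=; rewrite ?addnS.
Qed.

Lemma subseq_splits l p : p \in splits l -> subseq p.1 l /\ subseq p.2 l.
Proof.
elim: l p => [|j l IH] p /=; first by rewrite inE => /eqP ->.
rewrite mem_cat => /orP[] /mapP[q /IH[s1 s2] ->] /=; rewrite eqxx; split=> //.
  by case: (q.2) s2 => //= a q2; case: eqP => // _ /cons_subseq.
by case: (q.1) s1 => //= a q1; case: eqP => // _ /cons_subseq.
Qed.

Context (W : nmodType).

Lemma big_splits_cons (F : seq T * seq T -> W) (P : pred (seq T * seq T)) j l :
  \sum_(p <- splits (j :: l) | P p) F p =
  \sum_(p <- splits l | P (j :: p.1, p.2)) F (j :: p.1, p.2) +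
  \sum_(p <- splits l | P (p.1, j :: p.2)) F (p.1, j :: p.2).
Proof. by rewrite /= big_cat !big_map. Qed.

Lemma big_splits_nil1 (F : seq T * seq T -> W) l :
  \sum_(p <- splits l | nilp p.1) F p = F ([::], l).
Proof.
elim: l F => [|j l IH] F; first by rewrite big_cons big_nil addr0.
rewrite big_splits_cons /= big_pred0// add0r.
exact: (IH (fun p => F (p.1, j :: p.2))).
Qed.

Lemma big_splits_nil2 (F : seq T * seq T -> W) l :
  \sum_(p <- splits l | nilp p.2) F p = F (l, [::]).
Proof.
elim: l F => [|j l IH] F; first by rewrite big_cons big_nil addr0.
rewrite big_splits_cons /= [X in _ + X]big_pred0// addr0.
exact: (IH (fun p => F (j :: p.1, p.2))).
Qed.

Definition inner (p : seq T * seq T) := ~~ nilp p.1 && ~~ nilp p.2.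

Lemma big_splits_inner (F : seq T * seq T -> W) l : ~~ nilp l ->
  \sum_(p <- splits l) F p =
  F (l, [::]) + F ([::], l) + \sum_(p <- splits l | inner p) F p.
Proof.
move=> l0; rewrite (bigID (fun p => nilp p.2)) /= big_splits_nil2 -addrA; congr (_ + _).
rewrite (bigID (fun p => nilp p.1)) /= -(big_splits_nil1 F l); congr (_ + _).
  rewrite big_seq_cond [RHS]big_seq_cond; apply: eq_bigl => p.
  case: (boolP (p \in splits l)) => //= /size_splits pl.
  case: (boolP (nilp p.1)); rewrite ?andbF// andbT => /nilP p1.
  by rewrite p1 add0n in pl; rewrite /nilp pl -/(nilp l).
by apply: eq_bigl => p; rewrite andbC.
Qed.

End splits.

(** * Falling factorials of one half *)

Section half_factorials.
Context (R : realType).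

Definition ffact (q : R) n : R := \prod_(i < n) (q - i%:R).

Lemma ffactS q n : ffact q n.+1 = ffact q n * (q - n%:R).
Proof. by rewrite /ffact big_ord_recr. Qed.

(** The Chu-Vandermonde identity. A new entry joins either part, and (x - k) + (y - (n - k)) = x + y
    - n. *)
Lemma ffact_splits (T : eqType) (x y : R) (l : seq T) :
  \sum_(p <- splits l) ffact x (size p.1) * ffact y (size p.2) =
  ffact (x + y) (size l).
Proof.
elim: l => [|j l IH]; first by rewrite /= big_cons big_nil addr0 /ffact !big_ord0 mulr1.
rewrite big_splits_cons -big_split -[size (j :: l)]/(size l).+1 [RHS]ffactS -IH.
rewrite mulr_suml big_seq [RHS]big_seq; apply: eq_bigr => p /size_splits /= <-.
by rewrite !ffactS natrD; ring.
Qed.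

Lemma ffact_halfE n : ffact_half R n = `|ffact 2^-1 n|. Proof. by []. Qed.

Lemma ffact_half_ge0 n : 0 <= ffact_half R n.
Proof. exact: normr_ge0. Qed.

Lemma ffact_half0 : ffact_half R 0 = 1.
Proof. by rewrite ffact_halfE /ffact big_ord0 normr1. Qed.

Lemma ffact_half1 : ffact_half R 1 = 2^-1.
Proof. by rewrite ffact_halfE /ffact big_ord1 subr0 gtr0_norm// invr_gt0. Qed.

Lemma ffact_halfS n : ffact_half R n.+2 = ffact_half R n.+1 * (n.+1%:R - 2^-1).
Proof.
rewrite !ffact_halfE ffactS normrM; congr (_ * _).
rewrite distrC ger0_norm// subr_ge0 (@le_trans _ _ 1)//; last by rewrite ler1n.
by rewrite invf_le1// ler1n.
Qed.

Lemma ffact_half_sign n : ffact 2^-1 n.+1 = (-1) ^+ n * ffact_half R n.+1.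
Proof.
elim: n => [|n IH]; first by rewrite expr0 mul1r ffact_half1 /ffact big_ord1 subr0.
by rewrite ffactS IH ffact_halfS [in RHS]exprS; ring.
Qed.

(** For n >= 2 the Vandermonde sum for 1/2 + 1/2 is (1)_n = 0. The inner terms all have the sign
    (-1)^n and the two extreme terms the opposite sign, so the absolute values balance. For n = 1
    there are no inner splittings. *)
Lemma ffact_half_inner (T : eqType) (l : seq T) : ~~ nilp l ->
  \sum_(p <- splits l | inner p) ffact_half R (size p.1) * ffact_half R (size p.2)
  <= 2 * ffact_half R (size l).
Proof.
move=> l0; have := ffact_splits 2^-1 2^-1 l; rewrite big_splits_inner//.
set n := size l; have n0 : (0 < n)%N by rewrite lt0n.
rewrite -/n /= (_ : ffact 2^-1 0 = 1); last by rewrite /ffact big_ord0.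
rewrite mulr1 mul1r -{1 2 3}(prednK n0) ffact_half_sign (prednK n0).
rewrite (_ : \sum_(p <- _ | _) _ = (-1) ^+ n * \sum_(p <- splits l | inner p)
    ffact_half R (size p.1) * ffact_half R (size p.2)); last first.
  rewrite mulr_sumr big_seq_cond [RHS]big_seq_cond; apply: eq_bigr => p.
  move=> /and3P[/size_splits pl p1 p2].
  rewrite -(@prednK (size p.1)) ?lt0n// -[in ffact _ (size p.2)](@prednK (size p.2)) ?lt0n//.
  rewrite !ffact_half_sign !prednK ?lt0n// /n -pl.
  rewrite -{3}(@prednK (size p.1)) ?lt0n// -{3}(@prednK (size p.2)) ?lt0n//.
  by rewrite addnS addSn !exprS exprD; ring.
have -> : (-1) ^+ n = - (-1) ^+ n.-1 :> R by rewrite -{1}(prednK n0) exprS mulN1r.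
set S := \sum_(p <- _ | _) _.
have -> : 2^-1 + 2^-1 = 1 :> R by lra.
set e := (-1) ^+ n.-1; have ee : e * e = 1 by rewrite -expr2 sqrr_sign.
case: (posnP n.-1) => [n1 | n1 H].
  rewrite /e n1 (_ : n = 1%N); last by rewrite -(prednK n0) n1.
  rewrite /ffact big_ord1 ffact_half1 expr0 subr0 => H; lra.
suff -> : S = 2 * ffact_half R n by [].
move/(congr1 (fun z => e * z)) : H.
rewrite (_ : ffact 1 n = 0) ?mulr0; last first.
  rewrite -(prednK n0) -(prednK n1) /ffact; apply/eqP/prodf_eq0.
  by exists (inord 1) => //; rewrite inordK// subrr.
rewrite (_ : e * _ = (e * e) * (2 * ffact_half R n - S)); last by ring.
by rewrite ee mul1r => /eqP; rewrite subr_eq0 => /eqP.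
Qed.

End half_factorials.

(** * The Leibniz rule for contractions *)

Section leibniz.
Context (R : realType) (V : normedModType R) (s : nat).
Context (U : set 'rV[R]_s) (oU : open U).

Lemma derivable_sum_seq (B : normedModType R) (I : Type) (r : seq I)
    (G : I -> 'rV[R]_s -> B) y e :
  (forall p, derivable (G p) y e) ->
  is_derive y e (fun z => \sum_(p <- r) G p z) (\sum_(p <- r) 'D_e (G p) y).
Proof.
move=> dG; elim: r => [|p r IH].
  rewrite big_nil (_ : (fun z => _) = cst 0); first exact: is_derive_cst.
  by apply/funext => z; rewrite big_nil.
rewrite big_cons (_ : (fun z => _) = G p + (fun z => \sum_(q <- r) G q z)).
  by apply: is_deriveD; exact: derivableP.
by apply/funext => z; rewrite big_cons.
Qed.

Lemma leibniz_app (x : 'rV[R]_s -> sform V) (u : 'rV[R]_s -> V) l :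
  smooth_on U x -> smooth_on U u -> forall y, U y ->
  iter_partial l (fun z => app (x z) (u z)) y =
  \sum_(p <- splits l) app (iter_partial p.1 x y) (iter_partial p.2 u y).
Proof.
move=> sx su; elim: l => [|j l IH] y Uy; first by rewrite big_cons big_nil addr0.
rewrite big_splits_cons -big_split /= (partial_eq_on oU j IH)//.
have dp (p : seq 'I_s * seq 'I_s) : is_derive y (delta_mx 0 j)
    (fun z => app (iter_partial p.1 x z) (iter_partial p.2 u z))
    (app (iter_partial (j :: p.1) x y) (iter_partial p.2 u y) +
     app (iter_partial p.1 x y) (iter_partial (j :: p.2) u y)).
  have [_ /(_ j) d1] := sx p.1 y Uy; have [_ /(_ j) d2] := su p.2 y Uy.
  by apply: is_derive_app; exact: derivableP.
have [|_] := derivable_sum_seq (splits l) (y := y) (e := delta_mx 0 j) (G := fun p z =>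
    app (iter_partial p.1 x z) (iter_partial p.2 u z)).
  by move=> p; have [] := dp p.
by rewrite /partial => ->; apply: eq_bigr => p _; have [_ ->] := dp p.
Qed.

Lemma smooth_on_app (x : 'rV[R]_s -> sform V) (u : 'rV[R]_s -> V) :
  smooth_on U x -> smooth_on U u -> smooth_on U (fun z => app (x z) (u z)).
Proof.
by move=> /smooth_onP sx /smooth_onP su; apply/smooth_onP => k; exact: Ck_app.
Qed.

Lemma smooth_on_pow n (x : 'rV[R]_s -> sform V) (u : 'rV[R]_s -> V) :
  smooth_on U x -> smooth_on U u -> smooth_on U (fun z => pow n (x z) (u z)).
Proof. by move=> sx su; elim: n => [//|n IH]; exact: smooth_on_app IH su. Qed.

Lemma iter_partial_eq_on (B : normedModType R) (g h : 'rV[R]_s -> B) l :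
  (forall y, U y -> g y = h y) ->
  forall y, U y -> iter_partial l g y = iter_partial l h y.
Proof. by move=> gh; elim: l => //= j l IH; exact: (partial_eq_on oU j IH). Qed.

Lemma iter_partialD_on (B : normedModType R) (g h : 'rV[R]_s -> B) l :
  smooth_on U g -> smooth_on U h -> forall y, U y ->
  iter_partial l (fun z => g z + h z) y = iter_partial l g y + iter_partial l h y.
Proof.
move=> sg sh; elim: l => //= j l IH y Uy; rewrite (partial_eq_on oU j IH)//.
have [_ /(_ j) d1] := sg l y Uy; have [_ /(_ j) d2] := sh l y Uy.
by rewrite /partial -deriveD.
Qed.

End leibniz.

(** * Majorants of derivatives *)

Section jets.
Context (R : realType) (V : normedModType R) (s : nat).
Context (U : set 'rV[R]_s) (oU : open U) (y : 'rV[R]_s) (Uy : U y).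
Context (Q : pred (seq 'I_s)) (wt : seq 'I_s -> R) (rho : R).
(** [Q] will be sortedness and [wt] the Gevrey weight. Products only require that [Q] passes to the
    parts of a splitting and that [wt] is submultiplicative over them. *)
Hypothesis Q_splits : forall l p, Q l -> p \in splits l -> Q p.1 && Q p.2.
Hypothesis wt_ge0 : forall l, 0 <= wt l.
Hypothesis wt_splits : forall l p, p \in splits l -> wt l <= wt p.1 * wt p.2.
Hypothesis rho2 : 2 <= rho.

Let rho0 : 0 < rho. Proof. exact: lt_le_trans rho2. Qed.

(** The exponent [n.-1] is what makes a product of two such factors of positive order lose one power
    of rho. *)
Definition gfac n : R := rho ^+ n.-1 * ffact_half R n.

Lemma gfac_ge0 n : 0 <= gfac n.
Proof. by rewrite mulr_ge0 ?ffact_half_ge0// exprn_ge0// ltW. Qed.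

(* A bounds the value and X the scaled derivatives of order < n; the class is
   chosen so that A and A + X are both multiplicative (jet_app). *)
Definition jet n (B : normedModType R) (A X : R) (g : 'rV[R]_s -> B) :=
  `|g y| <= A /\ forall l, Q l -> ~~ nilp l -> (size l < n)%N ->
    `|iter_partial l g y| * wt l <= X * gfac (size l).

(** Both parts of an inner splitting are shorter than [l], so order n is reached although the jets
    bound only orders below n. The leading [rho] records the lost power. *)
Lemma jet_app_rem n A X B Y (x : 'rV[R]_s -> sform V) (u : 'rV[R]_s -> V) l :
  smooth_on U x -> smooth_on U u -> 0 <= X -> 0 <= Y ->
  jet n A X x -> jet n B Y u -> Q l -> ~~ nilp l -> (size l <= n)%N ->
  rho * (`|iter_partial l (fun z => app (x z) (u z)) y -
    (app (iter_partial l x y) (u y) + app (x y) (iter_partial l u y))| * wt l) <=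
  X * Y * (2 * gfac (size l)).
Proof.
move=> sx su X0 Y0 [_ jx] [_ ju] Ql l0 ln.
rewrite (leibniz_app oU _ sx su Uy) big_splits_inner//= [_ - _]addrC addKr.
apply: (@le_trans _ _ (\sum_(p <- splits l | inner p) X * Y * rho ^+ (size l).-1 *
    (ffact_half R (size p.1) * ffact_half R (size p.2)))); last first.
  rewrite -mulr_sumr /gfac -!mulrA; do 2!rewrite ler_wpM2l//.
  rewrite mulrCA ler_wpM2l ?exprn_ge0 ?(ltW rho0)//.
  exact: ffact_half_inner.
rewrite (@le_trans _ _ (rho * ((\sum_(p <- splits l | inner p)
  `|app (iter_partial p.1 x y) (iter_partial p.2 u y)|) * wt l)))//.
  by rewrite ler_pM2l// ler_wpM2r// ler_norm_sum.
rewrite mulr_suml mulr_sumr big_seq_cond [leRHS]big_seq_cond.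
apply: ler_sum => p /and3P[pl p1 p2]; have /andP[Q1 Q2] := Q_splits Ql pl.
have sz := size_splits pl.
have s1 : (0 < size p.1)%N by rewrite lt0n.
have s2 : (0 < size p.2)%N by rewrite lt0n.
have l1 : (size p.1 < n)%N by rewrite (leq_trans _ ln)// -sz -addn1 leq_add2l.
have l2 : (size p.2 < n)%N by rewrite (leq_trans _ ln)// -sz -add1n leq_add2r.
apply: (@le_trans _ _ (rho * ((`|iter_partial p.1 x y| * wt p.1) *
    (`|iter_partial p.2 u y| * wt p.2)))).
  rewrite ler_pM2l// mulrACA ler_pM//; first exact: app_norm.
  exact: wt_splits.
apply: (@le_trans _ _ (rho * ((X * gfac (size p.1)) * (Y * gfac (size p.2))))).
  by rewrite ler_pM2l// ler_pM ?mulr_ge0// ?jx ?ju.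
rewrite /gfac (_ : rho ^+ (size l).-1 = rho * (rho ^+ (size p.1).-1 *
    rho ^+ (size p.2).-1)); first by rewrite le_eqVlt; apply/predU1P; left; ring.
by rewrite -exprD -exprS -sz -{1}(prednK s1) -{1}(prednK s2) addSn addnS.
Qed.

(** The two extreme splittings give X B and A Y. The inner ones give X Y, where [2 <= rho] absorbs
    the Vandermonde factor 2. *)
Lemma jet_app n A X B Y (x : 'rV[R]_s -> sform V) (u : 'rV[R]_s -> V) :
  smooth_on U x -> smooth_on U u -> 0 <= X -> 0 <= Y ->
  jet n A X x -> jet n B Y u ->
  jet n (A * B) ((A + X) * (B + Y) - A * B) (fun z => app (x z) (u z)).
Proof.
move=> sx su X0 Y0 jx ju; have [xA jx'] := jx; have [uB ju'] := ju.
have A0 : 0 <= A by exact: le_trans xA.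
have B0 : 0 <= B by exact: le_trans uB.
split; first by rewrite (le_trans (app_norm _ _))// ler_pM.
move=> l Ql l0 ln.
have rem := jet_app_rem sx su X0 Y0 jx ju Ql l0 (ltnW ln).
have b1 := jx' _ Ql l0 ln; have b2 := ju' _ Ql l0 ln.
set D := iter_partial l (fun z => _) y in rem *.
set E := app _ _ + _ in rem.
have : `|E| * wt l <= (X * B + A * Y) * gfac (size l).
  rewrite /E (@le_trans _ _ ((`|app (iter_partial l x y) (u y)| +
      `|app (x y) (iter_partial l u y)|) * wt l))//.
    by rewrite ler_wpM2r// ler_normD.
  rewrite [leRHS]mulrDl mulrDl lerD//.
    rewrite (@le_trans _ _ ((`|iter_partial l x y| * wt l) * `|u y|))//.
      by rewrite mulrAC ler_wpM2r// app_norm.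
    by rewrite [leRHS]mulrAC ler_pM// mulr_ge0.
  rewrite (@le_trans _ _ (`|x y| * (`|iter_partial l u y| * wt l)))//.
    by rewrite mulrA ler_wpM2r// app_norm.
  by rewrite -mulrA ler_pM// mulr_ge0.
have : `|D - E| * wt l <= X * Y * gfac (size l).
  have w0 : 0 <= `|D - E| * wt l by rewrite mulr_ge0.
  have := ler_wpM2r w0 rho2; move=> /le_trans/(_ rem); nra.
have : `|D| * wt l <= (`|D - E| + `|E|) * wt l.
  by rewrite ler_wpM2r// -{1}(subrK E D) ler_normD.
set g := gfac _; rewrite mulrDl => h1 h2 h3; rewrite (le_trans h1)//.
rewrite (le_trans (lerD h2 h3))//; rewrite le_eqVlt; apply/predU1P; left; ring.
Qed.

Lemma jet_pow n k A X B Y (x : 'rV[R]_s -> sform V) (u : 'rV[R]_s -> V) :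
  smooth_on U x -> smooth_on U u -> 0 <= A -> 0 <= X -> 0 <= B -> 0 <= Y ->
  jet n A X x -> jet n B Y u ->
  jet n (A * B ^+ k) ((A + X) * (B + Y) ^+ k - A * B ^+ k)
    (fun z => pow k (x z) (u z)).
Proof.
move=> sx su A0 X0 B0 Y0 jx ju; elim: k => [|k IH].
  by rewrite !expr0 !mulr1 [A + X]addrC addrK.
have jX : 0 <= (A + X) * (B + Y) ^+ k - A * B ^+ k.
  rewrite subr_ge0 ler_pM ?exprn_ge0 ?lerDl// lerXn2r ?nnegrE ?addr_ge0//.
  by rewrite lerDl.
have := jet_app (smooth_on_pow oU k sx su) su jX Y0 IH ju.
rewrite -mulrA -exprSr; congr (jet _ _ _ _).
by rewrite [A * _ + _]addrC subrK -mulrA -exprSr.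
Qed.

(** The terms subtracted are those where all derivatives fall on [x], or all on one factor [u].
    Accordingly the bound is the full majorant (A + X)(B + Y)^k without A B^k (the value), X B^k
    (all on [x]) and k A Y B^(k-1) (all on one [u]). *)
Lemma jet_pow_rem n k A X B Y (x : 'rV[R]_s -> sform V) (u : 'rV[R]_s -> V) l :
  smooth_on U x -> smooth_on U u -> 0 <= A -> 0 <= X -> 0 <= B -> 0 <= Y ->
  jet n A X x -> jet n B Y u -> Q l -> ~~ nilp l -> (size l <= n)%N ->
  rho * (`|iter_partial l (fun z => pow k (x z) (u z)) y -
    (pow k (iter_partial l x y) (u y) +
     app (ddiv k (x y) (u y) (u y)) (iter_partial l u y))| * wt l) <=
  ((A + X) * ((B + Y) ^+ k - B ^+ k) - k%:R * A * Y * B ^+ k.-1) *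
    (2 * gfac (size l)).
Proof.
move=> sx su A0 X0 B0 Y0 jx ju Ql l0 ln; have [_ ju1] := ju; have [uB _] := ju.
elim: k => [|k IH].
  by rewrite /= app0l addr0 subrr normr0 !mul0r mulr0 !expr0 subrr mulr0 subrr mul0r.
have jp := jet_pow k sx su A0 X0 B0 Y0 jx ju.
have jX : 0 <= (A + X) * (B + Y) ^+ k - A * B ^+ k.
  rewrite subr_ge0 ler_pM ?exprn_ge0 ?lerDl// lerXn2r ?nnegrE ?addr_ge0//.
  by rewrite lerDl.
have := jet_app_rem (smooth_on_pow oU k sx su) su jX Y0 jp ju Ql l0 ln.
rewrite app_ddiv_sameS.
rewrite -[fun z => app (pow k (x z) (u z)) (u z)]/(fun z => pow k.+1 (x z) (u z)).
rewrite -[pow k.+1 (iter_partial l x y) (u y)]/(app (pow k (iter_partial l x y) (u y)) (u y)).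
move: IH.
set P1 := iter_partial l (fun z => pow k.+1 _ _) y.
set P0 := iter_partial l (fun z => pow k _ _) y.
set dx := pow k (iter_partial l x y) (u y); set dd := app (ddiv _ _ _ _) _.
set a := app (pow k (x y) (u y)) _ => IH1 IH2.
(* The remainder of x u^(k+1) is that of the product (x u^k) u plus the remainder of x u^k
   contracted with u. *)
rewrite (_ : P1 - _ = (P1 - (app P0 (u y) + a)) + app (P0 - (dx + dd)) (u y)); last first.
  by rewrite appBl appDl; apply: sformP => t; rewrite !(sformDE, sformNE); ring.
apply: (@le_trans _ _ (rho * (`|P1 - (app P0 (u y) + a)| * wt l) +
   (rho * (`|P0 - (dx + dd)| * wt l)) * B)).
  rewrite -mulrA -mulrDr ler_pM2l// mulrAC -mulrDl ler_wpM2r//.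
  rewrite (le_trans (ler_normD _ _))// lerD2l (le_trans (app_norm _ _))//.
  by rewrite ler_wpM2l.
rewrite (le_trans (lerD IH2 (ler_wpM2r B0 IH1)))// le_eqVlt; apply/predU1P; left.
case: (k) => [|k'] /=; rewrite ?exprS -?natr1 ?expr0; ring.
Qed.

(** Induction on the order. In the equation of order |l|, the top derivatives of F, A, T enter with
    the factor rho of the first summand of the numerical hypothesis, the two remainders with the
    factor 2 of the second; that hypothesis is the resulting inequality divided by
    [gfac (size l)]. *)
Lemma solution_bound m c (A T F : 'rV[R]_s -> sform V) (u : 'rV[R]_s -> V)
    (A0 T0 F0 ub Cu : R) :
  solves U m A T F u ->
  (forall d, c * `|d| <= `|app (linop m A T u y) d|) ->
  smooth_on U A -> smooth_on U T -> smooth_on U F -> smooth_on U u ->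
  (forall n, jet n A0 A0 A) -> (forall n, jet n T0 T0 T) ->
  (forall n, jet n F0 F0 F) -> `|u y| <= ub -> 0 < c -> 0 <= Cu ->
  rho * (F0 + A0 * ub + T0 * ub ^+ m) +
    2 * (A0 * Cu + ((T0 + T0) * ((ub + Cu) ^+ m - ub ^+ m) -
      m%:R * T0 * Cu * ub ^+ m.-1)) <= c * rho * Cu ->
  forall n, jet n ub Cu u.
Proof.
move=> sol co sA sT sF su jA jT jF uub c0 Cu0 num.
have A00 : 0 <= A0 by have [h _] := jA 0; exact: le_trans h.
have T00 : 0 <= T0 by have [h _] := jT 0; exact: le_trans h.
have ub0 : 0 <= ub by exact: le_trans uub.
elim=> [|n IH]; split => // l Ql l0; rewrite ltnS => ln.
have rA := jet_app_rem sA su A00 Cu0 (jA n) IH Ql l0 ln.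
have rT := jet_pow_rem m sT su T00 T00 ub0 Cu0 (jT n) IH Ql l0 ln.
have [_ /(_ l Ql l0 (ltnSn _)) dA] := jA (size l).+1.
have [_ /(_ l Ql l0 (ltnSn _)) dT] := jT (size l).+1.
have [_ /(_ l Ql l0 (ltnSn _)) dF] := jF (size l).+1.
have eqn := iter_partialD_on oU l (smooth_on_app oU sA su) (smooth_on_pow oU m sT su) Uy.
rewrite (iter_partial_eq_on oU l sol Uy) in eqn.
move: rA rT eqn; set PA := iter_partial l (fun z => app _ _) y.
set PT := iter_partial l (fun z => pow _ _ _) y.
set ra := PA - _; set rt := PT - _ => rA rT eqn.
have E : app (linop m A T u y) (iter_partial l u y) =
    iter_partial l F y - app (iter_partial l A y) (u y)
    - pow m (iter_partial l T y) (u y) - ra - rt.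
  rewrite eqn /ra /rt /linop appDl.
  set a1 := app (A y) _; set a2 := app (ddiv _ _ _ _) _.
  set b1 := app _ (u y); set b2 := pow _ _ _.
  by apply: sformP => t; rewrite !(sformDE, sformNE); ring.
have cr0 : 0 < c * rho by rewrite mulr_gt0.
rewrite -(ler_pM2l cr0); set g := gfac (size l) in rA rT dA dT dF *.
have g0 : 0 <= g by exact: gfac_ge0.
apply: (@le_trans _ _ (rho * (`|iter_partial l F y| * wt l) +
    rho * ((`|iter_partial l A y| * wt l) * ub) +
    rho * ((`|iter_partial l T y| * wt l) * ub ^+ m) +
    rho * (`|ra| * wt l) + rho * (`|rt| * wt l))).
  rewrite -!mulrDr [leLHS](_ : _ = rho * (c * `|iter_partial l u y| * wt l)); last by ring.
  rewrite ler_pM2l// [`|iter_partial l A y| * _ * _]mulrAC.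
  rewrite [`|iter_partial l T y| * _ * _]mulrAC -!mulrDl ler_wpM2r//.
  rewrite (le_trans (co _))// E.
  do 2!rewrite (le_trans (ler_normB _ _))// lerD//.
  rewrite (le_trans (ler_normB _ _))// lerD//; last first.
    rewrite (le_trans (pow_norm _ _ _))// ler_wpM2l// lerXn2r ?nnegrE//.
  rewrite (le_trans (ler_normB _ _))// lerD// (le_trans (app_norm _ _))//.
  by rewrite ler_wpM2l.
apply: (@le_trans _ _ (g * (c * rho * Cu))); last first.
  by rewrite le_eqVlt; apply/predU1P; left; ring.
rewrite (le_trans _ (ler_wpM2l g0 num))//.
apply: (@le_trans _ _ (rho * (F0 * g) + rho * (A0 * g * ub) +
    rho * (T0 * g * ub ^+ m) + A0 * Cu * (2 * g) +
    ((T0 + T0) * ((ub + Cu) ^+ m - ub ^+ m) -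
      m%:R * T0 * Cu * ub ^+ m.-1) * (2 * g))).
  apply: lerD rT; apply: lerD rA; apply: lerD; [apply: lerD|]; rewrite ler_pM2l//.
    by rewrite ler_wpM2r.
  by rewrite ler_wpM2r// exprn_ge0.
by rewrite le_eqVlt; apply/predU1P; left; ring.
Qed.

End jets.

(** * The choice of the constants *)

Section numerics.
Context (R : realType).

(** With t = ubar and C = Cu this explains the numerator of [const_rho]: once the isolated term m
    t^(m-1) is subtracted, 3 m t^(m-1) becomes m t^(m-1), and the power of 3 C pays for the rest.
    For m >= 3 the crude bound (2C)^m suffices; m = 1 and m = 2 are checked directly. *)
Lemma pow_remainder_le (m : nat) (t C : R) : (0 < m)%N -> 0 <= t -> t <= C ->
  4 * ((t + C) ^+ m - t ^+ m) <=
  C * (3 * m%:R * t ^+ m.-1 + (3 * C) ^+ m.-1 * m.+1%:R).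
Proof.
case: m => // -[|[|n]] _ t0 tC; first by rewrite !expr1 !expr0; lra.
  by rewrite !expr1; nra.
have C0 : 0 <= C by exact: le_trans tC.
apply: (@le_trans _ _ (4 * (C + C) ^+ n.+3)).
  rewrite ler_pM2l// lerBlDr (@le_trans _ _ ((C + C) ^+ n.+3))//.
    by rewrite lerXn2r ?nnegrE ?addr_ge0// lerD2r.
  by rewrite lerDl exprn_ge0.
have p0 : 0 <= C ^+ n.+3 by rewrite exprn_ge0.
have h : 2 ^+ n <= 3 ^+ n :> R by rewrite lerXn2r ?nnegrE// ler_nat.
have n2 : 0 <= 2 ^+ n :> R by rewrite exprn_ge0.
have n4 : 4 <= n.+4%:R :> R by rewrite ler_nat.
have t2 : 0 <= C * (3 * n.+3%:R * t ^+ n.+2) by rewrite mulr_ge0// mulr_ge0 ?exprn_ge0// mulr_ge0.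
rewrite mulrDr (@le_trans _ _ (C * ((3 * C) ^+ n.+2 * n.+4%:R)))//; last first.
  by rewrite lerDr.
rewrite (_ : 4 * _ = (32 * 2 ^+ n) * C ^+ n.+3); last first.
  by rewrite (_ : C + C = 2 * C) ?exprMn ?exprS; ring.
rewrite (_ : C * _ = (9 * 3 ^+ n * n.+4%:R) * C ^+ n.+3); last first.
  by rewrite exprMn !exprS; ring.
rewrite ler_wpM2r//; nra.
Qed.

(** The data bounds carry 2^-n through 2R. Equality holds at n = 1, and afterwards the ratio (n+2)/2
    on the left is at most 2 (n + 1/2) on the right. *)
Lemma fact_le_gfac (rho : R) n : 2 <= rho -> (0 < n)%N ->
  n`!%:R / 2 ^+ n <= gfac rho n.
Proof.
move=> rho2; case: n => // n _; elim: n => [|n IH].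
  by rewrite /gfac ffact_half1 !expr1 expr0 !mul1r.
have -> : n.+2`!%:R / 2 ^+ n.+2 = (n.+1`!%:R / 2 ^+ n.+1) * (n.+2%:R / 2) :> R.
  by rewrite factS natrM [in LHS]exprS invfM; ring.
have -> : gfac rho n.+2 = gfac rho n.+1 * (rho * (n.+1%:R - 2^-1)).
  by rewrite /gfac /= ffact_halfS exprS; ring.
have n0 : 0 <= n%:R :> R by [].
have d0 : 0 <= n.+1`!%:R / 2 ^+ n.+1 :> R by rewrite divr_ge0 ?exprn_ge0.
apply: ler_pM => //.
rewrite -[n.+2]addn2 -[n.+1]addn1 !natrD.
nra.
Qed.

Lemma ffact_half_le_fact n : ffact_half R n <= n`!%:R.
Proof.
case: n => [|n]; first by rewrite ffact_half0.
elim: n => [|n IH]; first by rewrite ffact_half1 invf_le1// ler1n.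
rewrite ffact_halfS factS natrM mulrC ler_pM ?ffact_half_ge0//.
  by rewrite subr_ge0 (@le_trans _ _ 1) ?ler1n// invf_le1// ler1n.
have n0 : 0 <= n%:R :> R by [].
by rewrite -[n.+2]addn2 -[n.+1]addn1 !natrD; lra.
Qed.

(** Half of CA rho Cu pays for the data, because CA Cu = ubar (abar + bbar ubar^(m-1) + 1) and fbar
    <= ubar. The other half pays for the remainders through [pow_remainder_le], which requires ubar
    <= Cu; this is where CA <= 1 enters. *)
Lemma rho_large (m : nat) (abar bbar fbar CA ubar : R) :
  (0 < m)%N -> 0 <= abar -> 0 <= bbar -> 0 < fbar -> fbar <= ubar ->
  0 < CA -> CA <= 1 ->
  forall Cu rho, Cu = const_Cu m abar bbar CA ubar ->
  rho = const_rho m abar bbar CA ubar ->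
  rho * (fbar / 2 + abar / 2 * ubar + bbar / 2 * ubar ^+ m) +
    2 * (abar / 2 * Cu + ((bbar / 2 + bbar / 2) * ((ubar + Cu) ^+ m - ubar ^+ m) -
      m%:R * (bbar / 2) * Cu * ubar ^+ m.-1)) <= CA * rho * Cu.
Proof.
move=> m0 a0 b0 f0 fu CA0 CA1 Cu rho CuE rhoE.
have u0 : 0 < ubar by exact: lt_le_trans fu.
have p0 : 0 <= ubar ^+ m.-1 by rewrite exprn_ge0// ltW.
have CAu : CA * Cu = ubar * (abar + bbar * ubar ^+ m.-1 + 1).
  by rewrite CuE /const_Cu -!mulrA mulVKf// gt_eqF.
have bp0 : 0 <= bbar * ubar ^+ m.-1 by rewrite mulr_ge0.
have uCu : ubar <= Cu.
  have Cu0 : 0 <= Cu.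
    by rewrite CuE /const_Cu !mulr_ge0 ?invr_ge0 ?addr_ge0// ltW.
  by rewrite (@le_trans _ _ (CA * Cu))// ?CAu; nra.
have rhoP : 2 * abar + bbar * (m%:R * ubar ^+ m.-1 +
    (3 * Cu) ^+ m.-1 * m.+1%:R) <= CA * rho.
  rewrite [CA * rho]mulrC -ler_pdivrMr// (@le_trans _ _ ((2 * abar + bbar * (m%:R * ubar ^+ m.-1 +
    (3 * Cu) ^+ m.-1 * m.+1%:R)) / CA + 1))//; first by rewrite lerDl.
  by rewrite rhoE /const_rho -CuE le_max lexx orbT.
have rho0 : 0 <= rho by rewrite rhoE /const_rho le_max ler0n.
have main := pow_remainder_le m0 (ltW u0) uCu.
have Cu0 : 0 < Cu by exact: lt_le_trans uCu.
have h1 : rho * (fbar / 2 + abar / 2 * ubar + bbar / 2 * ubar ^+ m) <=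
    CA * rho * Cu / 2.
  rewrite (_ : CA * rho * Cu / 2 = rho * (CA * Cu / 2)); last by ring.
  rewrite ler_wpM2l// CAu (_ : ubar ^+ m = ubar * ubar ^+ m.-1); last first.
    by rewrite -exprS prednK.
  by move: p0 bp0; set p := ubar ^+ _; nra.
have h2 := ler_wpM2r (ltW Cu0) rhoP.
have h3 := ler_wpM2l b0 main.
move: h1 h2 h3; set w := (ubar + Cu) ^+ m - ubar ^+ m.
set q := (3 * Cu) ^+ _; set p := ubar ^+ m.-1; set k := m%:R; set k1 := m.+1%:R.
set X := rho * (_ + _); move=> h1 h2 h3.
suff : 2 * (abar / 2 * Cu + ((bbar / 2 + bbar / 2) * w - k * (bbar / 2) * Cu * p))
    <= CA * rho * Cu / 2 by lra.
lra.
Qed.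

End numerics.

(** * Multi-indices as sorted lists, and the Gevrey weight *)

Section multi_indices.
Context (s : nat).
Implicit Types (l : seq 'I_s) (nu : {ffun 'I_s -> nat}).

Definition ord_le (i j : 'I_s) := (i <= j)%N.

Lemma ord_le_trans : transitive ord_le.
Proof. by move=> i j k; exact: leq_trans. Qed.

Definition mlist nu : seq 'I_s := flatten [seq nseq (nu j) j | j <- enum 'I_s].

Lemma count_mlist nu j : count_mem j (mlist nu) = nu j.
Proof.
rewrite count_flatten -map_comp sumnE big_map big_enum /= (bigD1 j)//=.
rewrite count_nseq /= eqxx mul1n big1 ?addn0// => i ij.
by rewrite count_nseq /= (negbTE ij).
Qed.

Lemma sorted_mlist nu : sorted ord_le (mlist nu).
Proof.
rewrite sorted_pairwise; last exact: ord_le_trans.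
have : pairwise ord_le (enum 'I_s).
  rewrite -sorted_pairwise; last exact: ord_le_trans.
  by rewrite -(@sorted_map _ _ val leq) val_enum_ord iota_sorted.
rewrite /mlist; elim: (enum _) => //= i e IH /andP[ie /IH {}IH].
rewrite pairwise_cat IH andbT; apply/andP; split.
  apply/allrelP => x z /nseqP[-> _] /flatten_mapP[k ke /nseqP[-> _]].
  exact: (allP ie).
by elim: (nu i) => //= k ->; rewrite andbT; apply/allP => x /nseqP[->]; rewrite /ord_le leqnn.
Qed.

(** Hence bounds on [mpartial] cover every list that the Leibniz rule produces from [mlist nu]. *)
Lemma sorted_is_mlist l : sorted ord_le l -> l = mlist [ffun j => count_mem j l].
Proof.
move=> sl; apply: (sorted_eq ord_le_trans) => //.
- by move=> i j /andP[ij ji]; apply/val_inj/eqP; rewrite eqn_leq; exact/andP.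
- exact: sorted_mlist.
- by apply/allP => j _ /=; rewrite count_mlist ffunE.
Qed.

Lemma size_mlist nu : size (mlist nu) = mdeg nu.
Proof.
rewrite size_flatten /shape -map_comp sumnE big_map big_enum /=.
by apply: eq_bigr => j _; rewrite size_nseq.
Qed.

Lemma sorted_splits l (p : seq 'I_s * seq 'I_s) : sorted ord_le l ->
  p \in splits l -> sorted ord_le p.1 && sorted ord_le p.2.
Proof.
move=> sl /subseq_splits[p1 p2].
by rewrite !(subseq_sorted ord_le_trans _ sl).
Qed.

Context (R : realType) (r : 'I_s -> R) (delta : R).
Hypotheses (r0 : forall j, 0 < r j) (delta1 : 1 <= delta).

Lemma prod_mlist (q : 'I_s -> R) nu : \prod_(j <- mlist nu) q j = mpow q nu.
Proof.
rewrite /mlist big_flatten big_map big_enum; apply: eq_bigr => j _.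
by rewrite big_nseq iter_mulr_1.
Qed.

Definition gweight l : R := (\prod_(j <- l) r j) / (size l)`!%:R `^ (delta - 1).

Lemma gweight_gt0 l : 0 < gweight l.
Proof.
rewrite divr_gt0 ?powR_gt0 ?ltr0n ?fact_gt0//.
by rewrite prodr_gt0.
Qed.

Lemma gweight_ge0 l : 0 <= gweight l.
Proof. exact/ltW/gweight_gt0. Qed.

(** The product of the radii factors exactly, and p! q! <= (p + q)! is raised to the power delta - 1
    >= 0. *)
Lemma gweight_splits l p : p \in splits l ->
  gweight l <= gweight p.1 * gweight p.2.
Proof.
move=> pl; rewrite /gweight -(size_splits pl).
have -> : \prod_(j <- l) r j = (\prod_(j <- p.1) r j) * (\prod_(j <- p.2) r j).
  elim: l p pl => [|j l IH] p; first by rewrite inE => /eqP ->; rewrite !big_nil mulr1.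
  rewrite /= mem_cat big_cons => /orP[] /mapP[q /IH -> ->] /=; rewrite big_cons.
    by rewrite mulrA.
  by rewrite mulrCA.
rewrite mulrACA ler_wpM2l//; first by rewrite mulr_ge0 ?prodr_ge0// => j _; exact: ltW.
rewrite -invfM lef_pV2 ?posrE ?mulr_gt0 ?powR_gt0 ?ltr0n ?fact_gt0//.
rewrite -powRM// ge0_ler_powR ?nnegrE ?subr_ge0//.
rewrite -natrM ler_nat -(bin_fact (leq_addr (size p.2) (size p.1))) addKn.
by rewrite leq_pmull// bin_gt0 leq_addr.
Qed.

Lemma gweight_mlist nu :
  gweight (mlist nu) = mpow r nu / (mdeg nu)`!%:R `^ (delta - 1).
Proof. by rewrite /gweight prod_mlist size_mlist. Qed.

Lemma fact_powR n : n`!%:R `^ delta = n`!%:R `^ (delta - 1) * n`!%:R :> R.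
Proof.
rewrite -[in LHS](subrK 1 delta) [LHS]powRD ?powRr1//.
by rewrite pnatr_eq0 -lt0n fact_gt0 implybT.
Qed.

Lemma mpow_gt0 nu : 0 < mpow r nu.
Proof. by rewrite prodr_gt0// => j _; rewrite exprn_gt0. Qed.

Lemma mpow2 nu : mpow (fun j => 2 * r j) nu = 2 ^+ mdeg nu * mpow r nu.
Proof.
rewrite /mpow /mdeg expr_sum -big_split /=; apply: eq_bigr => j _.
by rewrite exprMn.
Qed.

Context (V : normedModType R) (rho : R) (rho2 : 2 <= rho).

Lemma jet_of_bound (g : 'rV[R]_s -> V) (K : R) y : 0 <= K -> `|g y| <= K ->
  (forall nu, `|mpartial nu g y| <=
    K * ((mdeg nu)`!%:R `^ delta / mpow (fun j => 2 * r j) nu)) ->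
  forall n, jet y (sorted ord_le) gweight rho n K K g.
Proof.
move=> K0 gK gd n; split => // l sl l0 _.
rewrite [l]sorted_is_mlist//; set nu := finfun _.
rewrite gweight_mlist size_mlist.
have := gd nu; rewrite /mpartial -/(mlist nu) => gnu.
have f0 : 0 < (mdeg nu)`!%:R `^ (delta - 1) by rewrite powR_gt0 ?ltr0n ?fact_gt0.
rewrite (le_trans (ler_wpM2r _ gnu)) ?divr_ge0 ?(ltW f0) ?(ltW (mpow_gt0 nu))//.
rewrite fact_powR mpow2 (_ : K * _ * _ = K * ((mdeg nu)`!%:R / 2 ^+ mdeg nu)); last first.
  by field; rewrite !gt_eqF ?exprn_gt0 ?mpow_gt0.
rewrite ler_wpM2l// fact_le_gfac// -size_mlist -sorted_is_mlist//.
by rewrite lt0n.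
Qed.

End multi_indices.

(** * Integration and completeness of L^2 *)

Section real_integrals.
Context d (T : measurableType d) (R : realType) (mu : {measure set T -> \bar R}).
Implicit Types (f g h : T -> R).

Definition rintegrable f := mu.-integrable setT (EFin \o f).

Lemma rintegrable_measurable f : rintegrable f -> measurable_fun setT f.
Proof. by move=> /integrableP[/measurable_EFinP]. Qed.

Lemma rintegrable_ae_le f g : measurable_fun setT f -> rintegrable g ->
  {ae mu, forall x, `|f x| <= g x} -> rintegrable f.
Proof.
move=> mf ig fg; apply/integrableP; split; first exact/measurable_EFinP.
have /integrableP[_] := ig; apply: le_lt_trans.
apply: ae_ge0_le_integral => //.
- by apply: measurableT_comp => //; exact/measurable_EFinP.
- apply: measurableT_comp => //; apply/measurable_EFinP.
  exact: rintegrable_measurable.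
apply: filterS fg => x fg _ /=; rewrite lee_fin (le_trans fg)//.
exact: ler_norm.
Qed.

Lemma rintegrable_ae f g : measurable_fun setT f -> rintegrable g ->
  {ae mu, forall x, f x = g x} -> rintegrable f.
Proof.
move=> mf ig fg; apply: (rintegrable_ae_le mf (integrable_norm ig)).
by apply: filterS fg => x ->.
Qed.

Lemma rintegrableD f g : rintegrable f -> rintegrable g ->
  rintegrable (fun x => f x + g x).
Proof. by move=> fi gi; have := integrableD measurableT fi gi. Qed.

Lemma rintegrableZ a f : rintegrable f -> rintegrable (fun x => a * f x).
Proof. by move=> fi; have := integrableZl measurableT a fi. Qed.

Lemma rintegrable0 : rintegrable (fun=> 0).
Proof. exact: integrable0. Qed.

Lemma rintegrable_sum (I : Type) (r : seq I) (F : I -> T -> R) :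
  (forall i, rintegrable (F i)) -> rintegrable (fun x => \sum_(i <- r) F i x).
Proof.
move=> Fi; elim: r => [|i r IH].
  by under eq_fun do rewrite big_nil; exact: rintegrable0.
by under eq_fun do rewrite big_cons; exact: rintegrableD.
Qed.

Lemma Rintegral_ae f g : measurable_fun setT f -> measurable_fun setT g ->
  {ae mu, forall x, f x = g x} -> \int[mu]_x f x = \int[mu]_x g x.
Proof.
move=> mf mg fg; congr fine; apply: ae_eq_integral => //.
- exact/measurable_EFinP.
- exact/measurable_EFinP.
- by apply: filterS fg => x /= -> _.
Qed.

Lemma le_Rintegral_ae f g : rintegrable f -> rintegrable g ->
  {ae mu, forall x, f x <= g x} -> \int[mu]_x f x <= \int[mu]_x g x.
Proof.
move=> fi gi fg; pose h x := Num.max (f x) (g x).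
have mf := rintegrable_measurable fi; have mg := rintegrable_measurable gi.
have mh : measurable_fun setT h by exact: measurable_maxr.
have hg : {ae mu, forall x, h x = g x}.
  by apply: filterS fg => x fg; rewrite /h; apply/max_idPr.
have hi : rintegrable h by exact: rintegrable_ae hg.
rewrite -(Rintegral_ae mh mg hg) le_Rintegral// => x _.
by rewrite /h le_max lexx.
Qed.

Lemma normr_Rintegral_le f g : measurable_fun setT f -> rintegrable g ->
  {ae mu, forall x, `|f x| <= g x} -> `|\int[mu]_x f x| <= \int[mu]_x g x.
Proof.
move=> mf gi fg; have fi := rintegrable_ae_le mf gi fg.
rewrite (le_trans (le_normr_Rintegral measurableT fi))// le_Rintegral_ae//.
exact: integrable_norm.
Qed.

Lemma Rintegral_sum (I : Type) (r : seq I) (F : I -> T -> R) :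
  (forall i, rintegrable (F i)) ->
  \int[mu]_x (\sum_(i <- r) F i x) = \sum_(i <- r) \int[mu]_x F i x.
Proof.
move=> Fi; elim: r => [|i r IH].
  by under eq_Rintegral do rewrite big_nil; rewrite big_nil Rintegral_cst// mul0r.
under eq_Rintegral do rewrite big_cons.
rewrite big_cons RintegralD// ?IH//; first exact: Fi.
exact: rintegrable_sum.
Qed.

(** The arithmetic-geometric mean inequality. Integrated, it bounds a product of n functions when
    all arguments are unit vectors; homogeneity then does the work of the generalised Hölder
    inequality. *)
Lemma power_mean (s : seq R) : (0 < size s)%N ->
  `|\prod_(x <- s) x| <= (\sum_(x <- s) `|x| ^+ size s) / (size s)%:R.
Proof.
move=> s0; set n := size s.
have S0 : 0 <= \sum_(x <- s) `|x| ^+ n by apply: sumr_ge0 => x _; exact: exprn_ge0.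
rewrite -(@ler_pXn2r _ n) ?nnegrE//; last by rewrite divr_ge0.
rewrite -normrX -prodrXl (eq_bigr (fun x => x ^+ n))//.
have := @leif_AGM _ 'I_n predT (fun i => `|s`_i| ^+ n).
rewrite card_ord /= => /(_ (fun i _ => exprn_ge0 _ (normr_ge0 _)))[+ _].
rewrite (big_nth 0) big_mkord -/n normr_prod (big_nth 0 xpredT (fun x => `|x| ^+ n)) big_mkord -/n.
by under [X in _ -> X <= _]eq_bigr do rewrite normrX.
Qed.

Lemma measurable_prod_seq (I : Type) (r : seq I) (F : I -> T -> R) :
  (forall i, measurable_fun setT (F i)) ->
  measurable_fun setT (fun x => \prod_(i <- r) F i x).
Proof.
move=> mF; elim: r => [|i r IH].
  by under eq_fun do rewrite big_nil; exact: measurable_cst.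
by under eq_fun do rewrite big_cons; exact: measurable_funM.
Qed.

Lemma prod_power_bound (I : Type) (r : seq I) (F : I -> T -> R) (b : T -> R) K :
  (0 < size r)%N -> (forall i, measurable_fun setT (F i)) ->
  (forall i, rintegrable (fun x => `|F i x| ^+ size r)) ->
  measurable_fun setT b -> {ae mu, forall x, `|b x| <= K} ->
  rintegrable (fun x => b x * \prod_(i <- r) F i x) /\
  `|\int[mu]_x (b x * \prod_(i <- r) F i x)| <=
    K / (size r)%:R * \sum_(i <- r) \int[mu]_x (`|F i x| ^+ size r).
Proof.
move=> r0 mF iF mb bK; set n := size r in r0 iF *.
have mbF : measurable_fun setT (fun x => b x * \prod_(i <- r) F i x).
  by apply: measurable_funM => //; exact: measurable_prod_seq.
pose g x := K / n%:R * \sum_(i <- r) `|F i x| ^+ n.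
have gi : rintegrable g by apply: rintegrableZ; exact: rintegrable_sum.
have bg : {ae mu, forall x, `|b x * \prod_(i <- r) F i x| <= g x}.
  apply: filterS bK => x bK; rewrite normrM /g -mulrA mulrC [leRHS]mulrC.
  rewrite ler_pM//; have := @power_mean [seq F i x | i <- r].
  by rewrite size_map !big_map -/n mulrC => /(_ r0).
split; first exact: rintegrable_ae_le bg.
rewrite (le_trans (normr_Rintegral_le mbF gi bg))//.
rewrite /g RintegralZl//; last exact: rintegrable_sum.
by rewrite Rintegral_sum.
Qed.

End real_integrals.

Section Lp_functions.
Context d (T : measurableType d) (R : realType) (mu : {measure set T -> \bar R}).

Lemma Lp_measurable p (p1 : (1 <= p)%E) (u : Lp mu p1) :
  measurable_fun setT (u : T -> R).
Proof. exact: measurable_funPT. Qed.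

Lemma Linf_ae_le (a : Lp mu (leey 1)) : {ae mu, forall x, `|a x| <= `|a|}.
Proof.
(* The L^oo norm is an essential supremum only for a nonzero measure; for the zero measure every
   statement holds almost everywhere. *)
have [mu0|mu0] := pselect (0 < mu setT)%E; last first.
  exists setT; split => //; apply/eqP; rewrite eq_le measure_ge0 andbT.
  by rewrite leNgt; apply/negP.
have N : 'N[mu]_+oo[EFin \o a]%E = (`|a|)%:E.
  by rewrite [RHS]finite_norm_fine.
rewrite unlock /= mu0 in N.
have := @ess_sup_ge _ _ _ mu (abse \o (EFin \o a)); rewrite N.
by apply: filterS => x /=; rewrite lee_fin.
Qed.

Lemma power_integral_le (f : T -> R) n K : measurable_fun setT f -> 0 <= K ->
  (0 < n)%N -> ('N[mu]_(n%:R%:E)[EFin \o f] <= K%:E)%E ->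
  rintegrable mu (fun x => `|f x| ^+ n) /\ \int[mu]_x (`|f x| ^+ n) <= K ^+ n.
Proof.
move=> mf K0 n0 fK; have nr0 : n%:R != 0 :> R by rewrite pnatr_eq0 -lt0n.
have I : (\int[mu]_x (`|f x| ^+ n)%:E <= (K ^+ n)%:E)%E.
  rewrite (_ : \int[mu]_x _ = 'N[mu]_(n%:R%:E)[EFin \o f] `^ n%:R)%E.
    rewrite -(powR_mulrn n K0) -poweR_EFin.
    apply: gt0_ler_poweR => //.
    - by rewrite in_itv /= Lnorm_ge0 leey.
    - by rewrite in_itv /= lee_fin K0 leey.
  by rewrite poweR_Lnorm//; apply: eq_integral => x _; rewrite /= powR_mulrn.
have mfn : measurable_fun setT (fun x => `|f x| ^+ n).
  by apply: measurable_funX; exact: measurableT_comp.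
split.
  apply/integrableP; split; first exact/measurable_EFinP.
  rewrite (eq_integral (fun x => (`|f x| ^+ n)%:E)); last first.
    by move=> x _ /=; rewrite ger0_norm// exprn_ge0.
  exact: le_lt_trans I (ltry _).
rewrite -lee_fin /Rintegral fineK// ge0_fin_numE; last first.
  by apply: integral_ge0 => x _; rewrite lee_fin exprn_ge0.
exact: le_lt_trans I (ltry _).
Qed.

Lemma L2_sqr (u : Lp mu (lee1n 2)) : rintegrable mu (fun x => u x ^+ 2) /\
  \int[mu]_x (u x ^+ 2) = `|u| ^+ 2.
Proof.
have N : 'N[mu]_2%:E[EFin \o u]%E = (`|u|)%:E by rewrite [RHS]finite_norm_fine.
have [|ui _] := @power_integral_le u 2 `|u| (Lp_measurable u) (normr_ge0 _) isT.
  by rewrite N.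
have sqE x : `|u x| ^+ 2 = u x ^+ 2 by rewrite real_normK// num_real.
split; first by apply: eq_integrable ui => // x _; rewrite /= sqE.
have := @poweR_Lnorm _ _ _ mu (EFin \o u) 2 (negbT (pnatr_eq0 R 2)).
rewrite N poweR_EFin powR_mulrn// => E.
rewrite /Rintegral -[RHS]/(fine (`|u| ^+ 2)%:E) E; congr fine.
by apply: eq_integral => x _; rewrite /= powR_mulrn// sqE.
Qed.

End Lp_functions.

(** * Multilinear forms bounded on unit vectors *)

Section multilinear_bounds.
Context (R : realType) (V : normedModType R) (n : nat) (phi : seq V -> R) (K : R).
Hypothesis phi_perm : forall s t, perm_eq s t -> phi s = phi t.
Hypothesis phi_lin : forall a v w s, (size s).+1 = n ->
  phi (a *: v + w :: s) = a * phi (v :: s) + phi (w :: s).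
Hypothesis K0 : 0 <= K.
Hypothesis phi_unit : forall s, size s = n -> (forall w, w \in s -> `|w| = 1) ->
  `|phi s| <= K.

Let phi0 s : (size s).+1 = n -> phi (0 :: s) = 0.
Proof.
move=> sn; have := phi_lin 1 0 0 sn; rewrite scaler0 addr0 mul1r => /eqP.
by rewrite -subr_eq subrr eq_sym => /eqP.
Qed.

Let phiZ a v s : (size s).+1 = n -> phi (a *: v :: s) = a * phi (v :: s).
Proof. by move=> sn; rewrite -[a *: v]addr0 phi_lin// phi0// addr0. Qed.

Let phi_scale (c : V -> R) s t : size (s ++ t) = n ->
  phi ([seq c w *: w | w <- s] ++ t) = (\prod_(w <- s) c w) * phi (s ++ t).
Proof.
elim: s t => [|w s IH] t st; first by rewrite big_nil mul1r.
have sw u : perm_eq (w :: u ++ t) (u ++ w :: t).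
  by rewrite -cat_rcons -cats1 perm_sym -catA perm_catCA.
rewrite /= phiZ; last by rewrite -st /= !size_cat size_map.
rewrite (phi_perm (sw [seq c z *: z | z <- s])) IH; last by rewrite -st /= !size_cat /= addnS.
by rewrite big_cons mulrA (phi_perm (sw s)).
Qed.

Lemma multilinear_bound s : size s = n -> `|phi s| <= K * normprod s.
Proof.
move=> sn; have [s0|s0] := boolP (0 \in s).
  have st := perm_to_rem s0.
  rewrite (phi_perm st) phi0 ?normr0 ?mulr_ge0 ?normprod_ge0//.
  by rewrite -sn (perm_size st).
have np : 0 < normprod s.
  rewrite lt_def normprod_ge0 andbT prodf_seq_neq0; apply/allP => w ws /=.
  by rewrite normr_eq0; apply: contraNneq s0 => <-.
have := @phi_scale (fun w => `|w|^-1) s [::]; rewrite !cats0 => /(_ sn) E.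
have := @phi_unit [seq `|w|^-1 *: w | w <- s]; rewrite size_map => /(_ sn).
rewrite E normrM => H.
have : `|\prod_(w <- s) `|w|^-1| * `|phi s| <= K.
  apply: H => _ /mapP[w ws ->]; rewrite normrZ normfV normr_id mulVf// normr_eq0.
  by apply: contraNneq s0 => <-.
rewrite prodfV normfV ger0_norm ?normprod_ge0// -/(normprod s).
by rewrite ler_pdivrMl// mulrC.
Qed.

(** [phi] is multilinear on lists of length n only: an integral of a product, for instance, is
    linear where integrability is known. *)
Definition homogeneous_part : seq V -> R^o := fun s => if size s == n then phi s else 0.

Lemma homogeneous_part_le s : `|homogeneous_part s| <= K * normprod s.
Proof.
rewrite /homogeneous_part; case: eqP => [|_]; first exact: multilinear_bound.
by rewrite normr0 mulr_ge0 ?normprod_ge0.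
Qed.

Lemma homogeneous_part_sform : homogeneous_part \in @sform_pred R V.
Proof.
apply/asboolP; split => [s t st|a v w s|].
- by rewrite /homogeneous_part (perm_size st) (phi_perm st).
- rewrite /homogeneous_part /=; case: eqP => [sn|_]; first exact: phi_lin.
  by rewrite mulr0 addr0.
- by exists K => s; exact: homogeneous_part_le.
Qed.

End multilinear_bounds.

(** * Forms given by integrals *)

Section energy_forms.
Context d (T : measurableType d) (R : realType) (mu : {measure set T -> \bar R}).
Context (V : normedModType R) (k n : nat) (G : 'I_k -> V -> T -> R) (c : R).
Hypotheses (n0 : (0 < n)%N) (c0 : 0 <= c).
Hypothesis mG : forall i v, measurable_fun setT (G i v).
Hypothesis linG : forall i a v w,
  {ae mu, forall x, G i (a *: v + w) x = a * G i v x + G i w x}.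
Hypothesis iG : forall i v, rintegrable mu (fun x => `|G i v x| ^+ n).
(** The normalisation behind [energy_form_norm]. For gradients with c = Cm^2 it is an equality; for
    the functions themselves it is the Sobolev embedding. This is why the norm of V carries the
    factor Cm. *)
Hypothesis nG : forall v, `|v| = 1 ->
  c * \sum_(i < k) \int[mu]_x (`|G i v x| ^+ n) <= 1.
Implicit Types b : Lp mu (leey 1).

(* Used with G the partial derivatives and n = 2 for the diffusion term, and with
   G the function itself and n = m + 1 for the reaction term. *)
Definition energy b (s : seq V) : R :=
  c * \int[mu]_x (b x * \sum_(i < k) \prod_(v <- s) G i v x).

Let Gprod b i s : size s = n ->
  rintegrable mu (fun x => b x * \prod_(v <- s) G i v x) /\
  `|\int[mu]_x (b x * \prod_(v <- s) G i v x)| <=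
    `|b| / n%:R * \sum_(v <- s) \int[mu]_x (`|G i v x| ^+ n).
Proof.
move=> sn; have := @prod_power_bound _ _ _ mu _ s (G i) b `|b|.
rewrite sn; apply => //.
exact: Linf_ae_le.
Qed.

Lemma energy_measurable b s :
  measurable_fun setT (fun x => b x * \sum_(i < k) \prod_(v <- s) G i v x).
Proof.
apply: measurable_funM; first exact: Lp_measurable.
by apply: measurable_sum => i; exact: measurable_prod_seq.
Qed.

Lemma energy_rintegrable b s : size s = n ->
  rintegrable mu (fun x => b x * \sum_(i < k) \prod_(v <- s) G i v x).
Proof.
move=> sn; under eq_fun do rewrite mulr_sumr.
by apply: rintegrable_sum => i; have [] := Gprod b i sn.
Qed.

Let energy_perm b s t : perm_eq s t -> energy b s = energy b t.
Proof.
move=> st; congr (_ * _); apply: eq_Rintegral => x _; congr (_ * _).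
by apply: eq_bigr => i _; exact: perm_big.
Qed.

Let energy_linr b a v w s : (size s).+1 = n ->
  energy b (a *: v + w :: s) = a * energy b (v :: s) + energy b (w :: s).
Proof.
move=> sn; rewrite /energy mulrCA -mulrDr; congr (_ * _).
have iv z := @energy_rintegrable b (z :: s) sn.
rewrite -RintegralZl//; last exact: iv.
rewrite -RintegralD//; [|exact/rintegrableZ/iv|exact: iv].
apply: Rintegral_ae.
- exact: energy_measurable.
- apply: measurable_funD; last exact: energy_measurable.
  by apply: measurable_funM => //; exact: energy_measurable.
have : {ae mu, forall x i, G i (a *: v + w) x = a * G i v x + G i w x}.
  by apply: filter_forall => i; exact: linG.
apply: filterS => x Gx; rewrite [RHS]addrC mulrCA addrC -mulrDr; congr (_ * _).
rewrite mulr_sumr -big_split; apply: eq_bigr => i _.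
by rewrite !big_cons Gx /= mulrDl mulrA.
Qed.

Let energy_unit b s : size s = n -> (forall v, v \in s -> `|v| = 1) ->
  `|energy b s| <= `|b|.
Proof.
move=> sn s1; rewrite /energy normrM (ger0_norm c0).
rewrite (_ : \int[mu]_x _ =
    \sum_(i < k) \int[mu]_x (b x * \prod_(v <- s) G i v x)); last first.
  rewrite -Rintegral_sum; last by move=> i; have [] := Gprod b i sn.
  by apply: eq_Rintegral => x _; rewrite mulr_sumr.
apply: (@le_trans _ _ (c * \sum_(i < k) (`|b| / n%:R *
    \sum_(v <- s) \int[mu]_x (`|G i v x| ^+ n)))).
  rewrite ler_wpM2l// (le_trans (ler_norm_sum _ _ _))//.
  by apply: ler_sum => i _; have [] := Gprod b i sn.
rewrite -mulr_sumr mulrCA -mulrA ler_piMr// mulrC ler_pdivrMr ?ltr0n// mul1r.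
(* Each of the n arguments contributes at most 1, which cancels the 1/n of the mean inequality. *)
rewrite exchange_big /= mulr_sumr (@le_trans _ _ (\sum_(v <- s) 1))//.
  rewrite big_seq [leRHS]big_seq; apply: ler_sum => v vs.
  by apply: nG; exact: s1.
by rewrite big_const_seq count_predT iter_addr_0 sn.
Qed.

Definition energy_form b : sform V := SForm
  (homogeneous_part_sform (@energy_perm b) (@energy_linr b) (normr_ge0 b)
    (@energy_unit b)).

Lemma energy_formE b s : size s = n -> energy_form b s = energy b s.
Proof. by move=> sn; rewrite /= /homogeneous_part sn eqxx. Qed.

Lemma energy_form_norm b : `|energy_form b| <= `|b|.
Proof.
apply: sform_norm_le => // s; apply: homogeneous_part_le => //.
- exact: energy_perm.
- exact: energy_linr.
- exact: energy_unit.
Qed.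

Lemma energy_form_lin a b b' :
  energy_form (a *: b + b') = a *: energy_form b + energy_form b'.
Proof.
apply: sformP => s; rewrite sformDE sformZE /= /homogeneous_part.
case: eqP => [sn|_]; last by rewrite mulr0 addr0.
rewrite /energy mulrCA -mulrDr; congr (_ * _).
have ib z := @energy_rintegrable z s sn.
rewrite -RintegralZl//; last exact: ib.
rewrite -RintegralD//; [|exact/rintegrableZ/ib|exact: ib].
apply: Rintegral_ae.
- exact: energy_measurable.
- apply: measurable_funD; last exact: energy_measurable.
  by apply: measurable_funM => //; exact: energy_measurable.
have := Lp_funZ a b; have := Lp_funD (a *: b) b'.
apply: filterS2 => x /(_ I)-> /(_ I) /= ->.
by rewrite [_ *: _]/(_ * _) mulrDl mulrA.
Qed.

End energy_forms.

(** * Completeness of L^2 *)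

Section L2_completeness.
Context d (T : measurableType d) (R : realType) (mu : {measure set T -> \bar R}).
Notation L2 := (Lp mu (lee1n 2)).

Lemma fast_dist (B : normedModType R) (u : nat -> B) (C : R) :
  (forall k, `|u k.+1 - u k| <= C * 2^-1 ^+ k) ->
  forall n j, `|u (n + j)%N - u n| <= 2 * C * 2^-1 ^+ n.
Proof.
move=> uC n j; have C0 : 0 <= C by have := uC 0; rewrite mulr1; exact: le_trans.
(* The exact geometric sum, needed for the induction on j. *)
apply: (@le_trans _ _ (2 * C * 2^-1 ^+ n * (1 - 2^-1 ^+ j))); last first.
  apply: ler_piMr; first by rewrite !mulr_ge0 ?exprn_ge0 ?invr_ge0.
  by rewrite gerBl exprn_ge0 ?invr_ge0.
elim: j => [|j IH]; first by rewrite addn0 !subrr normr0 mulr0.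
rewrite addnS -(subrK (u (n + j)%N) (u _.+1)) -addrA (le_trans (ler_normD _ _))//.
rewrite (le_trans (lerD (uC _) IH))// exprS exprD.
by set p := _ ^+ n; set q := _ ^+ j; rewrite le_eqVlt; apply/predU1P; left; field.
Qed.

Lemma bounded_variation_cvg (v : nat -> R) M :
  (forall n, \sum_(0 <= k < n) `|v k.+1 - v k| <= M) -> cvgn v.
Proof.
move=> vM; have cS : cvgn (series (telescope v)).
  apply: normed_cvg; apply: nondecreasing_is_cvgn.
    by apply: nondecreasing_series => k _ _; exact: normr_ge0.
  by exists M => _ [n _ <-]; exact: vM.
rewrite (_ : v = (fun n => v 0 + series (telescope v) n)); last first.
  by apply/funext => n; exact: eq_sum_telescope.
by apply: is_cvgD => //; exact: is_cvg_cst.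
Qed.

Lemma Lp_funB p (p1 : (1 <= p)%E) (u v : Lp mu p1) :
  {ae mu, forall x, (u - v : Lp mu p1) x = u x - v x}.
Proof.
have := Lp_funZ (-1) v; have := Lp_funD u ((-1) *: v); rewrite scaleN1r.
apply: filterS2 => x /(_ I) -> /(_ I) /= ->.
by rewrite [_ *: _]mulN1r.
Qed.

Lemma geometric_half_le2 n : \sum_(0 <= k < n) 2^-1 ^+ k <= 2 :> R.
Proof.
suff -> : \sum_(0 <= k < n) 2^-1 ^+ k = 2 - 2 * 2^-1 ^+ n :> R.
  by rewrite gerBl mulr_ge0 ?exprn_ge0 ?invr_ge0.
elim: n => [|n IH]; first by rewrite big_nil expr0; lra.
by rewrite big_nat_recr//= IH exprS; lra.
Qed.

Lemma L2_fast_ae_cvg (u : nat -> L2) C :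
  (forall k, `|u k.+1 - u k| <= C * 2^-1 ^+ k) ->
  {ae mu, forall x, cvgn (fun k => u k x)}.
Proof.
(* |t| <= 2^-k + 2^k t^2: the increments are absolutely summable wherever the
   series of the h k is finite. *)
move=> uC; pose h k x := (2 ^+ k * (u k.+1 - u k : L2) x ^+ 2)%:E.
have h0 k x : (0 <= h k x)%E by rewrite lee_fin mulr_ge0 ?sqr_ge0 ?exprn_ge0.
have mh k : measurable_fun setT (h k).
  apply/measurable_EFinP; apply: measurable_funM => //.
  by apply: measurable_funX; exact: Lp_measurable.
have Ih k : (\int[mu]_x h k x <= (C ^+ 2 * 2^-1 ^+ k)%:E)%E.
  have [i2 E] := L2_sqr (u k.+1 - u k).
  rewrite /h; under eq_integral do rewrite EFinM.
  rewrite integralZl// -[X in (_ * X)%E]fineK; last exact: integrable_fin_num.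
  rewrite -/(Rintegral mu setT _) E -EFinM lee_fin.
  have e : `|u k.+1 - u k| ^+ 2 <= (C * 2^-1 ^+ k) ^+ 2.
    by rewrite lerXn2r ?nnegrE// (le_trans _ (uC k)).
  rewrite (le_trans (ler_wpM2l (exprn_ge0 k _) e))//.
  rewrite exprMn mulrCA ler_wpM2l ?sqr_ge0// expr2 mulrA -exprMn.
  by rewrite divff// expr1n mul1r.
pose H x := (\sum_(0 <= k <oo) h k x)%E.
have IH : (\int[mu]_x H x < +oo)%E.
  rewrite /H integral_nneseries//.
  apply: (@le_lt_trans _ _ (C ^+ 2 * 2)%:E); last exact: ltry.
  apply: lime_le; first by apply: is_cvg_nneseries => k _ _; exact: integral_ge0.
  near=> n; apply: (@le_trans _ _ (\sum_(0 <= k < n) (C ^+ 2 * 2^-1 ^+ k)%:E)%E).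
    by apply: lee_sum => k _; exact: Ih.
  rewrite sumEFin lee_fin -mulr_sumr ler_wpM2l ?sqr_ge0//.
  exact: geometric_half_le2.
have mH : measurable_fun setT H.
  rewrite (_ : H = fun x => (\sum_(k <oo | k \in xpredT) h k x)%E)//.
  by apply: ge0_emeasurable_sum.
have iH : mu.-integrable setT H.
  apply/integrableP; split => //; apply: le_lt_trans IH.
  rewrite le_eqVlt; apply/predU1P; left; apply: eq_integral => x _.
  by rewrite gee0_abs// nneseries_ge0.
have du : {ae mu, forall x k, (u k.+1 - u k : L2) x = u k.+1 x - u k x}.
  by apply/ae_foralln => k; exact: Lp_funB.
apply: filterS2 (integrable_ae measurableT iH) du => x /(_ I) Hfin dux.
apply: (@bounded_variation_cvg _ (2 + fine (H x))) => n.
apply: (@le_trans _ _ (\sum_(0 <= k < n) (2^-1 ^+ k +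
    2 ^+ k * (u k.+1 - u k : L2) x ^+ 2))).
  apply: ler_sum => k _; rewrite -dux; set z := Lp_fun _ x.
  have p0 : 0 < 2^-1 ^+ k :> R by rewrite exprn_gt0// invr_gt0.
  have pp : 2^-1 ^+ k * 2 ^+ k = 1 :> R by rewrite -exprMn mulVf// expr1n.
  have q0 : 0 < 2 ^+ k :> R by rewrite exprn_gt0.
  rewrite -(real_normK (num_real z)); have := normr_ge0 z; set w := `|z| => w0.
  rewrite -(ler_pM2l p0) mulrDr mulrA pp mul1r.
  have := sqr_ge0 (2^-1 ^+ k - w); nra.
rewrite big_split lerD//=; first exact: geometric_half_le2.
rewrite -lee_fin fineK// -sumEFin.
exact: (nneseries_lim_ge n (fun k _ _ => h0 k x)).
Unshelve. all: by end_near. Qed.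

(** Pointwise limit almost everywhere, then Fatou's lemma for the distances to u_n. *)
Lemma L2_complete_fast (u : nat -> L2) C :
  (forall k, `|u k.+1 - u k| <= C * 2^-1 ^+ k) ->
  exists l : L2, forall n, `|l - u n| <= 2 * C * 2^-1 ^+ n.
Proof.
move=> uC; have C0 : 0 <= C by have := uC 0; rewrite mulr1; exact: le_trans.
(* The upper limit is measurable everywhere; [fine] replaces infinite values by 0, which happens on
   a null set only. *)
pose w x := fine (limn_esup (fun k => (u k x)%:E)).
have mw : measurable_fun setT w.
  apply: measurableT_comp => //.
  by apply: measurable_fun_limn_esup => k; apply/measurable_EFinP; exact: Lp_measurable.
have uw : {ae mu, forall x, u k x @[k --> \oo] --> w x}.
  apply: filterS (L2_fast_ae_cvg uC) => x /cvg_ex[l ul].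
  have ule : (u k x)%:E @[k --> \oo] --> l%:E by apply: cvg_EFin; [exact: nearW|].
  by rewrite /w; have [_ ->] := cvg_limn_einf_sup ule.
have bnd n : (\int[mu]_x ((w x - u n x) ^+ 2)%:E <= ((2 * C * 2^-1 ^+ n) ^+ 2)%:E)%E.
  pose f j x := (((u (n + j)%N - u n : L2) x) ^+ 2)%:E.
  have mf j : measurable_fun setT (f j).
    by apply/measurable_EFinP; apply: measurable_funX; exact: Lp_measurable.
  have du : {ae mu, forall x j, (u (n + j)%N - u n : L2) x = u (n + j)%N x - u n x}.
    by apply/ae_foralln => j; exact: Lp_funB.
  apply: (@le_trans _ _ (\int[mu]_x limn_einf (f^~ x))%E).
    apply: ae_ge0_le_integral => //.
    - by move=> x _; rewrite lee_fin sqr_ge0.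
    - apply/measurable_EFinP; apply: measurable_funX; exact: measurable_funB.
    - move=> x _; rewrite limn_einf_lim; apply: lime_ge; first exact: is_cvg_einfs.
      by apply: nearW => k; apply: le_ereal_inf_tmp => _ [j _ <-]; rewrite lee_fin sqr_ge0.
    - apply: measurableT_comp => //; apply: measurable_fun_limn_esup => k.
      exact: measurableT_comp.
    apply: filterS2 uw du => x uwx dux _.
    have lim : f^~ x @ \oo --> ((w x - u n x) ^+ 2)%:E.
      rewrite (_ : f^~ x = fun j => ((u (n + j)%N x - u n x) ^+ 2)%:E); last first.
        by apply/funext => j; rewrite /f dux.
      apply: cvg_EFin; first exact: nearW.
      have c : u (n + j)%N x - u n x @[j --> \oo] --> w x - u n x.
        apply: cvgB; last exact: cvg_cst.
        exact: (@cvg_comp _ _ _ (addn n) (fun k => u k x) _ _ _ (cvg_addnl n) uwx).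
      exact: (cvgM c c).
    by have [-> _] := cvg_limn_einf_sup lim.
  rewrite (le_trans (fatou _ _ _ _))//.
    by move=> j x _; rewrite lee_fin sqr_ge0.
  rewrite limn_einf_lim; apply: lime_le; first exact: is_cvg_einfs.
  apply: nearW => k; apply: (@le_trans _ _ (\int[mu]_x f k x)%E).
    by apply: ereal_inf_lbound; exists k => //=.
  have [i2 E] := L2_sqr (u (n + k)%N - u n).
  rewrite -[leLHS]fineK; last exact: integrable_fin_num.
  rewrite -/(Rintegral mu setT _) E lee_fin lerXn2r ?nnegrE//.
    by rewrite !mulr_ge0 ?exprn_ge0 ?invr_ge0.
  exact: fast_dist.
pose g x := w x - u 0%N x.
have mg : measurable_fun setT g by exact: measurable_funB.
have gL : g \in Lfun mu 2%:E.
  rewrite inE; apply/andP; split; rewrite inE//= /finite_norm unlock poweR_lty//.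
  rewrite (eq_integral (fun x => (g x ^+ 2)%:E)) ?(le_lt_trans (bnd 0%N)) ?ltry//.
  by move=> x _; rewrite /= powR_mulrn// real_normK// num_real.
(* Fatou's lemma shows that w - u_0, rather than w, is square integrable, so its class is formed and
   u_0 is added back. *)
pose l : L2 := nclass (Lp_seminorm mu (lee1n 2)) (Lfun_Sub (lee1n 2) gL) + u 0%N.
have lw n : {ae mu, forall x, (l - u n : L2) x = w x - u n x}.
  have := Lp_funD (nclass (Lp_seminorm mu (lee1n 2)) (Lfun_Sub (lee1n 2) gL)) (u 0%N).
  have := nclass_ae (Lfun_Sub (lee1n 2) gL).
  apply: filterS3 (Lp_funB l (u n)) => x -> /(_ I) E /(_ I).
  by rewrite /l => -> /=; rewrite E /= subrK.
exists l => n; have [i2 E] := L2_sqr (l - u n).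
rewrite -(@ler_pXn2r _ 2) ?nnegrE//; last by rewrite !mulr_ge0 ?exprn_ge0 ?invr_ge0.
rewrite -E -lee_fin /Rintegral fineK; last exact: integrable_fin_num.
rewrite (le_trans _ (bnd n))// le_eqVlt; apply/predU1P; left.
apply: ae_eq_integral => //.
- by apply/measurable_EFinP; apply: measurable_funX; exact: Lp_measurable.
- apply/measurable_EFinP; apply: measurable_funX; exact: measurable_funB.
by apply: filterS (lw n) => x -> _.
Qed.

End L2_completeness.

(** * The solution space and the forms of the equation *)

Section finite_measure.
Context (R : realType).

Lemma open_cube (n : nat) (M : R) : 0 < M ->
  [set v : 'rV[R]_n | forall j, `|v 0 j| < M] = ball (0 : 'rV[R]_n) M.
Proof.
move=> M0; apply/seteqP; split=> [v vM|v [_ vM] j /=].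
  by split => // i j; rewrite (ord1 i) /ball /= mxE sub0r normrN.
by have := vM 0 j; rewrite /ball /= mxE sub0r normrN.
Qed.

Lemma cube_measurable n (M : R) : 0 < M ->
  measurable [set v : 'rV[R]_n | forall j, `|v 0 j| < M].
Proof. by move=> M0; rewrite open_cube//; apply: open_rV_measurable; exact: ball_open. Qed.

Lemma cube_lty n (M : R) : 0 < M ->
  (lebesgue_rV R n [set v : 'rV[R]_n | forall j, `|v 0 j| < M]%R < +oo)%E.
Proof.
move=> M0; elim: n => [|n IH].
  by rewrite /= diracE; case: (_ \in _); rewrite ltry.
rewrite /= /lebesgue_prepend /pushforward.
rewrite (_ : _ @^-1` _ = ball (0 : R) M `*` [set v : 'rV[R]_n | forall j, `|v 0 j| < M]).
  have mB : measurable (ball (0 : R) M) by rewrite ball_itv; exact: measurable_itv.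
  have Boo : (lebesgue_measure (ball (0 : R) M)%R < +oo)%E.
    by rewrite lebesgue_measure_ball ?ltry// ltW.
  rewrite product_measure1E//; last exact: cube_measurable.
  by apply: lte_mul_pinfty => //; rewrite ge0_fin_numE.
apply/seteqP; split=> [[x v] /= xv|[x v] [/= xM vM] j].
  split=> [|j /=]; first by have := xv ord0; rewrite rV_cons0 /ball /= sub0r normrN.
  by have := xv (lift ord0 j); rewrite rV_consS.
have [k ->|->] := unliftP ord0 j; first by rewrite rV_consS; exact: vM.
by rewrite rV_cons0; move: xM; rewrite /ball /= sub0r normrN.
Qed.

Context (d : nat) (D : lipschitz_domain R d).

Lemma lebesgue_on_lty : (lebesgue_on D setT < +oo)%E.
Proof.
have [M [_ /(_ (`|M| + 1))]] := dom_bounded D.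
have M1 : M < `|M| + 1 by rewrite (le_lt_trans (ler_norm M))// ltrDl.
have M2 : 0 < `|M| + 2 by rewrite ltr_wpDl.
move=> /(_ M1) DM; apply: le_lt_trans (cube_lty d M2).
have -> : lebesgue_on D setT = lebesgue_rV R d (setT `&` D) by [].
rewrite setTI; apply: le_measure; rewrite ?inE.
- exact: open_rV_measurable (dom_open D).
- exact: cube_measurable.
move=> x /DM xM; rewrite open_cube// -ball_normE /ball_ /= sub0r normrN.
by rewrite (le_lt_trans xM)// ltrD2l ltr1n.
Qed.

End finite_measure.

Section solution_space_facts.
Context (R : realType) (d : nat) (D : lipschitz_domain R d) (m : nat) (Cm : R).
Context (m0 : (0 < m)%N) (Cm_gt0 : 0 < Cm) (Cm_emb : sobolev_embedding D m Cm).
Notation V := (solution_space Cm_gt0 Cm_emb).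
Notation mu := (lebesgue_on D).
Implicit Types v w : V.

Lemma solution_normE v : `|v| = Cm * H10_norm (v : H10 D).
Proof. by []. Qed.

Lemma H10_fun_measurable v : measurable_fun setT (H10_fun v).
Proof. exact: Lp_measurable. Qed.

Lemma H10_fun_lin a v w :
  {ae mu, forall x, H10_fun (a *: v + w) x = a * H10_fun v x + H10_fun w x}.
Proof.
have := Lp_funZ a (H10_val v).1; have := Lp_funD (a *: (H10_val v).1) (H10_val w).1.
apply: filterS2 => x /(_ I) D1 /(_ I) Z1.
by rewrite /H10_fun [LHS]D1 /= Z1.
Qed.

Lemma grad_lin i a v w :
  {ae mu, forall x, (grad (a *: v + w : V) i) x = a * (grad v i) x + (grad w i) x}.
Proof.
have := Lp_funZ a (grad v i); have := Lp_funD (a *: grad v i) (grad w i).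
apply: filterS2 => x /(_ I) D1 /(_ I) Z1.
rewrite (_ : grad _ i = a *: grad v i + grad w i); last by rewrite gradD gradZ.
by rewrite D1 /= Z1.
Qed.

Lemma H10_power v : rintegrable mu (fun x => `|H10_fun v x| ^+ m.+1) /\
  \int[mu]_x (`|H10_fun v x| ^+ m.+1) <= `|v| ^+ m.+1.
Proof.
exact: power_integral_le.
Qed.

Lemma H10_norm_sqr v : H10_norm (v : H10 D) ^+ 2 = \sum_i `|grad v i| ^+ 2.
Proof. by rewrite sqr_sqrtr// sumr_ge0// => i _; exact: sqr_ge0. Qed.

Lemma grad_le v i : `|grad v i| <= Cm^-1 * `|v|.
Proof.
rewrite solution_normE mulKf ?gt_eqF// -(@ler_pXn2r _ 2) ?nnegrE//; last exact: H10_norm_ge0.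
rewrite H10_norm_sqr (bigD1 i)//= lerDl sumr_ge0// => j _; exact: sqr_ge0.
Qed.

(** The norm of V sees gradients only, so completeness needs this control of the function. For a
    unit vector, t^2 <= 1 + t^(m+1) (as m >= 1) and the embedding give the square bound |D| + 1,
    finite because D is bounded. *)
Lemma poincare : exists P : R, forall v, `|(H10_val v).1| <= P * `|v|.
Proof.
pose P := Num.sqrt (fine (mu setT) + 1).
have f0 : 0 <= fine (mu setT) by rewrite fine_ge0.
exists P => v; have [->|v0] := eqVneq v 0.
  by rewrite (_ : (H10_val _).1 = 0)// !normr0 mulr0.
have vn : 0 < `|v| by rewrite normr_gt0.
suff unit w : `|w| = 1 -> `|(H10_val w).1| <= P.
  have := unit (`|v|^-1 *: v); rewrite normrZ normfV normr_id mulVf ?gt_eqF//.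
  move=> /(_ erefl); rewrite (_ : (H10_val _).1 = `|v|^-1 *: (H10_val v).1)//.
  by rewrite normrZ normfV normr_id ler_pdivrMl// mulrC.
move=> w1; rewrite -(@ler_pXn2r _ 2) ?nnegrE ?sqrtr_ge0//.
rewrite sqr_sqrtr ?addr_ge0//.
have [i2 <-] := L2_sqr (H10_val w).1.
have [iw] := H10_power w; rewrite w1 expr1n => Iw.
have i1 : rintegrable mu (fun=> 1).
  apply/integrableP; split; first exact: measurable_cst.
  under eq_integral do rewrite /= normr1.
  by rewrite integral_cst// mul1e lebesgue_on_lty.
apply: (@le_trans _ _ (\int[mu]_x (1 + `|H10_fun w x| ^+ m.+1))).
  apply: le_Rintegral => //; first exact: rintegrableD.
  move=> x _; rewrite -[_ x]/(H10_fun w x) -real_normK ?num_real//.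
  set t := `|_|; have t0 : 0 <= t by exact: normr_ge0.
  have [t1|t1] := leP t 1.
    by rewrite (@le_trans _ _ 1) ?exprn_ile1// lerDl exprn_ge0.
  by rewrite (@le_trans _ _ (t ^+ m.+1)) ?lerDr// ler_weXn2l// ltW.
rewrite RintegralD// lerD// Rintegral_cst// mul1r//.
Qed.

(** The function and each component of its gradient converge separately in L^2. The pair of limits
    is again approximated by test pairs, since [H10_pred] is a closure. *)
Lemma solution_space_complete : fast_complete V.
Proof.
move=> x xf; have [P vP] := poincare.
have P0 : 0 <= `|P| by [].
have H10B (v w : V) : (H10_val (v - w)).1 = (H10_val v).1 - (H10_val w).1 by [].
have gradB (v w : V) i : grad (v - w) i = grad v i - grad w i.
  by rewrite gradD -scaleN1r gradZ scaleN1r.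
have [l lx] : exists l : L2 D, forall n,
    `|l - (H10_val (x n)).1| <= 2 * `|P| * 2^-1 ^+ n.
  apply: (@L2_complete_fast _ _ _ mu) => k; rewrite -H10B (le_trans (vP _))//.
  by rewrite (le_trans (ler_wpM2r _ (ler_norm P)))// ler_wpM2l.
have /choice[g gx] : forall i : 'I_d, exists g : L2 D, forall n,
    `|g - grad (x n) i| <= 2 * Cm^-1 * 2^-1 ^+ n.
  move=> i.
  apply: (@L2_complete_fast _ _ _ mu (fun n => grad (x n) i)) => k.
  rewrite -gradB (le_trans (grad_le _ _))// ler_wpM2l// invr_ge0 ltW//.
have small (C e : R) : 0 < e -> exists N, forall n, (N <= n)%N -> C * 2^-1 ^+ n < e.
  move=> e0; have cv : C * 2^-1 ^+ n @[n --> \oo] --> (0 : R).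
    rewrite -[X in _ --> X](mulr0 C); apply: cvgM; first exact: cvg_cst.
    by apply: cvg_expr; rewrite gtr0_norm ?invr_gt0// invf_lt1// ltr1n.
  have /(cvgr_lt 0 cv) : 0 < e by [].
  by move=> [N _ NP]; exists N => n Nn; exact: NP.
have lH : (l, [ffun i => g i]) \in @H10_pred R d D.
  apply/asboolP => e e0; have e2 : 0 < e / 2 by rewrite divr_gt0.
  have [N1 N1P] := small (2 * `|P|) _ e2; have [N2 N2P] := small (2 * Cm^-1) _ e2.
  pose n := maxn N1 N2.
  have /asboolP /(_ _ e2)[z [tz z1 z2]] := valP (x n : H10 D).
  exists z; split => // [|i].
    rewrite -(subrK (H10_val (x n)).1 l) -addrA (le_lt_trans (ler_normD _ _))//.
    by rewrite (splitr e) ltrD// (le_lt_trans (lx n))// N1P// leq_maxl.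
  rewrite ffunE -(subrK (grad (x n) i) (g i)) -addrA (le_lt_trans (ler_normD _ _))//.
  by rewrite (splitr e) ltrD ?z2// (le_lt_trans (gx i n))// N2P// leq_maxr.
pose L : V := H10Elem lH.
exists L; apply: (@cvg_le_dist _ _ _ \oo _ _ _
    (fun n => Cm * (Num.sqrt d%:R * (2 * Cm^-1)) * 2^-1 ^+ n)); last first.
  rewrite -[X in _ --> X](mulr0 (Cm * (Num.sqrt d%:R * (2 * Cm^-1)))).
  apply: cvgM; first exact: cvg_cst.
  by apply: cvg_expr; rewrite gtr0_norm ?invr_gt0// invf_lt1// ltr1n.
apply: nearW => n; rewrite distrC solution_normE -!mulrA ler_pM2l//.
have c0 : 0 <= 2 * (Cm^-1 * 2^-1 ^+ n).
  by rewrite mulr_ge0// mulr_ge0 ?exprn_ge0 ?invr_ge0// ltW.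
rewrite -(@ler_pXn2r _ 2) ?nnegrE ?H10_norm_ge0//; last first.
  by rewrite mulr_ge0 ?sqrtr_ge0.
rewrite H10_norm_sqr exprMn sqr_sqrtr ?ler0n//.
rewrite (@le_trans _ _ (\sum_(i < d) (2 * (Cm^-1 * 2^-1 ^+ n)) ^+ 2))//.
  apply: ler_sum => i _; rewrite lerXn2r ?nnegrE// gradB mulrA.
  by rewrite [grad L i]ffunE; exact: gx.
by rewrite sumr_const card_ord -[leLHS]mulr_natl.
Qed.

End solution_space_facts.

(** Off the diagonal this is the slope of t |-> t^m, which is nondecreasing for odd m; on it, every
    term is the even power x^(m-1). *)
Lemma odd_geometric_ge0 (R : realDomainType) (m : nat) (x y : R) : odd m ->
  0 <= \sum_(i < m) x ^+ i * y ^+ (m.-1 - i).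
Proof.
move=> om; have E : x ^+ m - y ^+ m = (x - y) * \sum_(i < m) x ^+ i * y ^+ (m.-1 - i).
  rewrite -opprB subrXX -mulNr opprB; congr (_ * _); apply: eq_bigr => i _.
  by rewrite mulrC.
have em : ~~ odd m.-1 by case: m om {E}.
have mono (a b : R) : a <= b -> a ^+ m <= b ^+ m.
  move=> ab; have [a0|a0] := leP 0 a.
    by rewrite lerXn2r ?nnegrE// (le_trans a0).
  have [b0|b0] := leP 0 b.
    by rewrite (@le_trans _ _ 0) ?exprn_ge0// exprn_odd_le0// ltW.
  have : (- b) ^+ m <= (- a) ^+ m.
    by rewrite lerXn2r ?nnegrE ?oppr_ge0 ?lerN2// ltW.
  by rewrite (exprNn a) (exprNn b) -signr_odd om expr1 !mulN1r lerN2.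
have [xy|xy|<-] := ltgtP x y.
- have : (x - y) * \sum_(i < m) x ^+ i * y ^+ (m.-1 - i) <= 0.
    by rewrite -E subr_le0 mono// ltW.
  by rewrite nmulr_rle0// subr_lt0.
- have : 0 <= (x - y) * \sum_(i < m) x ^+ i * y ^+ (m.-1 - i).
    by rewrite -E subr_ge0 mono// ltW.
  by rewrite pmulr_rge0// subr_gt0.
- apply: sumr_ge0 => i _; rewrite -exprD subnKC; first exact: exprn_even_ge0.
  by rewrite -ltnS prednK ?(leq_trans _ (ltn_ord i)).
Qed.

(** * Diffusion, reaction and load as multilinear forms *)

Section solution_forms.
Context (R : realType) (d : nat) (D : lipschitz_domain R d) (m : nat) (Cm : R).
Context (m0 : (0 < m)%N) (Cm_gt0 : 0 < Cm) (Cm_emb : sobolev_embedding D m Cm).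
Notation V := (solution_space Cm_gt0 Cm_emb).
Notation mu := (lebesgue_on D).
Implicit Types (v w : V) (a b : Linf D) (f : Hm1 D).

Let abs_sqr (v : V) i x : `|grad v i x| ^+ 2 = grad v i x ^+ 2.
Proof. by rewrite real_normK// num_real. Qed.

Let grad_power i (v : V) : rintegrable mu (fun x => `|grad v i x| ^+ 2).
Proof.
by under eq_fun do rewrite abs_sqr; have [] := L2_sqr (grad v i).
Qed.

Let grad_unit (v : V) : `|v| = 1 ->
  Cm ^+ 2 * \sum_(i < d) \int[mu]_x (`|grad v i x| ^+ 2) <= 1.
Proof.
move=> v1; rewrite (eq_bigr (fun i => `|grad v i| ^+ 2)) => [|i _].
  by rewrite -H10_norm_sqr -exprMn -solution_normE v1 expr1n.
have [_ <-] := L2_sqr (grad v i).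
by apply: eq_Rintegral => x _; rewrite abs_sqr.
Qed.

Let grad_measurable (i : 'I_d) (v : V) : measurable_fun setT (grad v i).
Proof. exact: Lp_measurable. Qed.

Definition diffusion a : sform V := @energy_form _ _ _ mu V d 2
  (fun i v => grad v i) (Cm ^+ 2) isT (exprn_ge0 2 (ltW Cm_gt0))
  grad_measurable (@grad_lin _ _ _ _ _ Cm_gt0 Cm_emb) grad_power grad_unit a.

Let fun_unit (v : V) : `|v| = 1 ->
  1 * \sum_(i < 1) \int[mu]_x (`|H10_fun v x| ^+ m.+1) <= 1.
Proof.
move=> v1; rewrite mul1r big_ord1; have [_] := H10_power v.
by rewrite v1 expr1n.
Qed.

Definition reaction b : sform V := @energy_form _ _ _ mu V 1 m.+1
  (fun _ v => H10_fun v) 1 isT ler01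
  (fun _ => @H10_fun_measurable _ _ _ _ _ Cm_gt0 Cm_emb)
  (fun _ => @H10_fun_lin _ _ _ _ _ Cm_gt0 Cm_emb)
  (fun _ v => (H10_power v).1) fun_unit b.

Lemma diffusion_lin c a a' : diffusion (c *: a + a') = c *: diffusion a + diffusion a'.
Proof. exact: energy_form_lin. Qed.

Lemma diffusion_norm a : `|diffusion a| <= `|a|.
Proof. exact: energy_form_norm. Qed.

Lemma reaction_lin c b b' : reaction (c *: b + b') = c *: reaction b + reaction b'.
Proof. exact: energy_form_lin. Qed.

Lemma reaction_norm b : `|reaction b| <= `|b|.
Proof. exact: energy_form_norm. Qed.

Lemma Hm1_lin f c v w : f (c *: v + w : V) = c * f (v : H10 D) + f (w : H10 D).
Proof. by have /asboolP[lin _] := valP f; exact: lin. Qed.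

Lemma Hm1_le f (v : V) : `|f (v : H10 D)| <= `|f| * H10_norm (v : H10 D).
Proof.
have f0 : f (0 : H10 D) = 0.
  have := Hm1_lin f 1 0 0; rewrite scaler0 addr0 mul1r => /eqP.
  by rewrite -subr_eq subrr eq_sym => /eqP.
have ub (w : V) : f (w : H10 D) <= `|f| * H10_norm (w : H10 D).
  have [->|w0] := eqVneq w 0; first by rewrite f0 mulr_ge0// H10_norm_ge0.
  have nw : 0 < H10_norm (w : H10 D).
    by rewrite -(@pmulr_rgt0 _ Cm)// -solution_normE normr_gt0.
  rewrite -ler_pdivrMr//; apply: sup_ubound; last by exists (w : H10 D).
  have /asboolP[_ [K fK]] := valP f.
  exists `|K| => _ [z _ <-].
  have [->|z0] := eqVneq (H10_norm z) 0; first by rewrite invr0 mulr0.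
  rewrite ler_pdivrMr ?lt_def ?z0 ?H10_norm_ge0//.
  rewrite (le_trans (ler_norm _))// (le_trans (fK z))//.
  by rewrite ler_wpM2r ?H10_norm_ge0 ?ler_norm.
rewrite ler_norml ub andbT lerNl.
have fN : f (- v : V) = - f (v : H10 D).
  by have := Hm1_lin f (-1) v 0; rewrite scaleN1r addr0 f0 addr0 mulN1r.
rewrite -fN (le_trans (ub _))//.
by rewrite -scaleN1r H10_normZ normrN1 mul1r.
Qed.

(** Only lists of length 1 matter; summing over the list makes the expression symmetric at every
    length. *)
Definition load_fun f (s : seq V) : R := Cm * \sum_(v <- s) f (v : H10 D).

Let load_perm f s t : perm_eq s t -> load_fun f s = load_fun f t.
Proof. by move=> st; congr (_ * _); exact: perm_big. Qed.

Let load_linr f c v w s : (size s).+1 = 1%N ->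
  load_fun f (c *: v + w :: s) = c * load_fun f (v :: s) + load_fun f (w :: s).
Proof.
move=> [/size0nil ->]; rewrite /load_fun !big_cons !big_nil !addr0 Hm1_lin.
by ring.
Qed.

Let load_unit f s : size s = 1%N -> (forall v, v \in s -> `|v| = 1) ->
  `|load_fun f s| <= `|f|.
Proof.
case: s => [//|v []//] _ /(_ v (mem_head _ _)) v1.
rewrite /load_fun big_cons big_nil addr0 normrM gtr0_norm//.
rewrite (le_trans (ler_wpM2l (ltW Cm_gt0) (Hm1_le f v)))//.
by rewrite mulrCA -solution_normE v1 mulr1.
Qed.

Definition load f : sform V := SForm
  (homogeneous_part_sform (@load_perm f) (@load_linr f) (normr_ge0 f) (@load_unit f)).

Lemma loadE f s : load f s = if size s == 1%N then load_fun f s else 0.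
Proof. by []. Qed.

Lemma load_norm f : `|load f| <= `|f|.
Proof.
apply: sform_norm_le => // s; apply: homogeneous_part_le => //.
- exact: load_perm.
- exact: load_linr.
- exact: load_unit.
Qed.

Lemma load_lin c f f' : load (c *: f + f') = c *: load f + load f'.
Proof.
apply: sformP => s; rewrite sformDE sformZE !loadE.
case: ifP => _; last by rewrite mulr0 addr0.
rewrite /load_fun mulrCA -mulrDr; congr (_ * _).
by rewrite mulr_sumr -big_split.
Qed.

(** On [[:: v]] this is the weak equation tested with v. The arities 2, m + 1 and 1, lowered by the
    contractions with u, all leave 1, so both sides vanish on lists of any other length. *)
Lemma weak_solution_form a b f (u : V) : weak_solution m Cm a b f u ->
  app (diffusion a) u + pow m (reaction b) u = load f.
Proof.
move=> sol; apply: sformP => s; rewrite sformDE appE powE loadE.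
have [s1|s1] := eqVneq (size s) 1%N; last first.
  rewrite /diffusion /reaction /= /homogeneous_part size_cat size_nseq /=.
  by rewrite eqSS (negbTE s1) -addn1 eqn_add2l (negbTE s1) addr0.
case: s s1 => [//|v []//] _; rewrite !energy_formE ?size_cat ?size_nseq ?addn1//.
rewrite /load_fun big_cons big_nil addr0 -(sol v) /energy mul1r.
congr (_ * _ + _); apply: eq_Rintegral => x _.
  by congr (_ * _); apply: eq_bigr => i _; rewrite !big_cons big_nil mulr1.
by rewrite big_ord1 big_cat big_seq1 big_nseq iter_mulr_1 /= mulrA.
Qed.

Lemma diffusion_ge a (v : V) : {ae mu, forall x, 1 <= a x} ->
  `|v| ^+ 2 <= diffusion a [:: v; v].
Proof.
move=> a1; rewrite energy_formE// /energy solution_normE exprMn H10_norm_sqr.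
rewrite ler_pM2l ?exprn_gt0//.
have i2 i := L2_sqr (grad v i).
rewrite (eq_bigr (fun i => \int[mu]_x (grad v i x ^+ 2))) => [|i _]; last first.
  by have [_ ->] := i2 i.
rewrite -Rintegral_sum; last by move=> i; have [] := i2 i.
apply: le_Rintegral_ae.
- by apply: rintegrable_sum => i; have [] := i2 i.
- exact: (@energy_rintegrable _ _ _ mu V d 2 (fun i v => grad v i) isT
    grad_measurable grad_power a [:: v; v]).
apply: filterS a1 => x a1.
rewrite [in leRHS](eq_bigr (fun i => grad v i x ^+ 2)) => [|i _]; last first.
  by rewrite !big_cons big_nil mulr1.
by rewrite ler_peMl// sumr_ge0// => i _; exact: sqr_ge0.
Qed.

(** The integrand is b v^2 times the sum of [odd_geometric_ge0]. *)
Lemma reaction_ddiv_ge0 b (v u' u : V) : odd m -> {ae mu, forall x, 0 <= b x} ->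
  0 <= ddiv m (reaction b) u' u [:: v; v].
Proof.
move=> om b0; rewrite ddivE.
have sz i : (i < m)%N -> size (nseq i u' ++ nseq (m.-1 - i) u ++ [:: v; v]) = m.+1.
  move=> im; rewrite !size_cat !size_nseq /= addnA subnKC ?addn2 ?prednK//.
  by rewrite -ltnS prednK.
pose F (i : 'I_m) x := b x * H10_fun v x ^+ 2 *
  (H10_fun u' x ^+ i * H10_fun u x ^+ (m.-1 - i)).
pose s (i : 'I_m) := nseq i u' ++ nseq (m.-1 - i) u ++ [:: v; v].
have FE i x : F i x = b x * \sum_(j < 1) \prod_(w <- s i) H10_fun w x.
  rewrite big_ord1 /s big_cat big_cat big_cons big_seq1 !big_nseq !iter_mulr_1 /= /F.
  by rewrite expr2; ring.
have iF i : rintegrable mu (F i).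
  rewrite (funext (FE i)).
  exact: (@energy_rintegrable _ _ _ mu V 1 m.+1 (fun _ v => H10_fun v) isT
    (fun _ => @H10_fun_measurable _ _ _ _ _ Cm_gt0 Cm_emb)
    (fun _ v => (H10_power v).1) b (s i) (sz i (ltn_ord i))).
rewrite (eq_bigr (fun i => \int[mu]_x F i x)) => [|i _]; last first.
  rewrite energy_formE ?sz// /energy mul1r; apply: eq_Rintegral => x _.
  by rewrite FE.
have iF0 : rintegrable mu (fun x => \sum_(i < m) F i x) by exact: rintegrable_sum.
rewrite -Rintegral_sum// (le_trans _ (le_Rintegral_ae (rintegrable0 mu) iF0 _))//.
  by rewrite Rintegral_cst// mul0r.
apply: filterS b0 => x b0; rewrite /F -mulr_sumr /=.
apply: mulr_ge0; first by rewrite mulr_ge0// sqr_ge0.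
exact: odd_geometric_ge0.
Qed.

End solution_forms.

(** * Smoothness and majorants under linear contractions *)

Section linear_contractions.
Context (R : realType) (E F : normedModType R) (L : E -> F).
Hypothesis L_lin : forall c x y, L (c *: x + y) = c *: L x + L y.
Hypothesis L_norm : forall x, `|L x| <= `|x|.
Context (s : nat) (U : set 'rV[R]_s) (oU : open U).
Implicit Types g : 'rV[R]_s -> E.

Let LB x y : L (x - y) = L x - L y.
Proof. by rewrite addrC -scaleN1r L_lin scaleN1r addrC. Qed.

Let LZ c x : L (c *: x) = c *: L x.
Proof.
have L0 : L 0 = 0 by rewrite -(subrr 0) LB subrr.
by rewrite -[c *: x]addr0 L_lin L0 addr0.
Qed.

Let L_cvg (T : Type) (G : set_system T) {FG : Filter G} (f : T -> E) l :
  f @ G --> l -> L (f t) @[t --> G] --> L l.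
Proof.
move=> fl; apply: (@cvg_le_dist _ _ _ G _ _ _ (fun t => `|f t - l|)).
  by apply: nearW => t; rewrite -LB.
exact: cvg_dist_norm0.
Qed.

Let L_is_derive g y v : derivable g y v -> is_derive y v (L \o g) (L ('D_v g y)).
Proof.
move=> dg.
have cv : (fun h => h^-1 *: (((L \o g) \o shift y) (h *: v) - (L \o g) y)) @ 0^'
    --> L ('D_v g y).
  rewrite (_ : (fun h => _) = fun h => L (h^-1 *: ((g \o shift y) (h *: v) - g y))).
    exact: L_cvg.
  by apply/funext => h; rewrite LZ LB.
by split; [exact: cvgP cv|apply: cvg_lim cv; exact: norm_hausdorff].
Qed.

Lemma iter_partial_comp g l : smooth_on U g -> forall y, U y ->
  iter_partial l (L \o g) y = L (iter_partial l g y).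
Proof.
move=> sg; elim: l => //= j l IH y Uy; rewrite (partial_eq_on oU j IH)//.
have [_ /(_ j)] := sg l y Uy.
by move/L_is_derive => []; rewrite /partial.
Qed.

Lemma smooth_on_comp g : smooth_on U g -> smooth_on U (L \o g).
Proof.
move=> sg l y Uy; have [cg dg] := sg l y Uy.
have near_l : \near y, L (iter_partial l g y) = iter_partial l (L \o g) y.
  apply: filterS (open_nbhs_nbhs (conj oU Uy)) => z Uz.
  by rewrite iter_partial_comp.
split=> [|j].
  rewrite /prop_for /continuous_at iter_partial_comp//.
  by apply: cvg_trans (L_cvg cg); exact: (near_eq_cvg near_l).
apply: (@near_eq_derivable _ _ _ (L \o iter_partial l g)) => //.
by have [] := L_is_derive (dg j).
Qed.

Lemma jet_comp y Q wt rho n A X g : U y -> (forall l, 0 <= wt l) ->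
  smooth_on U g -> jet y Q wt rho n A X g -> jet y Q wt rho n A X (L \o g).
Proof.
move=> Uy w0 sg [gA gX]; split; first by rewrite (le_trans (L_norm _)).
move=> l Ql l0 ln; rewrite iter_partial_comp// (le_trans _ (gX l Ql l0 ln))//.
by rewrite ler_wpM2r.
Qed.

End linear_contractions.

(** Test [app M v] with [v] itself and divide by the norm of [v]. *)
Lemma app_norm_ge (R : realType) (V : normedModType R) (M : sform V) (v : V) (c : R) :
  c * `|v| ^+ 2 <= M [:: v; v] -> c * `|v| <= `|app M v|.
Proof.
have [->|v0] := eqVneq v 0; first by rewrite normr0 mulr0.
move=> h; have vn : 0 < `|v| by rewrite normr_gt0.
rewrite -(ler_pM2r vn) -mulrA -expr2 (le_trans h)//.
have := sform_le_norm (app M v) [:: v].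
rewrite normprod_cons /normprod big_nil mulr1; apply: le_trans.
exact: ler_norm.
Qed.

(** * Coercivity in the two cases *)

Section coercivity.
Context (R : realType) (d : nat) (D : lipschitz_domain R d) (m : nat) (Cm : R).
Context (m0 : (0 < m)%N) (Cm_gt0 : 0 < Cm) (Cm_emb : sobolev_embedding D m Cm).
Notation V := (solution_space Cm_gt0 Cm_emb).
Implicit Types (v w : V) (a b : Linf D).

Lemma coercive_small a b (u' u v : V) (gamma fbar bbar ubar : R) :
  0 < gamma -> 0 < fbar ->
  {ae lebesgue_on D, forall x, 1 <= a x} -> `|b| <= bbar / 2 ->
  bbar / 2 = gamma / (m%:R * fbar ^+ m.-1) ->
  ubar = (if m == 1%N then fbar / (1 - gamma) else fbar) ->
  `|u'| <= ubar -> `|u| <= ubar ->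
  (1 - gamma) * `|v| <=
    `|app (diffusion Cm_gt0 Cm_emb a + ddiv m (reaction Cm_gt0 Cm_emb b) u' u) v|.
Proof.
move=> g0 f0 a1 bb bE uE u1 u2; apply: app_norm_ge; rewrite sformDE mulrBl mul1r.
apply: lerD; first exact: diffusion_ge.
have nd : `|ddiv m (reaction Cm_gt0 Cm_emb b) u' u| <= gamma.
  rewrite (le_trans (ddiv_norm m _ u1 u2))//.
  have m1 : 0 < m%:R :> R by rewrite ltr0n.
  (* For m = 1, where the two radii differ, the exponent is 0. *)
  have -> : ubar ^+ m.-1 = fbar ^+ m.-1.
    by rewrite uE; case: eqP => [->|].
  rewrite (@le_trans _ _ (m%:R * fbar ^+ m.-1 * (bbar / 2)))//.
    rewrite ler_wpM2l ?mulr_ge0 ?exprn_ge0// ?(ltW f0)//.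
    by rewrite (le_trans (reaction_norm _ _ _)).
  by rewrite bE mulrCA divff ?mulr1// gt_eqF// mulr_gt0// exprn_gt0.
rewrite lerNl (le_trans (ler_norm _))// normrN (le_trans (sform_le_norm _ _))//.
by rewrite !normprod_cons /normprod big_nil mulr1 -expr2 ler_wpM2r// sqr_ge0.
Qed.

Lemma coercive_monotone a b (u' u v : V) : odd m ->
  {ae lebesgue_on D, forall x, 1 <= a x} ->
  {ae lebesgue_on D, forall x, 0 <= b x} ->
  `|v| <=
    `|app (diffusion Cm_gt0 Cm_emb a + ddiv m (reaction Cm_gt0 Cm_emb b) u' u) v|.
Proof.
move=> om a1 b0; rewrite -[leLHS]mul1r; apply: app_norm_ge; rewrite sformDE mul1r.
rewrite -[leLHS]addr0 lerD//; first exact: diffusion_ge.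
exact: reaction_ddiv_ge0.
Qed.

End coercivity.

Lemma bound_at_zero (R : realType) (s : nat) (B : normedModType R)
    (g : 'rV[R]_s -> B) (r : 'I_s -> R) (K delta : R) y :
  (forall nu, `|mpartial nu g y| <= K * ((mdeg nu)`!%:R `^ delta / mpow r nu)) ->
  `|g y| <= K.
Proof.
move=> /(_ [ffun=> 0%N]); rewrite /mpartial -/(mlist _).
have d0 : mdeg ([ffun=> 0%N] : {ffun 'I_s -> nat}) = 0%N.
  by rewrite /mdeg; apply: big1 => j _; rewrite ffunE.
rewrite (_ : mlist _ = [::]); last by apply/size0nil; rewrite size_mlist.
rewrite d0 powR1 /mpow big1 ?divr1 ?mulr1// => j _.
by rewrite ffunE expr0.
Qed.

Lemma admissible_gt0 d m : admissible d m -> (0 < m)%N.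
Proof.
by rewrite /admissible => /or4P[||| /orP[]] /andP[_]; [|move/andP=> []..|move/eqP=> ->].
Qed.

Theorem theorem4p1 (R : realType) (d m s : nat) (D : lipschitz_domain R d)
    (Cm abar bbar fbar delta : R) (U : set 'rV[R]_s) (r : 'I_s -> R)
    (a b : 'rV[R]_s -> Linf D) (f : 'rV[R]_s -> Hm1 D)
    (CA ubar : R)
    (dm_adm : admissible d m)
    (Cm_gt0 : 0 < Cm) (Cm_emb : sobolev_embedding D m Cm)
    (u : 'rV[R]_s -> solution_space Cm_gt0 Cm_emb) :
  (0 < s)%N -> 0 < fbar -> open U -> 1 <= delta -> (forall j, 0 < r j) ->
  (forall y, U y ->
    {ae lebesgue_on D, forall x, 1 <= a y x <= abar / 2}) ->
  (forall y, U y -> {ae lebesgue_on D, forall x, `|b y x| <= bbar / 2}) ->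
  (forall y, U y -> `|f y| <= fbar / 2) ->
  smooth_on U a -> smooth_on U b -> smooth_on U f ->
  (forall nu y, U y -> `|mpartial nu a y| <=
    abar / 2 * ((mdeg nu)`!%:R `^ delta / mpow (fun j => 2 * r j) nu)) ->
  (forall nu y, U y -> `|mpartial nu b y| <=
    bbar / 2 * ((mdeg nu)`!%:R `^ delta / mpow (fun j => 2 * r j) nu)) ->
  (forall nu y, U y -> `|mpartial nu f y| <=
    fbar / 2 * ((mdeg nu)`!%:R `^ delta / mpow (fun j => 2 * r j) nu)) ->
  (exists gamma : R, [/\ 0 < gamma < 1,
      bbar / 2 = gamma / (m%:R * fbar ^+ m.-1),
      CA = 1 - gamma &
      ubar = if m == 1%N then fbar / (1 - gamma) else fbar]) \/
  [/\ forall y, U y -> {ae lebesgue_on D, forall x, 0 <= b y x},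
      odd m, CA = 1 & ubar = fbar] ->
  (forall y, U y -> `|u y| <= ubar) ->
  (forall y, U y -> weak_solution m Cm (a y) (b y) (f y) (u y)) ->
  gevrey delta U u /\
  forall nu : {ffun 'I_s -> nat}, nu != [ffun=> 0%N] -> forall y, U y ->
    `|mpartial nu u y| <=
      const_Cu m abar bbar CA ubar *
      const_rho m abar bbar CA ubar ^+ (mdeg nu).-1 *
      ffact_half R (mdeg nu) / mpow r nu *
      (mdeg nu)`!%:R `^ (delta - 1)
    /\
    H10_norm (mpartial nu u y) <=
      const_Cu m abar bbar CA ubar *
      const_rho m abar bbar CA ubar ^+ (mdeg nu).-1 *
      (mdeg nu)`!%:R `^ delta / (Cm * mpow r nu).
Proof.
move=> s0 fbar0 oU delta1 r0 aP bP fP sa sb sf ba bb bf AB uub sol.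
have m0 := admissible_gt0 dm_adm.
pose A y := diffusion Cm_gt0 Cm_emb (a y).
pose T y := reaction Cm_gt0 Cm_emb (b y).
pose F y := load Cm_gt0 Cm_emb (f y).
have r20 j : 0 < 2 * r j by rewrite mulr_gt0.
have na y : U y -> `|a y| <= abar / 2 by move=> Uy; exact: bound_at_zero (fun nu => ba nu y Uy).
have nb y : U y -> `|b y| <= bbar / 2 by move=> Uy; exact: bound_at_zero (fun nu => bb nu y Uy).
have [CA0 CA1 fu co] : [/\ 0 < CA, CA <= 1, fbar <= ubar & coercive U m CA A T u].
  case: AB => [[gamma [/andP[g0 g1] bE CAE uE]]|[b0 om CAE uE]].
    have g1' : 0 < 1 - gamma by rewrite subr_gt0.
    split; rewrite ?CAE//.
    - by rewrite gerBl ltW.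
    - rewrite uE; case: ifP => // _.
      by rewrite ler_pdivlMr// ler_piMr ?(ltW fbar0)// gerBl ltW.
    - move=> y' y Uy' Uy v; apply: (@coercive_small _ _ _ _ _ m0 _ _ _ _ _ _ _ gamma fbar bbar ubar) => //.
      + by apply: filterS (aP y' Uy') => x /andP[].
      + exact: nb.
      + exact: uub.
      + exact: uub.
  split; rewrite ?CAE ?uE// => y' y Uy' Uy v; rewrite mul1r.
  apply: coercive_monotone => //; last exact: b0.
  by apply: filterS (aP y' Uy') => x /andP[].
have sA : smooth_on U A := smooth_on_comp (diffusion_lin Cm_gt0 Cm_emb)
  (diffusion_norm Cm_gt0 Cm_emb) oU sa.
have sT : smooth_on U T := smooth_on_comp (reaction_lin Cm_gt0 Cm_emb)
  (reaction_norm Cm_gt0 Cm_emb) oU sb.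
have sF : smooth_on U F := smooth_on_comp (load_lin Cm_gt0 Cm_emb)
  (load_norm Cm_gt0 Cm_emb) oU sf.
have solf : solves U m A T F u.
  by move=> y Uy; apply: weak_solution_form; exact: sol.
have su : smooth_on U u.
  have /smooth_onP cA := sA; have /smooth_onP cT := sT; have /smooth_onP cF := sF.
  apply/smooth_onP => k.
  exact: (solves_Ck (@solution_space_complete R d D m Cm m0 Cm_gt0 Cm_emb) oU CA0
    solf co (cA k) (cT k) (cF k)).
set Cu := const_Cu m abar bbar CA ubar; set rho := const_rho m abar bbar CA ubar.
have rho2 : 2 <= rho by rewrite /rho /const_rho le_max lexx.
(* The sign of [Cu] is proved at a point of [U], since only there do the norm bounds force [abar]
   and [bbar] to be nonnegative. *)
have main y : U y -> [/\ 0 <= Cu & forall nu, nu != [ffun=> 0%N] ->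
    `|mpartial nu u y| <=
      Cu * rho ^+ (mdeg nu).-1 * ffact_half R (mdeg nu) / mpow r nu *
      (mdeg nu)`!%:R `^ (delta - 1)].
  move=> Uy; have abar0 : 0 <= abar / 2 by exact: le_trans (na y Uy).
  have bbar0 : 0 <= bbar / 2 by exact: le_trans (nb y Uy).
  have a0 : 0 <= abar by move: abar0; rewrite pmulr_lge0.
  have b0 : 0 <= bbar by move: bbar0; rewrite pmulr_lge0.
  have u0 : 0 < ubar by exact: lt_le_trans fu.
  have Cu0 : 0 <= Cu.
    rewrite /Cu /const_Cu !mulr_ge0 ?invr_ge0 ?(ltW CA0) ?(ltW u0)//.
    by rewrite addr_ge0// addr_ge0// mulr_ge0// exprn_ge0// ltW.
  split=> // nu nu0.
  have num := rho_large m0 a0 b0 fbar0 fu CA0 CA1 (erefl Cu) (erefl rho).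
  have f20 : 0 <= fbar / 2 by rewrite divr_ge0// ltW.
  have co' v : CA * `|v| <= `|app (linop m A T u y) v| by exact: co.
  have w0 := @gweight_ge0 s R r delta r0.
  have := @solution_bound R _ s U oU y Uy (sorted (@ord_le s)) (gweight r delta) rho
    (@sorted_splits s) w0 (@gweight_splits s R r delta r0 delta1)
    rho2 m CA A T F u (abar / 2) (bbar / 2) (fbar / 2) ubar Cu
    solf co' sA sT sF su.
  have jA n := jet_comp (diffusion_lin Cm_gt0 Cm_emb) (diffusion_norm Cm_gt0 Cm_emb)
    oU Uy w0 sa (jet_of_bound r0 rho2 abar0 (na y Uy) (fun nu => ba nu y Uy) n).
  have jT n := jet_comp (reaction_lin Cm_gt0 Cm_emb) (reaction_norm Cm_gt0 Cm_emb)
    oU Uy w0 sb (jet_of_bound r0 rho2 bbar0 (nb y Uy) (fun nu => bb nu y Uy) n).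
  have jF n := jet_comp (load_lin Cm_gt0 Cm_emb) (load_norm Cm_gt0 Cm_emb)
    oU Uy w0 sf (jet_of_bound r0 rho2 f20 (fP y Uy) (fun nu => bf nu y Uy) n).
  (* A jet of order n bounds derivatives of order below n, hence the successor. *)
  move=> /(_ jA jT jF (uub y Uy) CA0 Cu0 num (mdeg nu).+1)[_].
  move=> /(_ (mlist nu) (sorted_mlist nu)).
  have n0 : mdeg nu != 0%N.
    apply: contra nu0 => /eqP n0; apply/eqP/ffunP => j; rewrite ffunE.
    by apply/eqP; move/eqP: n0; rewrite sum_nat_eq0 => /forallP /(_ j).
  rewrite /nilp size_mlist => /(_ n0 (ltnSn _)); rewrite gweight_mlist /gfac.
  rewrite -/(mpartial nu u).
  have p0 := mpow_gt0 r0 nu.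
  have q0 : 0 < (mdeg nu)`!%:R `^ (delta - 1) by rewrite powR_gt0 ?ltr0n ?fact_gt0.
  rewrite -ler_pdivlMr ?divr_gt0// => /le_trans; apply.
  by rewrite le_eqVlt; apply/predU1P; left; field; rewrite !gt_eqF.
have weaker y nu : U y -> nu != [ffun=> 0%N] -> `|mpartial nu u y| <=
    Cu * rho ^+ (mdeg nu).-1 * (mdeg nu)`!%:R `^ delta / mpow r nu.
  move=> Uy nu0; have [Cu0 /(_ nu nu0) H] := main y Uy.
  have p0 := mpow_gt0 r0 nu.
  rewrite (le_trans H)// [leLHS](_ : _ = Cu * rho ^+ (mdeg nu).-1 / mpow r nu *
    (ffact_half R (mdeg nu) * (mdeg nu)`!%:R `^ (delta - 1))); last by ring.
  rewrite [leRHS]mulrAC ler_wpM2l//.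
    by rewrite divr_ge0 ?(ltW p0)// mulr_ge0// exprn_ge0// (le_trans _ rho2).
  by rewrite [leRHS](fact_powR delta) [leLHS]mulrC ler_wpM2l ?powR_ge0// ffact_half_le_fact.
split; last first.
  move=> nu nu0 y Uy; split; first by have [_] := main y Uy; exact.
  have := weaker y nu Uy nu0; rewrite solution_normE => H.
  by rewrite invfM mulrCA ler_pdivlMl.
split => // y0 Uy0; have [Cu0 _] := main y0 Uy0.
have rho0 : 0 < rho by exact: lt_le_trans rho2.
have u0 : 0 < ubar by exact: lt_le_trans fu.
(* [ubar] covers nu = 0 and [Cu] the other indices; dividing the radii by rho absorbs rho^(n-1) <=
   rho^n. The bounds are uniform, so [U] itself is the neighbourhood. *)
exists U, (ubar + Cu), (fun j => r j / rho); split => //.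
  by split=> [|j]; [exact: ltr_wpDr|rewrite divr_gt0].
move=> nu y Uy; have p0 := mpow_gt0 r0 nu.
have mE : (mpow (fun j => r j / rho) nu)^-1 = rho ^+ mdeg nu / mpow r nu.
  rewrite /mpow /mdeg expr_sum -prodfV -prodf_div; apply: eq_bigr => j _.
  by rewrite exprMn invfM exprVn invrK mulrC.
rewrite mE; have [->|nu0] := eqVneq nu [ffun=> 0%N].
  rewrite /mpartial -/(mlist _).
  have d0 : mdeg ([ffun=> 0%N] : {ffun 'I_s -> nat}) = 0%N.
    by rewrite /mdeg; apply: big1 => j _; rewrite ffunE.
  rewrite (_ : mlist _ = [::]); last by apply/size0nil; rewrite size_mlist.
  rewrite d0 powR1 /mpow big1 ?divr1 ?mulr1 => [|j _]; last by rewrite ffunE.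
  by rewrite (le_trans (uub y Uy))// lerDl.
rewrite (le_trans (weaker y nu Uy nu0))//.
set fd := _ `^ delta.
rewrite [leLHS](_ : _ = Cu * rho ^+ (mdeg nu).-1 * (fd / mpow r nu)); last by ring.
rewrite [leRHS](_ : _ = (ubar + Cu) * rho ^+ mdeg nu * (fd / mpow r nu)); last by ring.
apply: ler_wpM2r; first by rewrite divr_ge0 ?powR_ge0 ?(ltW p0).
apply: ler_pM => //; first by rewrite exprn_ge0// ltW.
  by rewrite lerDr ltW.
by rewrite ler_weXn2l ?leq_pred// (le_trans _ rho2)// ler1n.
Qed.
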